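(* Let $P\in\mathcal{O}\setminus\{0\}$, $P(0)=0$, and $s>0$. Let $\mathcal{L}$, $H_{\mathcal L}$ and the set $\mathcal{Z}_{\mathcal L}\subset\mathbb{P}^1_{\mathbb C}$ of zeros of $H_{\mathcal L}$ be as defined in the context. Put $\mathcal{Z}=\mathcal{Z}_{\mathcal L}$ if $H_{\mathcal L}$ is not constant, and $\mathcal{Z}=\{\xi\}$ with an arbitrary $\xi\in\mathbb{P}^1_{\mathbb C}$ otherwise. Let $\hat f\in\hat{\mathcal{O}}$ be such that $\hat f\circ b_\xi$ is a $P\circ b_\xi$-$s$-Gevrey asymptotic series for every $\xi\in\mathcal{Z}$. Then $\hat f$ is a $P$-$s$-Gevrey asymptotic series.
   Context: Fix an integer $d\ge2$. $D(0;r)=\{x\in\mathbb{C}^d:|x_j|<r\ \forall j\}$. $\mathcal{O}=\mathbb{C}\{x_1,\dots,x_d\}$, $\hat{\mathcal{O}}=\mathbb{C}[[x_1,\dots,x_d]]$ with maximal ideal $\mathfrak{m}$; $\mathcal{O}_b(U)$ = bounded holomorphic functions on $U$; $J(f)$ = power series of $f$ at $0$. For $v\in\mathbb{C}^d$ write $v''=(v_3,\dots,v_d)$. For a germ $Q\in\mathcal{O}\setminus\{0\}$ with $Q(0)=0$: $\hat f\in\hat{\mathcal{O}}$ is a $Q$-$s$-Gevrey (asymptotic) series if there are $\rho,K,A>0$ and a sequence $\{f_n\}_{n\in\mathbb{N}}$ in $\mathcal{O}_b(D(0;\rho))$ with $|f_n(x)|\le KA^n\Gamma(sn+1)$ for all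 $n$ and $x\in D(0;\rho)$, and $J(f_n)\equiv\hat f\bmod Q^n\hat{\mathcal{O}}$ for all $n$. Blow-up charts: $\mathbb{P}^1_{\mathbb C}=\mathbb{C}\cup\{\infty\}$ with $\xi\in\mathbb{C}$ identified with $[1,\xi]$ and $\infty$ with $[0,1]$; $b_\xi(v)=(v_2,(\xi+v_1)v_2,v'')$ for $\xi\in\mathbb{C}$ and $b_\infty(v)=(v_1v_2,v_2,v'')$. Definition of $H_{\mathcal L}$: if $d=2$, put $\mathcal{L}=\emptyset$ and let $H_{\mathcal L}(x_1,x_2)$ be the homogeneous component of lowest degree of $P$. If $d>2$, let $\mathcal{L}:\mathbb{N}^{d-2}\to\mathbb{R}_+$ be an injective linear form; among all exponents $m=(m_3,\dots,m_d)$ such that some term $c\,x_1^{m_1}x_2^{m_2}x_3^{m_3}\cdots x_d^{m_d}$, $c\ne0$, occurs in $P$, let $\mathbf{a}$ be the one with $\mathcal{L}(m)$ minimal; let $P_{\mathcal L}(x_1,x_2)$ be the series in $x_1,x_2$ which is the coefficient of $(x'')^{\mathbf a}$ in $P$, and let $H_{\mathcal L}(x_1,x_2)$ be its homogeneous component of lowest degree. $\mathcal{Z}_{\mathcal L}$ is the set of zeros of $H_{\mathcal L}$ in $\mathbb{P}^1_{\mathbb C}$, where $H_{\mathcal L}(\xi)=H_{\mathcal L}(1,\xi)$ for $\xi\in\mathbb{C}$ and $H_{\mathcal L}(\infty)=H_{\mathcal L}(0,1)$. *)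

(* Defs.v *)
From mathcomp Require Import all_boot all_order all_algebra finmap.
From mathcomp Require Import complex.
From mathcomp Require Import all_classical all_reals all_analysis.
From mathcomp Require Import summability.

Set Implicit Arguments.
Unset Strict Implicit.
Unset Printing Implicit Defensive.

Import Order.TTheory GRing.Theory Num.Theory.
Import numFieldNormedType.Exports.

Local Open Scope classical_set_scope.
Local Open Scope ring_scope.
Local Open Scope complex_scope.

(* Exponents in N^d; addition and 0 are those of the nmodType of finite
   functions. *)
Notation expo d := {ffun 'I_d -> nat}.

Definition expo_deg (d : nat) (m : expo d) : nat := (\sum_(i < d) m i)%N.

(* The formal power series \sum_m p(m) x^m, given by its coefficients. *)
Definition fps (K : Type) (d : nat) : Type := expo d -> K.

Section FormalSeries.
Variable K : comNzRingType.

Definition fpsC (d : nat) (c : K) : fps K d := fun m => if m == 0 then c else 0.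

Definition fpsX (d : nat) (i : 'I_d) : fps K d :=
  fun m => (m == [ffun j => nat_of_bool (j == i)])%:R.

(* For every m the index set below is finite. *)
Definition fpsM (d : nat) (p q : fps K d) : fps K d :=
  fun m => \sum_(ab \in [set ab : expo d * expo d | ab.1 + ab.2 = m])
             p ab.1 * q ab.2.

Definition fpsXn (d : nat) (p : fps K d) (n : nat) : fps K d :=
  iter n (fpsM p) (fpsC 1).

(* Substitution x_i := g_i of series without constant term: the coefficient of
   y^k in \prod_i g_i^(m_i) vanishes when the degree of m exceeds that of k, so
   the sum has finite support. *)
Definition fps_comp (d e : nat) (p : fps K d) (g : 'I_d -> fps K e) : fps K e :=
  fun k => \sum_(m \in [set: expo d])
             p m * (\big[@fpsM e/fpsC 1]_(i < d) fpsXn (g i) (m i)) k.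

Definition fps_congr (d : nat) (q p1 p2 : fps K d) : Prop :=
  exists h : fps K d, p1 \- p2 = fpsM q h.

Definition monomial (d : nat) (z : 'rV[K]_d) (m : expo d) : K :=
  \prod_(i < d) z 0 i ^+ m i.

Definition fps_order (d : nat) (p : fps K d) : nat :=
  xget 0%N [set n | (exists2 m, p m != 0 & expo_deg m = n) /\
                    (forall m, p m != 0 -> (n <= expo_deg m)%N)].

Definition fps_lowest (d : nat) (p : fps K d) : fps K d :=
  fun m => if expo_deg m == fps_order p then p m else 0.

(* Only used for polynomials, for which the sum has finite support. *)
Definition fps_eval (d : nat) (p : fps K d) (z : 'rV[K]_d) : K :=
  \sum_(m \in [set: expo d]) p m * monomial z m.

Definition fps_constant (d : nat) (p : fps K d) : Prop :=
  exists c : K, p = fpsC c.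

(* [Some xi] is the point [1, xi] and [None] is the point at infinity [0, 1]. *)
Definition proj_line : Type := option K.

Definition proj_rep (xi : proj_line) : 'rV[K]_2 :=
  match xi with
  | Some c => \row_(j < 2) (if j == 0 then 1 else c)
  | None => \row_(j < 2) (if j == 0 then 0 else 1)
  end.

(* The components of the blow-up chart, in dimension d.+2. *)
Definition blowup (d : nat) (xi : proj_line) (i : 'I_d.+2) : fps K d.+2 :=
  let i1 : 'I_d.+2 := @Ordinal d.+2 0 isT in
  let i2 : 'I_d.+2 := @Ordinal d.+2 1 isT in
  match xi with
  | Some c => if i == i1 then fpsX i2
              else if i == i2 then fpsM (fpsC c \+ fpsX i1) (fpsX i2)
              else fpsX i
  | None => if i == i1 then fpsM (fpsX i1) (fpsX i2) else fpsX i
  end.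

(* The exponent (m1, m2, m3, ...) from (m1, m2) and m'' = (m3, ...). *)
Definition expo_cat (d : nat) (m : expo 2) (m'' : expo d) : expo d.+2 :=
  [ffun i : 'I_(2 + d) => match fintype.split i with inl j => m j | inr j => m'' j end].

Definition zero_set (H : fps K 2) : set proj_line :=
  [set xi | fps_eval H (proj_rep xi) = 0].

End FormalSeries.

(* In dimension 2 (d = 0) the only linear form on N^0 is zero, the only exponent
   is the empty one, and [P_L L P] is P itself. *)
Section LowestForm.
Variables (R : realType) (d : nat) (L : expo d -> R) (P : fps R[i] d.+2).

Definition occurs (m'' : expo d) : Prop :=
  exists m : expo 2, P (expo_cat m m'') != 0.

Definition min_expo : expo d :=
  xget 0 [set a | occurs a /\ (forall b, occurs b -> L a <= L b)].

Definition P_L : fps R[i] 2 := fun m => P (expo_cat m min_expo).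

Definition H_L : fps R[i] 2 := fps_lowest P_L.

End LowestForm.

Section Gevrey.
Variable R : realType.

Definition polydisc (d : nat) (a : 'rV[R[i]]_d) (r : R) : set 'rV[R[i]]_d :=
  [set z | forall j : 'I_d, `|z 0 j - a 0 j| < r%:C].

(* Unconditional (equivalently, absolute) convergence of p at z, with sum l. *)
Definition fps_sums_to (d : nat) (p : fps R[i] d) (z : 'rV[R[i]]_d) (l : R[i]) :
    Prop :=
  partial_sum (fun m : expo d => p m * monomial z m) @ totally --> (l : R[i]^o).

Definition fps_convergent (d : nat) (p : fps R[i] d) : Prop :=
  exists2 r : R, 0 < r &
    forall z, polydisc 0 r z -> exists l : R[i], fps_sums_to p z l.

Definition power_series_at (d : nat) (f : 'rV[R[i]]_d -> R[i]) (a : 'rV[R[i]]_d)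
    (p : fps R[i] d) : Prop :=
  exists2 r : R, 0 < r & forall z, polydisc a r z -> fps_sums_to p (z - a) (f z).

Definition holomorphic_on (d : nat) (U : set 'rV[R[i]]_d)
    (f : 'rV[R[i]]_d -> R[i]) : Prop :=
  forall a, U a -> exists p : fps R[i] d, power_series_at f a p.

Definition bounded_holomorphic_on (d : nat) (U : set 'rV[R[i]]_d)
    (f : 'rV[R[i]]_d -> R[i]) : Prop :=
  holomorphic_on U f /\ exists M : R, forall z, U z -> `|f z| <= M%:C.

Definition Gamma (x : R) : R :=
  (\int[lebesgue_measure]_(t in `]0, +oo[) (t `^ (x - 1) * expR (- t)))%R.

Definition gevrey (d : nat) (Q : fps R[i] d) (s : R) (fhat : fps R[i] d) :
    Prop :=
  exists (rho K A : R) (f : nat -> 'rV[R[i]]_d -> R[i]),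
    [/\ [/\ 0 < rho, 0 < K & 0 < A],
        forall n, bounded_holomorphic_on (polydisc 0 rho) (f n),
        forall n x, polydisc 0 rho x ->
          `|f n x| <= (K * A ^+ n * Gamma (s * n%:R + 1))%:C &
        forall n, exists2 J : fps R[i] d, power_series_at (f n) 0 J &
          fps_congr (fpsXn Q n) J fhat].

End Gevrey.

(* Main.v *)
Require Import Defs.
From HB Require Import structures.
From mathcomp Require Import all_boot all_order all_algebra finmap.
From mathcomp Require Import ring lra zify.
From mathcomp Require Import cyclic separable cyclotomic complex.
From mathcomp Require Import all_classical all_reals all_analysis.
From mathcomp Require Import summability.

Set Implicit Arguments.
Unset Strict Implicit.
Unset Printing Implicit Defensive.

Import Order.TTheory GRing.Theory Num.Theory.
Import numFieldNormedType.Exports.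
Local Open Scope classical_set_scope.
Local Open Scope ring_scope.
Local Open Scope complex_scope.

(** Collect the terms of a series by the exponent [a] of the variables [x''] and by
    the total degree [n] in [x1, x2]. The coefficient of index [(n, a)] is a form of
    degree [n] in two variables, and composition with the chart [blowup xi] only
    expands this form at the point [xi] of the projective line ([expand_comp]).
    Composition with all charts at once is therefore a ring homomorphism,
    [pullback], into series indexed by [(n, a)] whose coefficients are families of
    power series in one variable, one for each point [xi]. Such a family is normed
    by the largest of the norms of its members on small discs.

    For the weight [n + K * L a] with [K] large, [P] has a single term of minimal
    weight, and its coefficient is the form [H_L] ([lead_gap]). This form is a
    product of linear forms that vanish at points of [Z] ([form_factor]). A family
    of series can be divided by the linear form that vanishes at [z]: subtract the
    value at [z], extended to a form of the same degree, and divide the difference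
    in every chart ([divide_at]). This operation is bounded uniformly in the degree
    and maps forms to forms; if [H_L] is constant, then there is nothing to divide,
    and the single point of [Z] only provides a norm.

    By successive approximation every series, convergent or not, can be divided by
    [P], with a bounded quotient and remainder if the series is bounded and the
    radii are small ([quotient_nb]), and with forms as coefficients if the series
    has forms as coefficients ([quotient_closed]). Congruent series have the same
    remainder ([quotientD]). Let now [g] be the approximations of order [n] of
    [fhat] in the charts. The pull back of [fhat] is congruent to [g], so the two
    have a common remainder: it is bounded because [g] is, and it comes from a
    series in the original variables because the pull back of [fhat] does. Repeat
    this with the quotients. After [n] steps [fhat] is approximated modulo the power
    [n] of [P] by a series whose norm is the bound for [g] times the power [n] of a
    constant ([approximation]); it is essential that the radii do not shrink from
    one step to the next. The norm in the charts controls the coefficients of a form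
    up to a factor that is geometric in its degree ([form_coef_le]), which costs one
    final reduction of the radius.

    The passage between holomorphic functions and coefficients consists of the
    Cauchy estimates ([cauchy_estimate]) and of the holomorphy of the sum of a power
    series ([power_series_function]). *)

(** * Series with exponents in a monoid *)

(** Every exponent has finitely many decompositions as a sum, so that the Cauchy
    product of two arbitrary families of coefficients is defined. *)
HB.mixin Record hasFiniteBelow I of GRing.Nmodule I := {
  below : I -> seq I;
  belowP : forall a b : I, a \in below (a + b);
  addm_inj : forall a : I, injective (fun b : I => a + b)
}.

#[short(type="expMonoidType")]
HB.structure Definition ExpMonoid := {I of GRing.Nmodule I & hasFiniteBelow I}.

Section Decompositions.
Variable I : expMonoidType.
Implicit Types m a b : I.

Definition decomp m : seq (I * I) :=
  undup [seq ab <- [seq (a, b) | a <- below m, b <- below m] | ab.1 + ab.2 == m].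

Lemma mem_decomp m (ab : I * I) : (ab \in decomp m) = (ab.1 + ab.2 == m).
Proof.
case: ab => a b; rewrite mem_undup mem_filter /=; case: eqP => //= <-.
apply/allpairsP; exists (a, b); split => //=; first exact: belowP.
by rewrite addrC; exact: belowP.
Qed.

Lemma decomp_uniq m : uniq (decomp m).
Proof. exact: undup_uniq. Qed.

Lemma big_decompC (V : nmodType) m (F : I -> I -> V) :
  \sum_(ab <- decomp m) F ab.1 ab.2 = \sum_(ab <- decomp m) F ab.2 ab.1.
Proof.
rewrite -(big_map (fun ab : I * I => (ab.2, ab.1)) xpredT (fun ab => F ab.1 ab.2)).
apply/perm_big/uniq_perm; first exact: decomp_uniq.
  by rewrite map_inj_uniq ?decomp_uniq// => -[? ?] [? ?] [-> ->].
move=> [a b]; rewrite mem_decomp /=; apply/idP/mapP => [e|[[c d]]].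
  by exists (b, a) => //; rewrite mem_decomp /= addrC.
by rewrite mem_decomp => /= e [-> ->]; rewrite addrC.
Qed.

Lemma big_decomp0 (V : nmodType) m (F : I -> I -> V) :
  (forall a b, a != 0 -> F a b = 0) ->
  \sum_(ab <- decomp m) F ab.1 ab.2 = F 0 m.
Proof.
move=> F0; rewrite (bigD1_seq (0, m)) ?decomp_uniq ?mem_decomp ?add0r//=.
rewrite big_seq_cond big1 ?addr0// => -[a b] /andP[]; rewrite mem_decomp /= => /eqP <-.
by have [->|/F0->//] := eqVneq a 0; rewrite add0r eqxx.
Qed.

(** Both sides run over the ways to write [m] as a sum of three exponents. *)
Lemma big_decompA (V : nmodType) m (F : I -> I -> I -> V) :
  \sum_(xc <- decomp m) \sum_(ab <- decomp xc.1) F ab.1 ab.2 xc.2 =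
  \sum_(ax <- decomp m) \sum_(bc <- decomp ax.2) F ax.1 bc.1 bc.2.
Proof.
pose G (t : I * I * I) := F t.1.1 t.1.2 t.2.
transitivity (\sum_(t <- [seq (ab, xc.2) | xc <- decomp m, ab <- decomp xc.1]) G t).
  by rewrite big_allpairs_dep.
transitivity (\sum_(t <- [seq (ax.1, bc.1, bc.2) | ax <- decomp m, bc <- decomp ax.2]) G t);
  last by rewrite big_allpairs_dep.
apply/perm_big/uniq_perm.
- apply: allpairs_uniq_dep => [|x _|]; [exact: decomp_uniq|exact: decomp_uniq|].
  move=> [[x c] [a b]] [[y e] [a' b']] /allpairsPdep[[? ?] [[? ?] [+ + [? ? ? ?]]]].
  subst; rewrite !mem_decomp /= => /eqP ? /eqP ?; subst.
  move=> /allpairsPdep[[? ?] [[? ?] [+ + [? ? ? ?]]]].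
  by subst; rewrite !mem_decomp /= => /eqP ? /eqP ? [? ? ?]; subst.
- apply: allpairs_uniq_dep => [|x _|]; [exact: decomp_uniq|exact: decomp_uniq|].
  move=> [[x c] [a b]] [[y e] [a' b']] /allpairsPdep[[? ?] [[? ?] [+ + [? ? ? ?]]]].
  subst; rewrite !mem_decomp /= => /eqP ? /eqP ?; subst.
  move=> /allpairsPdep[[? ?] [[? ?] [+ + [? ? ? ?]]]].
  by subst; rewrite !mem_decomp /= => /eqP ? /eqP ? [? ? ?]; subst.
move=> [[a b] c]; apply/allpairsPdep/allpairsPdep => -[[x y] [[z t] [+ + [? ? ?]]]];
  subst; rewrite !mem_decomp /= => /eqP ? /eqP ?; subst.
  by exists (z, t + y), (t, y); rewrite !mem_decomp /= addrA !eqxx.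
by exists (x + z, t), (x, z); rewrite !mem_decomp /= addrA !eqxx.
Qed.

End Decompositions.

(** The exponents are a parameter because the same product is used for all the
    variables, for one variable, and for series whose coefficients are series. *)
Definition ser (I : expMonoidType) (K : Type) : Type := I -> K.

HB.instance Definition _ (I : expMonoidType) (K : zmodType) :=
  GRing.Zmodule.copy (ser I K) (I -> K).

Section SerRing.
Variables (I : expMonoidType) (K : comNzRingType).
Implicit Types f g h : ser I K.

Definition ser_one : ser I K := fun m => (m == 0)%:R.
Definition ser_mul f g : ser I K :=
  fun m => \sum_(ab <- decomp m) f ab.1 * g ab.2.

Lemma ser_mulA : associative ser_mul.
Proof.
move=> f g h; apply/funext => m; rewrite /ser_mul.
under eq_bigr do rewrite big_distrr /=.
under [RHS]eq_bigr do rewrite big_distrl /=.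
under [RHS]eq_bigr do under eq_bigr do rewrite -mulrA.
by rewrite (big_decompA m (fun a b c => f a * (g b * h c))).
Qed.

Lemma ser_mulC : commutative ser_mul.
Proof.
move=> f g; apply/funext => m; rewrite /ser_mul.
rewrite (big_decompC _ (fun a b => f a * g b)).
by apply: eq_bigr => ab _; rewrite mulrC.
Qed.

Lemma ser_mul1 : left_id ser_one ser_mul.
Proof.
move=> f; apply/funext => m; rewrite /ser_mul.
rewrite (@big_decomp0 _ _ _ (fun a b => ser_one a * f b)) /ser_one ?eqxx ?mul1r//.
by move=> a b /negPf->; rewrite mul0r.
Qed.

Lemma ser_mulDl : left_distributive ser_mul +%R.
Proof.
move=> f g h; apply/funext => m; rewrite /ser_mul.
by rewrite -[RHS]big_split; apply: eq_bigr => ab _; exact: mulrDl.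
Qed.

Lemma ser_one_neq0 : ser_one != 0 :> ser I K.
Proof.
apply/eqP => /(congr1 (fun f => f 0)); rewrite /ser_one eqxx; apply/eqP.
exact: oner_neq0.
Qed.

HB.instance Definition _ := GRing.Zmodule_isComNzRing.Build (ser I K)
  ser_mulA ser_mulC ser_mul1 ser_mulDl ser_one_neq0.

Lemma serM f g m : (f * g) m = \sum_(ab <- decomp m) f ab.1 * g ab.2.
Proof. by []. Qed.

Lemma serD f g m : (f + g) m = f m + g m.
Proof. by []. Qed.

Lemma serN f m : (- f) m = - f m.
Proof. by []. Qed.

Lemma serB f g m : (f - g) m = f m - g m.
Proof. by []. Qed.

Lemma ser1 m : (1 : ser I K) m = (m == 0)%:R.
Proof. by []. Qed.

Definition mono (i : I) (c : K) : ser I K := fun m => if m == i then c else 0.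

Lemma monoM i j c e : mono i c * mono j e = mono (i + j) (c * e).
Proof.
apply/funext => m; rewrite serM /mono; case: eqP => [->|mij].
  rewrite (bigD1_seq (i, j)) ?decomp_uniq ?mem_decomp//= !eqxx.
  rewrite big_seq_cond big1 ?addr0// => -[a b] /andP[]; rewrite mem_decomp xpair_eqE /= => /eqP ab.
  case: eqP => [ai|]; last by rewrite mul0r.
  case: eqP => [bj|]; last by rewrite mulr0.
  by [].
rewrite big_seq_cond big1// => -[a b] /andP[]; rewrite mem_decomp /= => /eqP ab _.
case: eqP => [ai|]; last by rewrite mul0r.
case: eqP => [bj|]; last by rewrite mulr0.
by case: mij; rewrite -ab ai bj.
Qed.

Lemma mono0 : mono 0 1 = 1.
Proof. by apply/funext => m; rewrite /mono ser1; case: eqP. Qed.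

Lemma monoD i c e : mono i (c + e) = mono i c + mono i e.
Proof. by apply/funext => m; rewrite serD /mono; case: eqP; rewrite ?addr0. Qed.

Lemma monoN i c : mono i (- c) = - mono i c.
Proof. by apply/funext => m; rewrite serN /mono; case: eqP; rewrite ?oppr0. Qed.

Lemma monoX i c n : mono i c ^+ n = mono (i *+ n) (c ^+ n).
Proof.
elim: n => [|n IH]; first by rewrite expr0 mulr0n mono0.
by rewrite exprS IH monoM -mulrS -exprS.
Qed.

End SerRing.

Lemma nat_belowP (a b : nat) : a \in iota 0 (a + b)%R.+1.
Proof. by rewrite mem_iota /= add0n ltnS; exact: leq_addr. Qed.
Lemma nat_addm_inj (a : nat) : injective (fun b : nat => (a + b)%R).
Proof. by move=> b c; exact: addnI. Qed.
HB.instance Definition _ := @hasFiniteBelow.Build nat (fun n => iota 0 n.+1) nat_belowP nat_addm_inj.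

Section ExpoInstance.
Variable d : nat.
Implicit Types m a b : expo d.

Definition expo_box (n : nat) : seq (expo d) :=
  [seq [ffun i => nat_of_ord (f i)] | f : {ffun 'I_d -> 'I_n} <- enum {ffun 'I_d -> 'I_n}].

Lemma mem_expo_box n m : (m \in expo_box n) = [forall i, (m i < n)%N].
Proof.
apply/mapP/forallP => [[f _ ->] i|mn]; first by rewrite ffunE ltn_ord.
exists [ffun i => Ordinal (mn i)]; first by rewrite mem_enum.
by apply/ffunP => i; rewrite !ffunE.
Qed.

Lemma expo_box_uniq n : uniq (expo_box n).
Proof.
rewrite map_inj_uniq ?enum_uniq// => f g fg; apply/ffunP => i; apply/val_inj.
by move/ffunP/(_ i): fg; rewrite !ffunE.
Qed.

Lemma expoD a b i : (a + b) i = (a i + b i)%N.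
Proof. by rewrite ffunE. Qed.

Lemma expo0 i : (0 : expo d) i = 0%N.
Proof. by rewrite ffunE. Qed.

Lemma leq_expo_deg m i : (m i <= expo_deg m)%N.
Proof. by rewrite /expo_deg (bigD1 i)//= leq_addr. Qed.

Lemma expo_degD a b : expo_deg (a + b) = (expo_deg a + expo_deg b)%N.
Proof. by rewrite /expo_deg -big_split; apply: eq_bigr => i _; rewrite expoD. Qed.

Lemma expo_belowP a b : a \in expo_box (expo_deg (a + b)).+1.
Proof.
rewrite mem_expo_box; apply/forallP => i; rewrite ltnS expo_degD.
by rewrite (leq_trans (leq_expo_deg a i))// leq_addr.
Qed.

Lemma expo_addm_inj a : injective (fun b => a + b).
Proof.
move=> b b' /ffunP e; apply/ffunP => i; move: (e i).
by rewrite !expoD => /addnI.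
Qed.

HB.instance Definition _ := @hasFiniteBelow.Build (expo d) (fun m => expo_box (expo_deg m).+1) expo_belowP expo_addm_inj.

End ExpoInstance.

Section PairInstance.
Variables I J : expMonoidType.

Lemma pair_belowP (a b : I * J) :
  a \in [seq (i, j) | i <- below (a + b).1, j <- below (a + b).2].
Proof. by case: a b => [a1 a2] [b1 b2]; apply: allpairs_f; apply: belowP. Qed.

Lemma pair_addm_inj (a : I * J) : injective (fun b => a + b).
Proof. by case: a => [a1 a2] [b1 b2] [c1 c2] [/addm_inj-> /addm_inj->]. Qed.

HB.instance Definition _ := @hasFiniteBelow.Build (I * J)%type
  (fun m => [seq (i, j) | i <- below m.1, j <- below m.2]) pair_belowP pair_addm_inj.
End PairInstance.

Section FpsIsSer.
Variables (K : comNzRingType) (d : nat).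
Implicit Types p q : fps K d.

Lemma fpsME p q : fpsM p q = (p : ser (expo d) K) * q.
Proof.
apply/funext => m; rewrite serM /fpsM [RHS]fsbig_seq ?decomp_uniq//.
suff -> : [set ab : expo d * expo d | ab.1 + ab.2 = m] = [set` decomp m] by [].
by apply/seteqP; split => ab /=; rewrite mem_decomp => /eqP.
Qed.

Lemma fpsCE (c : K) : fpsC c = mono 0 c :> ser (expo d) K.
Proof. by []. Qed.

Lemma fpsXnE p n : fpsXn p n = (p : ser (expo d) K) ^+ n.
Proof.
elim: n => [|n IH]; first by rewrite expr0 -mono0.
by rewrite /fpsXn iterS -/(fpsXn p n) IH fpsME exprS.
Qed.

Lemma fps_congrE q p1 p2 : fps_congr q p1 p2 <->
  exists h : ser (expo d) K, (p1 : ser (expo d) K) - p2 = (q : ser (expo d) K) * h.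
Proof. by split=> -[h e]; exists h; move: e; rewrite fpsME. Qed.

End FpsIsSer.

(** * Finite sums and bounds of norms *)

Section FiniteSums.
Variable R : numDomainType.

Lemma ler_sum_sub (T : eqType) (s1 s2 : seq T) (F : T -> R) :
  uniq s1 -> uniq s2 -> {subset s1 <= s2} -> (forall x, 0 <= F x) ->
  \sum_(x <- s1) F x <= \sum_(x <- s2) F x.
Proof.
move=> u1 u2 s12 F0; rewrite [leRHS](bigID (mem s1)) /= -[X in _ <= X + _]big_filter.
rewrite (_ : \sum_(x <- s1) F x = \sum_(x <- [seq x <- s2 | x \in s1]) F x).
  by rewrite lerDl sumr_ge0.
apply/perm_big/uniq_perm => //; first exact: filter_uniq.
by move=> x; rewrite mem_filter; case: (boolP (x \in s1)) => //= /s12 ->.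
Qed.

Lemma ler_sum_pairs (S T : eqType) (L : seq (S * T)) (x : S -> R) (y : T -> R) :
  uniq L -> (forall a, 0 <= x a) -> (forall b, 0 <= y b) ->
  \sum_(ab <- L) x ab.1 * y ab.2 <=
  (\sum_(a <- undup [seq ab.1 | ab <- L]) x a) *
  (\sum_(b <- undup [seq ab.2 | ab <- L]) y b).
Proof.
move=> uL x0 y0; rewrite big_distrl /=.
under [leRHS]eq_bigr do rewrite big_distrr /=.
rewrite [leRHS](_ : _ = \sum_(ab <- [seq (a, b) |
  a <- undup [seq ab.1 | ab <- L], b <- undup [seq ab.2 | ab <- L]]) x ab.1 * y ab.2);
  last by rewrite big_allpairs_dep.
apply: ler_sum_sub => //; last by move=> ab; rewrite mulr_ge0.
  by apply: allpairs_uniq; rewrite ?undup_uniq// => -[? ?] [? ?] _ _ [-> ->].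
move=> [a b] abL; apply: allpairs_f; rewrite mem_undup.
  by apply/mapP; exists (a, b).
by apply/mapP; exists (a, b).
Qed.

(** A finite piece of a Cauchy product is a sum over distinct pairs, hence at
    most the product of two finite pieces of the factors; the hypotheses on [X]
    and [Y] record which indices can occur. *)
Lemma ler_sum_conv (I : expMonoidType) (phi : I -> I) (s : seq I)
    (c : pred (I * I)) (x y : I -> R) (X Y : R) :
  injective phi -> uniq s -> (forall a, 0 <= x a) -> (forall a, 0 <= y a) ->
  (forall s1, uniq s1 ->
     (forall a, a \in s1 -> exists m b, [/\ m \in s, a + b = phi m & c (a, b)]) ->
     \sum_(a <- s1) x a <= X) ->
  (forall s2, uniq s2 -> (forall b, b \in s2 -> exists a, c (a, b)) ->
     \sum_(b <- s2) y b <= Y) ->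
  \sum_(m <- s) \sum_(ab <- decomp (phi m) | c ab) x ab.1 * y ab.2 <= X * Y.
Proof.
move=> phi_inj us x0 y0 hX hY.
pose L := [seq ab <- flatten [seq decomp (phi m) | m <- s] | c ab].
have memL ab : ab \in L -> exists m, [/\ m \in s, ab.1 + ab.2 = phi m & c ab].
  rewrite mem_filter => /andP[cab /flatten_mapP[m ms]].
  by rewrite mem_decomp => /eqP e; exists m.
have uL : uniq L.
  apply: filter_uniq; elim: s us {hX L memL} => //= m s IH /andP[ms us].
  rewrite cat_uniq decomp_uniq IH// andbT; apply/hasPn => ab /flatten_mapP[k ks].
  rewrite mem_decomp => /eqP e; rewrite /= mem_decomp e; apply/negP => /eqP/phi_inj km.
  by move: ms; rewrite -km ks.
have -> : \sum_(m <- s) \sum_(ab <- decomp (phi m) | c ab) x ab.1 * y ab.2 =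
    \sum_(ab <- L) x ab.1 * y ab.2.
  rewrite big_filter; elim: s {us hX L memL uL} => [|m s IH]; first by rewrite !big_nil.
  by rewrite big_cons /= big_cat IH.
apply: le_trans (ler_sum_pairs uL x0 y0) _; apply: ler_pM.
- by apply: sumr_ge0.
- by apply: sumr_ge0.
- apply: hX; rewrite ?undup_uniq// => a; rewrite mem_undup => /mapP[[a' b] /memL[m [/= ms e cab]] ->].
  by exists m, b.
- apply: hY; rewrite ?undup_uniq// => b; rewrite mem_undup => /mapP[[a b'] /memL[m [/= ms e cab]] ->].
  by exists a.
Qed.

End FiniteSums.

(** The upper bounds of a submultiplicative norm that may take the value
    infinity; [nb x a] reads: the norm of [x] is at most [a]. *)
Record normBound (R : realType) (K : comNzRingType) := NormBound {
  nb_rel :> K -> R -> Prop;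
  nb_ge0 : forall x a, nb_rel x a -> 0 <= a;
  nb_le : forall x a b, nb_rel x a -> a <= b -> nb_rel x b;
  nb0 : nb_rel 0 0;
  nb1 : nb_rel 1 1;
  nbD : forall x y a b, nb_rel x a -> nb_rel y b -> nb_rel (x + y) (a + b);
  nbN : forall x a, nb_rel x a -> nb_rel (- x) a;
  nbM : forall x y a b, nb_rel x a -> nb_rel y b -> nb_rel (x * y) (a * b)
}.

Record weight (R : realType) (I : expMonoidType) := Weight {
  wt :> I -> R;
  wt_ge0 : forall m, 0 <= wt m;
  wt0 : wt 0 = 1;
  wtD : forall m n, wt (m + n) = wt m * wt n
}.

Section NormBoundTheory.
Variables (R : realType) (K : comNzRingType) (nb : normBound R K).

Lemma nbB x y a b : nb x a -> nb y b -> nb (x - y) (a + b).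
Proof. by move=> xa yb; apply: nbD => //; apply: nbN. Qed.

Lemma nb_sum (T : Type) (s : seq T) (c : pred T) (f : T -> K) (F : T -> R) :
  (forall t, c t -> nb (f t) (F t)) ->
  nb (\sum_(t <- s | c t) f t) (\sum_(t <- s | c t) F t).
Proof.
move=> fF; elim: s => [|t s IH]; first by rewrite !big_nil; exact: nb0.
by rewrite !big_cons; case: ifP => // ct; apply: nbD => //; apply: fF.
Qed.

Lemma nbX x a n : nb x a -> nb (x ^+ n) (a ^+ n).
Proof.
move=> xa; elim: n => [|n IH]; first by rewrite !expr0; exact: nb1.
by rewrite !exprS; apply: nbM.
Qed.

Section Series.
Variables (I : expMonoidType) (w : weight R I).

(** The weighted sum of the norms of the coefficients; the majorant [F] avoids
    the need for norms with real values. *)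
Definition ser_nb (f : ser I K) (x : R) : Prop :=
  exists2 F : I -> R, (forall m, nb (f m) (F m)) &
    forall s, uniq s -> \sum_(m <- s) F m * w m <= x.

Lemma ser_nb_ge0 f x : ser_nb f x -> 0 <= x.
Proof. by case=> F _ /(_ [::] isT); rewrite big_nil. Qed.

Lemma ser_nb_le f x y : ser_nb f x -> x <= y -> ser_nb f y.
Proof. by case=> F fF Fx xy; exists F => // s /Fx h; apply: le_trans xy. Qed.

Lemma ser_nb_mono i c x : nb c x -> ser_nb (mono i c) (x * w i).
Proof.
move=> cx; have x0 := nb_ge0 cx.
exists (fun m => if m == i then x else 0) => [m|s us].
  by rewrite /mono; case: eqP => // _; exact: nb0.
have xw0 : 0 <= x * w i by rewrite mulr_ge0// wt_ge0.
have [si|si] := boolP (i \in s).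
  rewrite (bigD1_seq i)//= eqxx big1 ?addr0// => m /negPf ->.
  by rewrite mul0r.
rewrite big_seq big1// => m ms; case: eqP => [mi|]; last by rewrite mul0r.
by rewrite -mi ms in si.
Qed.

Lemma ser_nb0 : ser_nb 0 0.
Proof.
by exists (fun=> 0) => [m|s _]; [exact: nb0|rewrite big1// => m; rewrite mul0r].
Qed.

Lemma ser_nb1 : ser_nb 1 1.
Proof.
rewrite -(@mono0 I K); have := ser_nb_mono 0 (nb1 nb).
by rewrite wt0 mulr1.
Qed.

Lemma ser_nbD f g x y : ser_nb f x -> ser_nb g y -> ser_nb (f + g) (x + y).
Proof.
move=> [F fF Fx] [G gG Gy]; exists (fun m => F m + G m) => [m|s us].
  by rewrite serD; apply: nbD.
under eq_bigr do rewrite mulrDl.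
by rewrite big_split lerD ?Fx ?Gy.
Qed.

Lemma ser_nbN f x : ser_nb f x -> ser_nb (- f) x.
Proof. by move=> [F fF Fx]; exists F => // m; rewrite serN; apply: nbN. Qed.

Lemma ser_nbM f g x y : ser_nb f x -> ser_nb g y -> ser_nb (f * g) (x * y).
Proof.
move=> [F fF Fx] [G gG Gy].
have F0 m : 0 <= F m by apply: nb_ge0 (fF m).
have G0 m : 0 <= G m by apply: nb_ge0 (gG m).
exists (fun m => \sum_(ab <- decomp m) F ab.1 * G ab.2) => [m|s us].
  by rewrite serM; apply: nb_sum => ab _; apply: nbM.
have -> : \sum_(m <- s) (\sum_(ab <- decomp m) F ab.1 * G ab.2) * w m =
    \sum_(m <- s) \sum_(ab <- decomp m) (F ab.1 * w ab.1) * (G ab.2 * w ab.2).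
  apply: eq_bigr => m _; rewrite big_distrl /= big_seq [RHS]big_seq.
  by apply: eq_bigr => ab; rewrite mem_decomp => /eqP <-; rewrite wtD mulrACA.
apply: (@ler_sum_conv R I id s xpredT (fun m => F m * w m) (fun m => G m * w m)) => //.
- by move=> m; rewrite mulr_ge0 ?wt_ge0.
- by move=> m; rewrite mulr_ge0 ?wt_ge0.
- by move=> s1 us1 _; exact: Fx.
- by move=> s1 us1 _; exact: Gy.
Qed.

Definition ser_normBound : normBound R (ser I K) :=
  NormBound ser_nb_ge0 ser_nb_le ser_nb0 ser_nb1 ser_nbD ser_nbN ser_nbM.

End Series.
End NormBoundTheory.

Section CausalFixpoint.
Variables (I V : Type) (mu : I -> nat) (Psi : (I -> V) -> I -> V) (v0 : V).
Hypothesis causal : forall q q' m,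
  (forall a, (mu a < mu m)%N -> q a = q' a) -> Psi q m = Psi q' m.

(** The value at [m] is already final after [mu m + 1] iterations. *)
Lemma causal_fixpoint : exists q, forall m, q m = Psi q m.
Proof.
pose it n := iter n Psi (fun=> v0).
have it_stable n k m : (mu m < n)%N -> (mu m < k)%N -> it n m = it k m.
  elim: n k m => // n IH [|k] m // mn mk; rewrite /it !iterS; apply: causal => a am.
  by apply: IH; [apply: leq_trans am _|apply: leq_trans am _].
exists (fun m => it (mu m).+1 m) => m; rewrite {1}/it iterS; apply: causal => a am.
exact: it_stable.
Qed.

End CausalFixpoint.

(** * Division by a series with a dominant term *)

Section Weierstrass.
Variables (R : realType) (I : expMonoidType) (B : comNzRingType).
Variables (W : I -> R) (W_ge0 : forall m, 0 <= W m).
Hypothesis WD : forall a b, W (a + b) = W a + W b.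
Variables (m0 : I) (P : ser I B) (eta : R).
Hypothesis eta_gt0 : 0 < eta.
Hypothesis P_gap : forall m, P m != 0 -> m != m0 -> W m0 + eta <= W m.

(** The steps of size [eta] that the weight of [m] allows: division by the
    dominant term strictly decreases this number in all the other terms. *)
Let mu (m : I) : nat := Num.truncn (W m / eta).

Lemma mu_lt a b m : a + b = m + m0 -> W m0 + eta <= W b -> (mu a < mu m)%N.
Proof.
move=> e Wb; have : W a + eta <= W m.
  by have := congr1 W e; rewrite !WD; lra.
move=> h; have ha : 0 <= W a / eta by rewrite divr_ge0 ?W_ge0// ltW.
have hm : 0 <= W m / eta by rewrite divr_ge0 ?W_ge0// ltW.
have /andP[a1 _] := truncn_itv ha; have /andP[_ m2] := truncn_itv hm.
have : W a / eta + 1 <= W m / eta.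
  by rewrite -[X in _ + X](@divff _ eta) ?gt_eqF// -mulrDl ler_pM2r ?invr_gt0.
rewrite -natr1 in m2; move=> h2.
rewrite -(ltr_nat R) -(ltrD2r 1); apply: le_lt_trans m2.
by apply: le_trans h2; rewrite lerD2r.
Qed.

Definition tail_mul (q : ser I B) (m : I) : B :=
  \sum_(ab <- decomp (m + m0) | ab.2 != m0) q ab.1 * P ab.2.

Lemma mul_lead_tail q m : (q * P) (m + m0) = q m * P m0 + tail_mul q m.
Proof.
rewrite serM (bigD1_seq (m, m0)) ?decomp_uniq ?mem_decomp//=; congr (_ + _).
rewrite /tail_mul big_seq_cond [RHS]big_seq_cond; apply: eq_bigl => -[a b] /=.
rewrite mem_decomp /= xpair_eqE; case: eqP => //= e; have [bm|//] := eqVneq b m0.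
  by move: e; rewrite bm ![_ + m0]addrC => /addm_inj ->; rewrite eqxx.
by rewrite andbF.
Qed.

Lemma tail_mul_causal q q' m :
  (forall a, (mu a < mu m)%N -> q a = q' a) -> tail_mul q m = tail_mul q' m.
Proof.
move=> qq; rewrite /tail_mul big_seq_cond [RHS]big_seq_cond.
apply: eq_bigr => -[a b] /andP[]; rewrite mem_decomp /= => /eqP e bm.
have [->|Pb] := eqVneq (P b) 0; first by rewrite !mulr0.
by rewrite (qq a)//; exact: mu_lt e (P_gap Pb bm).
Qed.

Variable tau : I -> B -> B.
Hypothesis tauB : forall m x y, tau m (x - y) = tau m x - tau m y.
Hypothesis tauP : forall m b, tau m (b * P m0) = b.

(** The remainders are the series on which [tau], a left inverse of the
    multiplication by the dominant coefficient, vanishes from the exponent [m0]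
    on. *)
Definition is_quotient (g q : ser I B) : Prop :=
  forall m, tau m ((g - q * P) (m + m0)) = 0.

(** The quotient is the solution of a recursion on the weight. *)
Lemma is_quotientE g q :
  is_quotient g q <-> forall m, q m = tau m (g (m + m0) - tail_mul q m).
Proof.
have key m : tau m ((g - q * P) (m + m0)) = tau m (g (m + m0) - tail_mul q m) - q m.
  rewrite serB mul_lead_tail opprD [- _ - _]addrC addrA tauB; congr (_ - _).
  exact: tauP.
split=> h m; last by rewrite key -h subrr.
by apply/eqP; rewrite eq_sym -subr_eq0 -key h.
Qed.

Lemma quotient_exists g : exists q, is_quotient g q.
Proof.
have [q hq] := @causal_fixpoint I B mu (fun q m => tau m (g (m + m0) - tail_mul q m)) 0
  (fun q q' m qq => congr1 (fun x => tau m (_ - x)) (tail_mul_causal qq)).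
by exists q; apply/is_quotientE.
Qed.

(** Congruent series have the same remainder. *)
Lemma quotientD g q z : is_quotient g q -> is_quotient (g + z * P) (q + z).
Proof.
move=> gq m; rewrite -[RHS](gq m); congr (tau m _).
by rewrite mulrDl opprD addrACA subrr addr0.
Qed.

(** The recursion stays in any graded subring that is stable under [tau]. *)
Lemma quotient_closed (A : I -> B -> Prop) g q :
  (forall m x y, A m x -> A m y -> A m (x + y)) ->
  (forall m x, A m x -> A m (- x)) -> (forall m, A m 0) ->
  (forall m n x y, A m x -> A n y -> A (m + n) (x * y)) ->
  (forall m x, A (m + m0) x -> A m (tau m x)) ->
  (forall m, A m (P m)) -> (forall m, A m (g m)) ->
  is_quotient g q -> forall m, A m (q m).
Proof.
move=> AD AN A0 AM At AP Ag /is_quotientE qE m.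
have [n] := ubnP (mu m); elim: n m => // n IH m; rewrite ltnS => mn.
rewrite qE; apply: (At); apply: (AD) => //; apply: (AN); rewrite /tail_mul big_seq_cond.
apply: (big_ind (A (m + m0))) => // [x y|[a b]]; first exact: AD.
rewrite mem_decomp /= => /andP[/eqP e bm].
have [->|Pb] := eqVneq (P b) 0; first by rewrite mulr0.
rewrite -e; apply: (AM) => //; apply: IH; apply: leq_trans mn.
exact: mu_lt e (P_gap Pb bm).
Qed.

Variables (nb : normBound R B) (w : weight R I) (C : R).
Hypothesis C_gt0 : 0 < C.
Hypothesis tau_nb : forall m b x, nb b x -> nb (tau m b) (C * x).
Hypothesis w_gt0 : 0 < w m0.
Variable p : I -> R.
Hypothesis P_nb : forall m, nb (P m) (p m).
Hypothesis p_small : forall s, uniq s -> m0 \notin s ->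
  \sum_(m <- s) p m * w m <= w m0 / (2 * C).

(** The norms of the coefficients of the quotient are majorized by the solution
    of the same recursion over the reals, so that the geometric estimate is made
    on real sums only. *)
Lemma quotient_nb g q x :
  ser_nb nb w g x -> is_quotient g q -> ser_nb nb w q (2 * C / w m0 * x).
Proof.
move=> gx; have x0 := ser_nb_ge0 gx; case: gx => G gG Gx /is_quotientE qE.
pose p' m := if P m == 0 then 0 else p m.
have p'0 m : 0 <= p' m by rewrite /p'; case: ifP => // _; exact: nb_ge0 (P_nb m).
have P'nb m : nb (P m) (p' m).
  by rewrite /p'; case: eqP => [->|//]; exact: nb0.
have G0 m : 0 <= G m by exact: nb_ge0 (gG m).
pose Psi (Q : I -> R) m := C * (G (m + m0) +
  \sum_(ab <- decomp (m + m0) | ab.2 != m0) Q ab.1 * p' ab.2).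
have [Q QE] : exists Q, forall m, Q m = Psi Q m.
  apply: (@causal_fixpoint I R mu Psi 0) => Q Q' m QQ; rewrite /Psi;
  congr (_ * (_ + _)); rewrite big_seq_cond [RHS]big_seq_cond.
  apply: eq_bigr => -[a b] /andP[]; rewrite mem_decomp /= => /eqP e bm.
  rewrite /p'; case: eqP => [_|/eqP Pb]; first by rewrite !mulr0.
  by rewrite (QQ a)//; exact: mu_lt e (P_gap Pb bm).
have qQ m : nb (q m) (Q m).
  have [n] := ubnP (mu m); elim: n m => // n IH m; rewrite ltnS => mn.
  rewrite qE QE /Psi; apply: (tau_nb); apply: nbB => //; rewrite /tail_mul big_seq_cond.
  rewrite [X in nb _ X]big_seq_cond; apply: nb_sum => -[a b].
  rewrite mem_decomp /= => /andP[/eqP e bm]; rewrite /p'; case: eqP => [->|/eqP Pb].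
    by rewrite !mulr0; exact: nb0.
  apply: nbM => //; apply: IH; apply: leq_trans mn; exact: mu_lt e (P_gap Pb bm).
exists Q => // s us.
have Q0 m : 0 <= Q m by exact: nb_ge0 (qQ m).
(* Induction on the largest weight in the finite set [s]: the exponents that the
   recursion visits have smaller weight, so the bound is available for them. *)
have [n sn] : exists n, forall m, m \in s -> (mu m < n)%N.
  exists (\sum_(m <- s) mu m).+1 => m ms; rewrite ltnS (big_rem m)//=.
  exact: leq_addr.
elim: n s us sn => [|n IH] s us sn.
  case: s us sn => [_ _|m s _ /(_ m (mem_head _ _))//]; rewrite big_nil.
  by rewrite !mulr_ge0 ?invr_ge0// ltW.
have wm0 := w_gt0.
pose X := 2 * C / w m0 * x.
have X0 : 0 <= X by rewrite !mulr_ge0 ?invr_ge0// ltW.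
have hs : \sum_(m <- s) \sum_(ab <- decomp (m + m0) | (ab.2 != m0) && (P ab.2 != 0))
     (Q ab.1 * w ab.1) * (p' ab.2 * w ab.2) <= X * (w m0 / (2 * C)).
  apply: (@ler_sum_conv R I (fun m => m + m0) s
    (fun ab => (ab.2 != m0) && (P ab.2 != 0)) (fun a => Q a * w a) (fun b => p' b * w b)) => //.
  - by move=> a b /=; rewrite ![_ + m0]addrC => /addm_inj.
  - by move=> a; rewrite mulr_ge0 ?wt_ge0.
  - by move=> a; rewrite mulr_ge0 ?wt_ge0.
  - move=> s1 us1 s1P; apply: IH => // a /s1P[m [b [ms e /andP[/= bm Pb]]]].
    by have /leq_trans := mu_lt e (P_gap Pb bm); apply; rewrite -ltnS; exact: sn.
  - move=> s2 us2 s2P.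
    have s2m0 : m0 \notin s2 by apply/negP => /s2P[a /=]; rewrite eqxx.
    apply: le_trans (p_small us2 s2m0); apply: ler_sum => b _.
    rewrite ler_wpM2r ?wt_ge0// /p'; case: ifP => // _; exact: nb_ge0 (P_nb b).
have hG : \sum_(m <- s) G (m + m0) * w (m + m0) <= x.
  rewrite -(big_map (fun m => m + m0) xpredT (fun m => G m * w m)); apply: Gx.
  by rewrite map_inj_uniq// => a b /=; rewrite ![_ + m0]addrC => /addm_inj.
have -> : \sum_(m <- s) Q m * w m = C / w m0 *
  (\sum_(m <- s) G (m + m0) * w (m + m0) +
   \sum_(m <- s) \sum_(ab <- decomp (m + m0) | (ab.2 != m0) && (P ab.2 != 0))
     (Q ab.1 * w ab.1) * (p' ab.2 * w ab.2)).
  rewrite -big_split big_distrr /=; apply: eq_bigr => m _.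
  rewrite {1}QE /Psi -!mulrA; congr (C * _).
  apply/(mulfI (lt0r_neq0 wm0)); rewrite [RHS]mulrA mulfV ?lt0r_neq0// mul1r.
  rewrite mulrC -mulrA -wtD mulrDl; congr (_ + _); rewrite big_distrl /=.
  rewrite big_seq_cond [RHS]big_seq_cond [LHS](bigID (fun ab => P ab.2 == 0)) /=.
  rewrite big1 ?add0r => [|ab /andP[_ /eqP Pb]]; last by rewrite /p' Pb eqxx mulr0 mul0r.
  apply: eq_big => [ab|ab]; first by rewrite andbA.
  move=> /andP[/andP[+ _] _]; rewrite mem_decomp => /eqP <-.
  by rewrite wtD mulrACA.
have -> : 2 * C / w m0 * x = C / w m0 * (x + X * (w m0 / (2 * C))).
  rewrite /X; field; apply/andP; split; exact: lt0r_neq0.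
by rewrite ler_wpM2l ?lerD// divr_ge0// ltW.
Qed.

End Weierstrass.

(** * Power series in one variable *)

Section Modulus.
Variable R : realType.
Implicit Types z : R[i].

Definition cabs z : R := Normc.normc z.
Arguments cabs : simpl never.

Lemma cabsE z : `|z| = (cabs z)%:C.
Proof. by []. Qed.

Lemma cabs_ge0 z : 0 <= cabs z.
Proof. by rewrite -lecR -cabsE normr_ge0. Qed.

Lemma cabs_gt0 z : (0 < cabs z) = (z != 0).
Proof. by rewrite -ltcR -cabsE normr_gt0. Qed.

Lemma cabsM z y : cabs (z * y) = cabs z * cabs y.
Proof. exact: Normc.normcM. Qed.

Lemma cabsV z : cabs z^-1 = (cabs z)^-1.
Proof. exact: Normc.normcV. Qed.

Lemma cabs_le z (x : R) : (cabs z <= x) = (`|z| <= x%:C).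
Proof. by rewrite cabsE lecR. Qed.

Lemma cabsD z y : cabs (z + y) <= cabs z + cabs y.
Proof. by rewrite cabs_le rmorphD /= -!cabsE ler_normD. Qed.

Lemma cabsN z : cabs (- z) = cabs z.
Proof. by apply: complexI; rewrite -!cabsE normrN. Qed.

Lemma cabs0 : cabs 0 = 0. Proof. exact: Normc.normc0. Qed.
Lemma cabs1 : cabs 1 = 1. Proof. exact: Normc.normc1. Qed.

Lemma cabsX z n : cabs (z ^+ n) = cabs z ^+ n.
Proof. by elim: n => [|n IH]; rewrite ?expr0 ?cabs1// !exprS cabsM IH. Qed.

Lemma cabs_real (x : R) : 0 <= x -> cabs x%:C = x.
Proof. by move=> x0; apply: complexI; rewrite -cabsE ger0_norm ?lecR. Qed.

Lemma cabs_sum (T : Type) (s : seq T) (c : pred T) (F : T -> R[i]) :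
  cabs (\sum_(t <- s | c t) F t) <= \sum_(t <- s | c t) cabs (F t).
Proof.
rewrite cabs_le rmorph_sum; apply: le_trans (ler_norm_sum _ _ _) _.
exact: ler_sum.
Qed.

Lemma cabs_prod (T : Type) (s : seq T) (F : T -> R[i]) :
  cabs (\prod_(t <- s) F t) = \prod_(t <- s) cabs (F t).
Proof.
elim: s => [|t s IH]; first by rewrite !big_nil cabs1.
by rewrite !big_cons cabsM IH.
Qed.

Definition cabs_bound z (x : R) : Prop := cabs z <= x.

Lemma cabs_bound_ge0 z x : cabs_bound z x -> 0 <= x.
Proof. exact: le_trans (cabs_ge0 z). Qed.
Lemma cabs_bound_le z x y : cabs_bound z x -> x <= y -> cabs_bound z y.
Proof. exact: le_trans. Qed.
Lemma cabs_bound0 : cabs_bound 0 0. Proof. by rewrite /cabs_bound cabs0. Qed.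
Lemma cabs_bound1 : cabs_bound 1 1. Proof. by rewrite /cabs_bound cabs1. Qed.
Lemma cabs_boundD z y a b :
  cabs_bound z a -> cabs_bound y b -> cabs_bound (z + y) (a + b).
Proof. by move=> za yb; apply: le_trans (cabsD _ _) _; apply: lerD. Qed.
Lemma cabs_boundN z a : cabs_bound z a -> cabs_bound (- z) a.
Proof. by rewrite /cabs_bound cabsN. Qed.
Lemma cabs_boundM z y a b :
  cabs_bound z a -> cabs_bound y b -> cabs_bound (z * y) (a * b).
Proof. by move=> za yb; rewrite /cabs_bound cabsM ler_pM ?cabs_ge0. Qed.

Definition cabs_normBound : normBound R R[i] := NormBound
  cabs_bound_ge0 cabs_bound_le cabs_bound0 cabs_bound1 cabs_boundD cabs_boundN
  cabs_boundM.

End Modulus.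

Arguments cabs {R} z : simpl never.

Section PowerSeries1.
Variable R : realType.
Local Notation C := R[i].
Local Notation pw := (ser nat C).
Implicit Types f g : pw.

Lemma pwM f g n : (f * g) n = \sum_(i < n.+1) f i * g (n - i)%N.
Proof.
rewrite serM -(big_mkord xpredT (fun i => f i * g (n - i)%N)).
rewrite -(big_map (fun i => (i, n - i)%N) xpredT (fun ab => f ab.1 * g ab.2)).
apply/perm_big/uniq_perm; rewrite ?decomp_uniq//.
  by rewrite map_inj_uniq ?iota_uniq// => i j [].
move=> [a b]; rewrite mem_decomp; apply/eqP/mapP => [<-|[k]].
  exists a; first by rewrite mem_index_iota ltnS /= leq_addr.
  by congr (_, _); exact/esym/addKn.
by rewrite mem_index_iota ltnS /= => nk [-> ->]; exact: subnKC.
Qed.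

Lemma pwM0 f g : (f * g) 0%N = f 0%N * g 0%N.
Proof. by rewrite pwM big_ord1. Qed.

Definition pw_lin (a b : C) : pw :=
  fun j => match j with 0 => a | 1 => b | _ => 0 end.

Lemma pw_linMS a b g j : (pw_lin a b * g) j.+1 = a * g j.+1 + b * g j.
Proof.
rewrite pwM 2!big_ord_recl big1 ?addr0 => [|i _]; last by rewrite mul0r.
by rewrite subn0 /= subSS subn0.
Qed.

Lemma pw_linM0 a b g : (pw_lin a b * g) 0%N = a * g 0%N.
Proof. exact: pwM0. Qed.

(** Division by [pw_lin a b]; if [a] is zero, then the constant term of the
    dividend is dropped. *)
Definition pw_divl (a b : C) (g : pw) : pw :=
  if a == 0 then fun j => g j.+1 / b
  else fix q j := match j with 0 => g 0%N / a | j'.+1 => (g j'.+1 - b * q j') / a end.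

Lemma pw_divlK a b g : a != 0 \/ b != 0 -> pw_divl a b (pw_lin a b * g) = g.
Proof.
move=> ab; rewrite /pw_divl; apply/funext => j; case: eqP => [a0|/eqP a0].
  have b0 : b != 0 by case: ab => //; rewrite a0 eqxx.
  by rewrite pw_linMS a0 mul0r add0r mulrAC mulfV ?mul1r.
elim: j => [|j IH]; first by rewrite pw_linM0 mulrAC mulfV ?mul1r.
by rewrite IH pw_linMS addrK mulrAC mulfV ?mul1r.
Qed.

Lemma pw_divlB a b f g : pw_divl a b (f - g) = pw_divl a b f - pw_divl a b g.
Proof.
apply/funext => j; rewrite serB /pw_divl; case: eqP => _; first by rewrite serB mulrBl.
elim: j => [|j IH]; first by rewrite serB mulrBl.
by rewrite IH serB; ring.
Qed.

Variables (eps : R) (eps_gt0 : 0 < eps).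

Let wpow (j : nat) : R := eps ^+ j.
Lemma pw_weight_ge0 j : 0 <= wpow j. Proof. by rewrite exprn_ge0// ltW. Qed.
Lemma pw_weight0 : wpow 0 = 1. Proof. exact: expr0. Qed.
Lemma pw_weightD i j : wpow (i + j) = wpow i * wpow j. Proof. exact: exprD. Qed.

Definition pw_weight : weight R nat := Weight pw_weight_ge0 pw_weight0 pw_weightD.

Definition pw_nb : normBound R pw := ser_normBound (cabs_normBound R) pw_weight.

Lemma pw_nbP g x : pw_nb g x <-> forall n, \sum_(j < n) cabs (g j) * eps ^+ j <= x.
Proof.
split=> [[G gG Gx] n|h].
  apply: le_trans (Gx (iota 0 n) (iota_uniq _ _)).
  rewrite -(big_mkord xpredT (fun j => cabs (g j) * eps ^+ j)) /index_iota subn0.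
  by apply: ler_sum => j _; rewrite ler_wpM2r ?exprn_ge0 ?(ltW eps_gt0)//; exact: (gG j).
exists (fun j => cabs (g j)) => [m|s us]; first exact: lexx.
pose n := (\sum_(j <- s) j).+1; apply: le_trans (h n).
rewrite -(big_mkord xpredT (fun j => cabs (g j) * eps ^+ j)).
apply: ler_sum_sub => //; first exact: iota_uniq.
  move=> j js.
  rewrite mem_index_iota /= ltnS (big_rem j)//=; exact: leq_addr.
by move=> j; rewrite mulr_ge0 ?cabs_ge0 ?exprn_ge0 ?ltW.
Qed.

Lemma pw_nb_coef g x j : pw_nb g x -> cabs (g j) * eps ^+ j <= x.
Proof.
move/pw_nbP/(_ j.+1); rewrite big_ord_recr /=; apply: le_trans.
by rewrite lerDr sumr_ge0// => i _; rewrite mulr_ge0 ?cabs_ge0 ?exprn_ge0 ?ltW.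
Qed.

Lemma pw_nb_lin a b : pw_nb (pw_lin a b) (cabs a + cabs b * eps).
Proof.
apply/pw_nbP => n.
have e0 j : 0 <= cabs (pw_lin a b j) * eps ^+ j.
  by rewrite mulr_ge0 ?cabs_ge0 ?exprn_ge0 ?ltW.
apply: (@le_trans _ _ (\sum_(j < n.+2) cabs (pw_lin a b j) * eps ^+ j)).
  rewrite 2!big_ord_recr; set S := (X in X <= _).
  apply: (@le_trans _ _ (S + cabs (pw_lin a b n) * eps ^+ n)); rewrite lerDl; exact: e0.
rewrite 2!big_ord_recl big1 ?addr0 => [|i _]; last by rewrite (_ : pw_lin a b _ = 0) ?cabs0 ?mul0r.
by rewrite /= expr0 expr1 mulr1.
Qed.

(** For a unit, the geometric series converges on the disc of radius [eps]. *)
Lemma pw_divl_nb a b :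
  (a = 0 -> b != 0) -> (a != 0 -> cabs b * eps <= cabs a / 2) ->
  exists2 D, 0 < D & forall g x, pw_nb g x -> pw_nb (pw_divl a b g) (D * x).
Proof.
move=> ab0 ab; have [a0|a0] := eqVneq a 0.
  rewrite /pw_divl a0 eqxx; have b0 : 0 < cabs b by rewrite cabs_gt0 ab0.
  exists (cabs b * eps)^-1; first by rewrite invr_gt0 mulr_gt0.
  move=> g x /pw_nbP gx; apply/pw_nbP => n.
  rewrite ler_pdivlMl ?mulr_gt0//; apply: le_trans (gx n.+1).
  rewrite big_distrr big_ord_recl /= ler_wpDl ?mulr_ge0 ?cabs_ge0 ?exprn_ge0 ?(ltW eps_gt0)//.
  apply: ler_sum => i _; rewrite cabsM cabsV /bump /= add1n exprS.
  by rewrite le_eqVlt; apply/orP; left; apply/eqP; field; exact: lt0r_neq0.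
have a0' : 0 < cabs a by rewrite cabs_gt0.
exists (2 / cabs a); first by rewrite divr_gt0.
move=> g x /pw_nbP gx; apply/pw_nbP => n.
pose q := pw_divl a b g.
have q0 : q 0%N = g 0%N / a by rewrite /q /pw_divl (negPf a0).
have qS j : q j.+1 = (g j.+1 - b * q j) / a by rewrite /q /pw_divl (negPf a0).
pose S := \sum_(j < n) cabs (q j) * eps ^+ j; rewrite -/q -/S.
have Sn : S <= \sum_(j < n.+1) cabs (q j) * eps ^+ j.
  by rewrite big_ord_recr /= lerDl mulr_ge0 ?cabs_ge0 ?exprn_ge0 ?(ltW eps_gt0).
have : \sum_(j < n.+1) cabs (q j) * eps ^+ j <=
    (cabs a)^-1 * (\sum_(j < n.+1) cabs (g j) * eps ^+ j + cabs b * eps * S).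
  rewrite big_ord_recl [X in _ * (X + _)]big_ord_recl /= -addrA mulrDr; apply: lerD.
    by rewrite q0 cabsM cabsV !expr0 !mulr1 mulrC.
  rewrite /S [X in _ + X]big_distrr -big_split big_distrr /=; apply: ler_sum => i _.
  rewrite /bump /= add1n qS cabsM cabsV exprS.
  rewrite [X in X <= _](_ : _ = (cabs a)^-1 * (cabs (g i.+1 - b * q i) * (eps * eps ^+ i)));
    last by ring.
  rewrite ler_wpM2l ?invr_ge0 ?cabs_ge0//.
  apply: (@le_trans _ _ ((cabs (g i.+1) + cabs b * cabs (q i)) * (eps * eps ^+ i))).
    rewrite ler_wpM2r ?mulr_ge0 ?exprn_ge0 ?(ltW eps_gt0)//.
    by apply: le_trans (cabsD _ _) _; rewrite cabsN cabsM.
  by rewrite le_eqVlt; apply/orP; left; apply/eqP; ring.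
move=> /(le_trans Sn) hS.
have S0 : 0 <= S.
  by apply: sumr_ge0 => i _; rewrite mulr_ge0 ?cabs_ge0 ?exprn_ge0 ?(ltW eps_gt0).
have h1 : cabs b * eps * S <= cabs a / 2 * S by rewrite ler_wpM2r ?ab.
have h2 := gx n.+1.
have h3 : S <= (cabs a)^-1 * (x + cabs a / 2 * S).
  by apply: le_trans hS _; rewrite ler_wpM2l ?invr_ge0 ?cabs_ge0// lerD.
have e : (cabs a)^-1 * (x + cabs a / 2 * S) = (cabs a)^-1 * x + S / 2.
  by field; exact: lt0r_neq0.
rewrite e in h3; have -> : 2 / cabs a * x = 2 * ((cabs a)^-1 * x) by ring.
by lra.
Qed.

End PowerSeries1.

(** * Forms on the exceptional divisor *)

Section UniformConstants.
Variables (R : realType) (T : eqType) (Q : T -> R -> Prop).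

Lemma uniform_bound (s : seq T) :
  (forall x D D', Q x D -> D <= D' -> Q x D') ->
  (forall x, x \in s -> exists2 D, 0 < D & Q x D) ->
  exists2 D, 0 < D & forall x, x \in s -> Q x D.
Proof.
move=> mono; elim: s => [|x s IH] h; first by exists 1.
have [y ys|D D0 DQ] := IH; first by apply: h; rewrite inE ys orbT.
have [E E0 EQ] := h x (mem_head _ _).
exists (D + E) => [|y]; first exact: addr_gt0.
rewrite inE => /orP[/eqP->|/DQ yQ].
  by apply: mono EQ _; rewrite lerDr ltW.
by apply: mono yQ _; rewrite lerDl ltW.
Qed.

Lemma uniform_radius (s : seq T) :
  (forall x D D', Q x D -> 0 < D' -> D' <= D -> Q x D') ->
  (forall x, x \in s -> exists2 D, 0 < D & Q x D) ->
  exists2 D, 0 < D & forall x, x \in s -> Q x D.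
Proof.
move=> mono; elim: s => [|x s IH] h; first by exists 1.
have [y ys|D D0 DQ] := IH; first by apply: h; rewrite inE ys orbT.
have [E E0 EQ] := h x (mem_head _ _).
have m0 : 0 < Order.min D E by rewrite lt_min D0.
exists (Order.min D E) => // y; rewrite inE => /orP[/eqP->|/DQ yQ].
  by apply: mono EQ _ _ => //; rewrite ge_min lexx orbT.
by apply: mono yQ _ _ => //; rewrite ge_min lexx.
Qed.

End UniformConstants.

Section Charts.
Variable R : realType.
Local Notation C := R[i].
Local Notation pw := (ser nat C).
Local Notation chart := (proj_line C -> pw).
Variable B : R.
Hypothesis B_ge1 : 1 <= B.
Let b : C := B%:C.

Lemma B_gt0 : 0 < B. Proof. exact: lt_le_trans B_ge1. Qed.

Lemma b_neq0 : b != 0.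
Proof. by rewrite -cabs_gt0 cabs_real ?B_gt0// ltW// B_gt0. Qed.

(** The two homogeneous coordinates of the exceptional divisor in each chart,
    as series in the affine variable. In the finite charts they are scaled so
    that both have norm at most one in every chart. *)
Definition coordX : chart := fun xi =>
  match xi with Some _ => pw_lin b^-1 0 | None => pw_lin 0 1 end.
Definition coordY : chart := fun xi =>
  match xi with Some c => pw_lin (c / b) b^-1 | None => pw_lin 1 0 end.

Definition const (c : C) : chart := fun=> mono 0%N c.

Lemma constM c e : const (c * e) = const c * const e.
Proof. by apply/funext => xi; rewrite /const [RHS]monoM addr0. Qed.
Lemma constD c e : const (c + e) = const c + const e.
Proof. by apply/funext => xi; exact: monoD. Qed.
Lemma constN c : const (- c) = - const c.
Proof. by apply/funext => xi; exact: monoN. Qed.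
Lemma const1 : const 1 = 1.
Proof. by apply/funext => xi; exact: mono0. Qed.
Lemma const0 : const 0 = 0.
Proof. by apply/funext => xi; apply/funext => j; rewrite /const /mono; case: eqP. Qed.

Lemma constX c n : const (c ^+ n) = const c ^+ n.
Proof. by elim: n => [|n IH]; rewrite ?expr0 ?const1// !exprS constM IH. Qed.

Lemma const_linE c xi : const c xi = pw_lin c 0.
Proof. by apply/funext => -[|[|j]]. Qed.

Lemma chartM (f g : chart) xi : (f * g) xi = f xi * g xi.
Proof. by []. Qed.

Lemma chartB (f g : chart) xi : (f - g) xi = f xi - g xi.
Proof. by []. Qed.

Lemma const_mulE c (f : pw) j : (pw_lin c 0 * f) j = c * f j.
Proof. by case: j => [|j]; rewrite ?pw_linM0// pw_linMS mul0r addr0. Qed.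

Definition vanish_at (z : proj_line C) : chart :=
  match z with Some c => coordY - const c * coordX | None => coordX end.

Definition vanish_coef (z xi : proj_line C) : C * C :=
  match z, xi with
  | Some c, Some e => ((e - c) / b, b^-1)
  | Some c, None => (1, - c)
  | None, Some _ => (b^-1, 0)
  | None, None => (0, 1)
  end.

Lemma vanish_atE z xi :
  vanish_at z xi = pw_lin (vanish_coef z xi).1 (vanish_coef z xi).2.
Proof.
case: z xi => [c|] [e|] //=; apply/funext => j.
  rewrite chartB serB chartM const_linE const_mulE /=.
  by case: j => [|[|j]] /=; rewrite ?mulr0 ?subr0 ?mulrBl//.
rewrite chartB serB chartM const_linE const_mulE /=.
by case: j => [|[|j]] /=; rewrite ?mulr0 ?mulr1 ?subr0 ?sub0r.
Qed.

Lemma vanish_coef_eq0 z xi : ((vanish_coef z xi).1 == 0) = (z == xi).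
Proof.
have b0 := b_neq0.
case: z xi => [c|] [e|] //=; rewrite ?oner_eq0 ?eqxx ?invr_eq0 ?(negPf b0)//.
by rewrite mulf_eq0 invr_eq0 (negPf b0) orbF subr_eq0 eq_sym.
Qed.

Lemma vanish_coef2_neq0 z : (vanish_coef z z).2 != 0.
Proof. by case: z => [c|] /=; rewrite ?invr_eq0 ?b_neq0 ?oner_neq0. Qed.

(** A coordinate normalized to the value one at the origin of the chart of [z];
    its powers extend a value at [z] to a form of any degree. *)
Definition unit_at (z : proj_line C) : chart :=
  match z with Some _ => const b * coordX | None => coordY end.

Definition center_value (z : proj_line C) (g : chart) : C := g z 0%N.

Lemma center_valueM z f g : center_value z (f * g) = center_value z f * center_value z g.
Proof. exact: pwM0. Qed.

Lemma center_value_const z c : center_value z (const c) = c.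
Proof. by rewrite /center_value const_linE. Qed.

Lemma center_valueX z f n : center_value z (f ^+ n) = center_value z f ^+ n.
Proof.
elim: n => [|n IH]; first by rewrite !expr0 -const1 center_value_const.
by rewrite !exprS center_valueM IH.
Qed.

Lemma center_value_sum z (T : Type) (s : seq T) (F : T -> chart) :
  center_value z (\sum_(t <- s) F t) = \sum_(t <- s) center_value z (F t).
Proof. by apply: (big_morph (center_value z)). Qed.

(** One step of Newton interpolation for families of degree [n]: the value at [z]
    is extended to a form of degree [n], and the difference, which vanishes at
    [z], is divided by the linear form in every chart. *)
Definition divide_at (z : proj_line C) (n : nat) (g : chart) : chart := fun xi =>
  pw_divl (vanish_coef z xi).1 (vanish_coef z xi).2
    ((g - const (center_value z g) * unit_at z ^+ n) xi).

Lemma divide_atB z n f g : divide_at z n (f - g) = divide_at z n f - divide_at z n g.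
Proof.
apply/funext => xi; rewrite chartB /divide_at -pw_divlB -chartB.
congr (pw_divl _ _ (_ xi)).
have -> : center_value z (f - g) = center_value z f - center_value z g by [].
by rewrite constD constN; ring.
Qed.

Lemma divide_atE z n f g :
  g = const (center_value z g) * unit_at z ^+ n + vanish_at z * f ->
  divide_at z n g = f.
Proof.
move=> e; apply/funext => xi; rewrite /divide_at.
rewrite [X in pw_divl _ _ (X xi)](_ : _ = vanish_at z * f); last first.
  by rewrite [X in X - _]e addrAC subrr add0r.
rewrite [(_ * _) xi](_ : _ = vanish_at z xi * f xi)// vanish_atE pw_divlK//.
have [<-|zxi] := eqVneq z xi; [right; exact: vanish_coef2_neq0|left].
by rewrite vanish_coef_eq0.
Qed.

Lemma center_value_vanish_at z : center_value z (vanish_at z) = 0.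
Proof. by rewrite /center_value vanish_atE /=; apply/eqP; rewrite vanish_coef_eq0. Qed.

Lemma divide_atK z n f : divide_at z n (vanish_at z * f) = f.
Proof.
by apply: divide_atE; rewrite center_valueM center_value_vanish_at mul0r const0 mul0r add0r.
Qed.

(** The form of degree [n] whose dehomogenization is the polynomial [h]. *)
Definition form (n : nat) (h : {poly C}) : chart :=
  \sum_(j < n.+1) const h`_j * coordX ^+ (n - j) * coordY ^+ j.

Implicit Types h k : {poly C}.

Lemma formD n h k : form n (h + k) = form n h + form n k.
Proof.
rewrite /form -big_split /=; apply: eq_bigr => j _.
by rewrite coefD constD !mulrDl.
Qed.

Lemma formZ n c h : form n (c *: h) = const c * form n h.
Proof.
rewrite /form big_distrr /=; apply: eq_bigr => j _.
by rewrite coefZ constM !mulrA.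
Qed.

Lemma formXn n : form n 'X^n = coordY ^+ n.
Proof.
rewrite /form big_ord_recr /= big1 ?add0r => [|j _].
  by rewrite coefXn eqxx const1 mul1r subnn expr0 mul1r.
by rewrite coefXn ltn_eqF ?const0 ?mul0r.
Qed.

Lemma form1 n : form n 1 = coordX ^+ n.
Proof.
rewrite /form big_ord_recl /= big1 ?addr0 => [|j _].
  by rewrite coef1 eqxx const1 mul1r subn0 expr0 mulr1.
by rewrite coef1 /= const0 !mul0r.
Qed.

Lemma formM_coordX n h : (size h <= n.+1)%N -> form n.+1 h = coordX * form n h.
Proof.
move=> hn; rewrite /form big_ord_recr /= [h`_n.+1]nth_default// const0 !mul0r addr0.
rewrite big_distrr /=; apply: eq_bigr => j _.
by rewrite subSn ?exprS; [ring|rewrite -ltnS].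
Qed.

Lemma formM_coordY n h : form n.+1 ('X * h) = coordY * form n h.
Proof.
rewrite /form big_ord_recl coefXM eqxx const0 !mul0r add0r big_distrr /=.
apply: eq_bigr => j _; rewrite /bump /= add1n coefXM /= subSS exprS; ring.
Qed.

Lemma formM_vanish_at n c h : (size h <= n.+1)%N ->
  form n.+1 (('X - c%:P) * h) = vanish_at (Some c) * form n h.
Proof.
move=> hn; rewrite mulrBl mul_polyC -scaleNr formD formZ formM_coordY formM_coordX//.
by rewrite /= mulrBl constN !mulNr mulrA.
Qed.

Lemma center_value_form n h z :
  (size h <= n.+1)%N -> center_value z (form n h) =
  match z with Some c => b^-1 ^+ n * h.[c] | None => h`_n end.
Proof.
move=> hn; rewrite /form center_value_sum; case: z => [c|].
  rewrite (horner_coef_wide _ hn) big_distrr /=; apply: eq_bigr => j _.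
  rewrite !center_valueM !center_valueX center_value_const /center_value /=.
  have jn : (j <= n)%N by rewrite -ltnS.
  have -> : b^-1 ^+ n = b^-1 ^+ (n - j) * b^-1 ^+ j by rewrite -exprD subnK.
  by rewrite exprMn; move: (b^-1) => u; ring.
rewrite big_ord_recr /= big1 => [|j _].
  rewrite add0r !center_valueM !center_valueX center_value_const /center_value /=.
  by rewrite subnn expr0 expr1n !mulr1.
rewrite !center_valueM !center_valueX center_value_const /center_value /=.
by rewrite expr0n subn_eq0 leqNgt ltn_ord /= mulr0 mul0r.
Qed.

(** The division maps forms to forms: it is the division by a linear factor, or
    the removal of the leading coefficient if [z] is the point at infinity. *)
Lemma divide_at_form z n h : (size h <= n.+2)%N ->
  exists2 k : {poly C}, (size k <= n.+1)%N & divide_at z n.+1 (form n.+1 h) = form n k.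
Proof.
move=> hn; case: z => [c|].
  have [k hk] : exists k, h - h.[c]%:P = k * ('X - c%:P).
    by apply/factor_theorem; rewrite /root !hornerE subrr.
  have sk : (size k <= n.+1)%N.
    have [->|k0] := eqVneq k 0; first by rewrite size_poly0.
    have : (size (h - h.[c]%:P)%R <= n.+2)%N.
      rewrite (leq_trans (size_polyD _ _))// geq_max hn size_polyN.
      by rewrite (leq_trans (size_polyC_leq1 _)).
    by rewrite hk size_Mmonic ?monicXsubC// size_XsubC addn2.
  exists k => //; apply: divide_atE.
  rewrite center_value_form// -formM_vanish_at// mulrC.
  rewrite [X in X = _](_ : _ = form n.+1 (h.[c] *: 1 + ('X - c%:P) * k)); last first.
    by congr form; rewrite mulrC -hk alg_polyC addrC subrK.
  rewrite formD formZ form1; congr (_ + _).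
  rewrite /= exprMn -constX [RHS]mulrC mulrA -constM; congr (const _ * _).
  by rewrite mulrAC -exprMn mulVf ?b_neq0// expr1n mul1r.
pose k := h - h`_n.+1 *: 'X^(n.+1).
have sk : (size k <= n.+1)%N.
  apply/leq_sizeP => j; rewrite leq_eqVlt => /orP[/eqP<-|jn].
    by rewrite coefB coefZ coefXn eqxx mulr1 subrr.
  rewrite coefB coefZ coefXn gtn_eqF// mulr0 subr0 nth_default//.
  exact: leq_trans hn _.
exists k => //; apply: divide_atE; rewrite center_value_form//= -formM_coordX//.
by rewrite -formXn -formZ -formD addrC subrK.
Qed.

Fixpoint divide_seq (zs : seq (proj_line C)) (n : nat) (g : chart) : chart :=
  if zs is z :: zs' then divide_seq zs' n.-1 (divide_at z n g) else g.

Lemma divide_seqB zs n f g : divide_seq zs n (f - g) = divide_seq zs n f - divide_seq zs n g.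
Proof. by elim: zs n f g => //= z zs IH n f g; rewrite divide_atB IH. Qed.

Lemma divide_seqK zs n g :
  divide_seq zs n ((\prod_(z <- zs) vanish_at z) * g) = g.
Proof.
elim: zs n g => [|z zs IH] n g; first by rewrite big_nil mul1r.
by rewrite big_cons /= -mulrA divide_atK IH.
Qed.

Lemma divide_seq_form zs n h : (size h <= (n + size zs).+1)%N ->
  exists2 k : {poly C}, (size k <= n.+1)%N &
    divide_seq zs (n + size zs) (form (n + size zs) h) = form n k.
Proof.
elim: zs h => [|z zs IH] h /=; first by rewrite addn0; exists h.
by rewrite addnS => /(divide_at_form z)[k sk /= ->]; exact: IH.
Qed.

(** The point at infinity is a root as often as the degree of the
    dehomogenization falls below [n]. *)
Lemma form_factor n h : (size h <= n.+1)%N -> h != 0 ->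
  exists zs c, [/\ size zs = n, c != 0, form n h = const c * \prod_(z <- zs) vanish_at z &
    forall z, (z \in zs) = match z with Some e => h.[e] == 0 | None => h`_n == 0 end].
Proof.
move=> hn h0; have [rs hE] := closed_field_poly_normal h.
have lc0 : lead_coef h != 0 by rewrite lead_coef_eq0.
have sh : size h = (size rs).+1 by rewrite hE size_scale// size_prod_XsubC.
have rn : (size rs <= n)%N by rewrite -ltnS -sh.
exists ([seq Some r | r <- rs] ++ nseq (n - size rs) None), (lead_coef h); split => //.
- by rewrite size_cat size_map size_nseq subnKC.
- rewrite {1}hE formZ; congr (_ * _); rewrite big_cat big_map /=.
  elim: rs n rn {h hn h0 hE lc0 sh} => [|r rs IH] n.
    by rewrite !big_nil subn0 mul1r form1 => _; elim: n => [|n IH];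
      rewrite ?expr0 ?big_nil// exprS big_cons IH.
  case: n => //= n rn; rewrite !big_cons formM_vanish_at ?IH ?subSS ?mulrA//.
  by rewrite size_prod_XsubC.
move=> [e|]; rewrite mem_cat.
  rewrite mem_nseq andbF orbF mem_map => [|? ? [->]//].
  by rewrite hE hornerZ mulf_eq0 (negPf lc0) /= -rootE root_prod_XsubC.
rewrite mem_nseq eqxx andbT subn_gt0 (_ : None \in _ = false) /=; last first.
  by apply/mapP => -[].
rewrite leq_eqVlt in rn; case/orP: rn => [/eqP rn|rn].
  by rewrite -rn ltnn; apply/esym/negbTE; rewrite -[size rs]/((size rs).+1.-1) -sh.
by rewrite rn nth_default ?eqxx// sh.
Qed.

Section ChartNorm.
Variables (eps : R) (eps_gt0 : 0 < eps) (pts : seq (proj_line C)).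
Hypothesis eps_center : forall c, Some c \in pts -> cabs c + eps <= B.
Hypothesis eps_B : eps * B <= 1 / 2.
Hypothesis eps_sep : forall c e, Some c \in pts -> Some e \in pts -> c != e ->
  eps <= cabs (c - e) / 2.
Local Notation pw_nb := (pw_nb eps_gt0).

Definition chart_bound (g : chart) (x : R) : Prop :=
  0 <= x /\ forall xi, xi \in pts -> pw_nb (g xi) x.

Lemma chart_bound_ge0 g x : chart_bound g x -> 0 <= x. Proof. by case. Qed.
Lemma chart_bound_le g x y : chart_bound g x -> x <= y -> chart_bound g y.
Proof.
move=> [x0 gx] xy; split; first exact: le_trans xy.
by move=> xi /gx h; exact: nb_le h xy.
Qed.
Lemma chart_bound0 : chart_bound 0 0. Proof. by split => // xi _; exact: nb0. Qed.
Lemma chart_bound1 : chart_bound 1 1. Proof. by split => // xi _; exact: nb1. Qed.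
Lemma chart_boundD f g x y :
  chart_bound f x -> chart_bound g y -> chart_bound (f + g) (x + y).
Proof.
move=> [x0 fx] [y0 gy]; split=> [|xi h]; first exact: addr_ge0.
by apply: nbD; [exact: fx|exact: gy].
Qed.
Lemma chart_boundN f x : chart_bound f x -> chart_bound (- f) x.
Proof. by move=> [x0 fx]; split=> // xi h; apply: nbN; exact: fx. Qed.
Lemma chart_boundM f g x y :
  chart_bound f x -> chart_bound g y -> chart_bound (f * g) (x * y).
Proof.
move=> [x0 fx] [y0 gy]; split=> [|xi h]; first exact: mulr_ge0.
by apply: nbM; [exact: fx|exact: gy].
Qed.

Definition chart_nb : normBound R chart := NormBound chart_bound_ge0
  chart_bound_le chart_bound0 chart_bound1 chart_boundD chart_boundN chart_boundM.

Lemma cabs_b : cabs b = B.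
Proof. by rewrite cabs_real// ltW// B_gt0. Qed.

Lemma eps_le1 : eps <= 1.
Proof. by have := eps_B; have := B_ge1; have := eps_gt0; nra. Qed.

Lemma const_nb c : chart_nb (const c) (cabs c).
Proof.
split=> [|xi _]; first exact: cabs_ge0.
rewrite const_linE; apply: nb_le (pw_nb_lin eps_gt0 c 0) _.
by rewrite cabs0 mul0r addr0.
Qed.

Lemma coordX_nb : chart_nb coordX 1.
Proof.
split=> // -[c|] h; apply: nb_le (pw_nb_lin eps_gt0 _ _) _.
  by rewrite cabs0 mul0r addr0 cabsV cabs_b invf_le1// B_gt0.
by rewrite cabs0 cabs1 add0r mul1r; exact: eps_le1.
Qed.

Lemma coordY_nb : chart_nb coordY 1.
Proof.
split=> // -[c|] h; apply: nb_le (pw_nb_lin eps_gt0 _ _) _.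
  rewrite cabsM cabsV cabs_b [_^-1 * _]mulrC -mulrDl ler_pdivrMr ?B_gt0// mul1r.
  exact: eps_center.
by rewrite cabs0 cabs1 mul0r addr0.
Qed.

Lemma unit_at_nb z : chart_nb (unit_at z) 1.
Proof.
case: z => [c|]; last exact: coordY_nb.
split=> // -[e|] h; rewrite /unit_at chartM.
  have -> : const b (Some e) * coordX (Some e) = pw_lin 1 0.
    rewrite const_linE; apply/funext => j; rewrite const_mulE.
    by case: j => [|[|j]]; rewrite /= ?mulr0 ?mulfV ?b_neq0.
  by apply: nb_le (pw_nb_lin eps_gt0 _ _) _; rewrite cabs0 cabs1 mul0r addr0.
have -> : const b None * coordX None = pw_lin 0 b.
  rewrite const_linE; apply/funext => j; rewrite const_mulE.
  by case: j => [|[|j]]; rewrite /= ?mulr0 ?mulr1.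
apply: nb_le (pw_nb_lin eps_gt0 _ _) _; rewrite cabs0 add0r cabs_b mulrC.
by have := eps_B; lra.
Qed.

(** The bound does not depend on the degree [n], because the powers of
    [unit_at z] have norm at most one. *)
Lemma divide_at_nb z : z \in pts ->
  exists2 D, 0 < D & forall n g x, chart_nb g x -> chart_nb (divide_at z n g) (D * x).
Proof.
move=> zpts.
pose Q xi D := forall g x, pw_nb g x -> pw_nb
  (pw_divl (vanish_coef z xi).1 (vanish_coef z xi).2 g) (D * x).
have Qmono xi D D' : Q xi D -> D <= D' -> Q xi D'.
  move=> h DD' g x gx; apply: nb_le (h g x gx) _.
  by rewrite ler_wpM2r//; exact: nb_ge0 gx.
have Qex xi : xi \in pts -> exists2 D, 0 < D & Q xi D.
  move=> xipts; apply: pw_divl_nb => [/eqP|].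
    by rewrite vanish_coef_eq0 => /eqP<-; exact: vanish_coef2_neq0.
  rewrite vanish_coef_eq0; have B0 := B_gt0; case: z xi zpts xipts {Q Qmono} => [c|] [e|] //= zp xp ne.
  - have {}ne : c != e by apply: contra ne => /eqP->.
    have := eps_sep xp zp; rewrite eq_sym => /(_ ne) h.
    by rewrite cabsM cabsV cabs_b [leLHS]mulrC [leRHS]mulrAC ler_wpM2r// invr_ge0 ltW.
  - have := eps_center zp; rewrite cabs1 cabsN; have := eps_B; have := cabs_ge0 c.
    by have := eps_gt0; nra.
  - by rewrite cabs0 mul0r divr_ge0// cabs_ge0.
have [D D0 hD] := uniform_bound Qmono Qex.
exists (D * 2); first by rewrite mulr_gt0.
move=> n g x gx; have x0 := nb_ge0 gx; split=> [|xi xip].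
  by rewrite !mulr_ge0// ltW.
rewrite -mulrA; apply: hD => //.
have -> : 2 * x = x + x * 1 ^+ n by rewrite expr1n; ring.
have : chart_nb (g - const (center_value z g) * unit_at z ^+ n) (x + x * 1 ^+ n).
  apply: nbB => //; apply: nbM; last by apply: nbX; exact: unit_at_nb.
  apply: nb_le (const_nb _) _; have [_ /(_ z zpts)/(pw_nb_coef 0%N)] := gx.
  by rewrite expr0 mulr1.
by case=> _; apply.
Qed.

Lemma divide_seq_nb zs : {subset zs <= pts} ->
  exists2 D, 0 < D & forall n g x, chart_nb g x -> chart_nb (divide_seq zs n g) (D * x).
Proof.
elim: zs => [|z zs IH] zp; first by exists 1 => // n g x; rewrite mul1r.
have [|D D0 hD] := IH; first by move=> y ys; apply: zp; rewrite inE ys orbT.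
have [E E0 hE] := divide_at_nb (zp z (mem_head _ _)).
exists (D * E) => [|n g x gx]; first by rewrite mulr_gt0.
by rewrite -mulrA; apply: hD; exact: hE.
Qed.

End ChartNorm.
End Charts.

(** * Blowing up *)

Section Exponents.
Variable d : nat.
Implicit Types (m n : expo d.+2) (a : expo d).

Definition ord_fst : 'I_d.+2 := @Ordinal d.+2 0 isT.
Definition ord_snd : 'I_d.+2 := @Ordinal d.+2 1 isT.
Definition ord_tail (k : 'I_d) : 'I_d.+2 := @rshift 2 d k.

Definition expo_mk (p q : nat) a : expo d.+2 :=
  expo_cat [ffun k : 'I_2 => if k == 0 then p else q] a.

Definition expo_tail m : expo d := [ffun k => m (ord_tail k)].

Lemma ord_case (i : 'I_d.+2) : [\/ i = ord_fst, i = ord_snd | exists k, i = ord_tail k].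
Proof.
case: (@splitP 2 d i) => j ij; last by apply: Or33; exists j; apply/val_inj.
have := ltn_ord j; case jE: (val j) => [|[|//]] _.
  by apply: Or31; apply/val_inj; rewrite /= ij.
by apply: Or32; apply/val_inj; rewrite /= ij.
Qed.

Lemma expo_cat_tail (m2 : expo 2) a k : expo_cat m2 a (ord_tail k) = a k.
Proof.
rewrite /expo_cat ffunE; case: splitP => j /= e.
  by have := ltn_ord j; rewrite -e ltnNge leq_addr.
by congr (a _); apply/val_inj/eqP; rewrite /= -(eqn_add2l 2) -e.
Qed.

Lemma expo_cat_fst (m2 : expo 2) a : expo_cat m2 a ord_fst = m2 0.
Proof. by rewrite /expo_cat ffunE; case: splitP => j //= e; congr (m2 _); apply/val_inj. Qed.

Lemma expo_cat_snd (m2 : expo 2) a : expo_cat m2 a ord_snd = m2 1.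
Proof. by rewrite /expo_cat ffunE; case: splitP => j //= e; congr (m2 _); apply/val_inj. Qed.

Lemma expo_mk_fst p q a : expo_mk p q a ord_fst = p.
Proof. by rewrite expo_cat_fst ffunE. Qed.
Lemma expo_mk_snd p q a : expo_mk p q a ord_snd = q.
Proof. by rewrite expo_cat_snd ffunE. Qed.
Lemma expo_mk_tail p q a : expo_tail (expo_mk p q a) = a.
Proof. by apply/ffunP => k; rewrite ffunE expo_cat_tail. Qed.

Lemma expoP m n : m ord_fst = n ord_fst -> m ord_snd = n ord_snd ->
  expo_tail m = expo_tail n -> m = n.
Proof.
move=> e1 e2 /ffunP e3; apply/ffunP => i; case: (ord_case i) => [->//|->//|[k ->]].
by have := e3 k; rewrite !ffunE.
Qed.

Lemma expo_mkE m : expo_mk (m ord_fst) (m ord_snd) (expo_tail m) = m.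
Proof. by apply: expoP; rewrite ?expo_mk_fst ?expo_mk_snd ?expo_mk_tail. Qed.

Lemma expo_tailD m n : expo_tail (m + n) = expo_tail m + expo_tail n.
Proof. by apply/ffunP => k; rewrite !ffunE. Qed.

Lemma expo_mkD p q a p' q' a' :
  expo_mk p q a + expo_mk p' q' a' = expo_mk (p + p') (q + q') (a + a').
Proof.
by apply: expoP; rewrite ?expo_tailD ?expoD ?expo_mk_fst ?expo_mk_snd ?expo_mk_tail.
Qed.

Lemma expo_cat_mk (m2 : expo 2) a : expo_cat m2 a = expo_mk (m2 0) (m2 1) a.
Proof.
apply: expoP; rewrite ?expo_mk_fst ?expo_mk_snd ?expo_mk_tail ?expo_cat_fst ?expo_cat_snd//.
by apply/ffunP => k; rewrite ffunE expo_cat_tail.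
Qed.

(** The exponent of a monomial after blowing up: the total degree in the first
    two variables, and the exponent of the other variables. *)
Definition expo_blow m : nat * expo d := ((m ord_fst + m ord_snd)%N, expo_tail m).

Lemma expo_blowD m n : expo_blow (m + n) = expo_blow m + expo_blow n.
Proof.
by rewrite /expo_blow expo_tailD !expoD; congr (_, _); rewrite addnACA.
Qed.

Definition blow_fiber (i : nat * expo d) : seq (expo d.+2) :=
  [seq expo_mk (i.1 - j) j i.2 | j <- iota 0 i.1.+1].

Arguments blow_fiber : simpl never.

Lemma blow_fiber_uniq i : uniq (blow_fiber i).
Proof.
rewrite map_inj_uniq ?iota_uniq// => p q /(congr1 (fun m : expo d.+2 => m ord_snd)).
by rewrite !expo_mk_snd.
Qed.

Lemma mem_blow_fiber i m : (m \in blow_fiber i) = (expo_blow m == i).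
Proof.
case: i => n a; apply/mapP/eqP => [[j]|[<- <-]].
  rewrite mem_iota ltnS /= ?add0n => jn ->.
  by rewrite /expo_blow expo_mk_tail expo_mk_fst expo_mk_snd subnK.
exists (m ord_snd); first by rewrite mem_iota ltnS /= ?add0n leq_addl.
by rewrite /= addnK expo_mkE.
Qed.

End Exponents.
Arguments blow_fiber {d} i : simpl never.

Lemma ser_sumE (I : expMonoidType) (K : zmodType) (T : Type) (s : seq T) (c : pred T)
    (F : T -> ser I K) m :
  (\sum_(t <- s | c t) F t) m = \sum_(t <- s | c t) F t m.
Proof. by apply: (big_morph (fun f : ser I K => f m)). Qed.

Lemma fsbig_fset (K : zmodType) (T : choiceType) (s : seq T) (F : T -> K) :
  uniq s -> (forall x, x \notin s -> F x = 0) ->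
  \sum_(x \in [set: T]) F x = \sum_(x <- s) F x.
Proof.
move=> us F0; rewrite [RHS]fsbig_seq// (fsbig_widen [set` s] setT)// => x /= [_ xs].
by apply: F0; apply/negP.
Qed.

Section Pullback.
Variables (R : realType) (d : nat) (B : R).
Hypothesis B_ge1 : 1 <= B.
Local Notation C := R[i].
Local Notation pw := (ser nat C).
Local Notation chart := (proj_line C -> pw).
Local Notation I := (nat * expo d)%type.
Local Notation ps := (ser (expo d.+2) C).
Let b : C := B%:C.
Let coordX := coordX B.
Let coordY := coordY B.

Definition coord_mono (m : expo d.+2) : chart :=
  coordX ^+ m (ord_fst d) * coordY ^+ m (ord_snd d).

Lemma coord_monoD m n : coord_mono (m + n) = coord_mono m * coord_mono n.
Proof. by rewrite /coord_mono !expoD !exprD mulrACA. Qed.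

(** The composition with the blow-up, in all charts at once. *)
Definition pullback (F : ps) : ser I chart :=
  fun i => \sum_(m <- blow_fiber i) const (F m) * coord_mono m.

Lemma pullback_form F i :
  pullback F i = form B i.1 (\poly_(j < i.1.+1) F (expo_mk (i.1 - j) j i.2)).
Proof.
rewrite /pullback /form big_map -(subn0 i.1.+1) -/(index_iota 0 i.1.+1) big_mkord subn0.
apply: eq_bigr => j _; rewrite /coord_mono expo_mk_fst expo_mk_snd mulrA.
by rewrite coef_poly ltn_ord.
Qed.

Lemma pullbackB F G : pullback (F - G) = pullback F - pullback G.
Proof.
apply/funext => i; rewrite serB /pullback -sumrB; apply: eq_bigr => m _.
by rewrite serB constD constN mulrBl.
Qed.

(** Multiplicativity: sort the pairs of exponents by the pair of their images. *)
Lemma pullbackM F G : pullback (F * G) = pullback F * pullback G.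
Proof.
have const_sum (T : Type) (s : seq T) (f : T -> C) :
    const (\sum_(t <- s) f t) = \sum_(t <- s) const (f t).
  by apply: (big_morph (@const R) (@constD R) (@const0 R)).
apply/funext => i; rewrite serM.
pose H (ab : expo d.+2 * expo d.+2) : chart :=
  (const (F ab.1) * coord_mono ab.1) * (const (G ab.2) * coord_mono ab.2).
transitivity (\sum_(m <- blow_fiber i) \sum_(ab <- decomp m) H ab).
  apply: eq_bigr => m _; rewrite serM const_sum big_distrl /= big_seq [RHS]big_seq.
  apply: eq_bigr => ab; rewrite mem_decomp => /eqP <-.
  by rewrite coord_monoD constM mulrACA.
transitivity (\sum_(xy <- decomp i)
   \sum_(ab <- [seq (a, a') | a <- blow_fiber xy.1, a' <- blow_fiber xy.2]) H ab);
  last first.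
  apply: eq_bigr => xy _; rewrite big_allpairs_dep /pullback big_distrl /=.
  by apply: eq_bigr => a _; rewrite big_distrr.
rewrite -(big_allpairs_dep (h := fun _ ab => ab) (r2 := @decomp _) (F := H)).
rewrite -(big_allpairs_dep (h := fun _ ab => ab)
  (r2 := fun xy => [seq (a, a') | a <- blow_fiber xy.1, a' <- blow_fiber xy.2]) (F := H)).
apply/perm_big/uniq_perm.
- apply: allpairs_uniq_dep => [|m _|].
  + exact: blow_fiber_uniq.
  + exact: decomp_uniq.
  move=> [m ab] [n cd] /allpairsPdep[? [? [_ + [? ?]]]] /allpairsPdep[? [? [_ + [? ?]]]].
  by subst; rewrite !mem_decomp /= => /eqP <- /eqP <- /= ->.
- apply: allpairs_uniq_dep => [|xy _|].
  + exact: decomp_uniq.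
  + by apply: allpairs_uniq; rewrite ?blow_fiber_uniq// => -[? ?] [? ?] _ _ [-> ->].
  move=> [[x y] ab] [[z t] cd] /allpairsPdep[? [? [_ + [? ?]]]] /allpairsPdep[? [? [_ + [? ?]]]].
  subst => /allpairsP[[a1 a2] [+ + ->]] /allpairsP[[a3 a4] [+ + ->]] /=.
  by rewrite !mem_blow_fiber /= => /eqP ? /eqP ? /eqP ? /eqP ? [? ?]; subst.
move=> [m n]; apply/allpairsPdep/allpairsPdep => -[x [y [+ + e]]];
  have {}e : (m, n) = y := e; subst y.
  rewrite mem_blow_fiber mem_decomp => /eqP<- /= /eqP <-.
  have hmn : (m, n) \in
      [seq (a, a') | a <- blow_fiber (expo_blow m), a' <- blow_fiber (expo_blow n)].
    by apply/allpairsP; exists (m, n); rewrite !mem_blow_fiber.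
  exists (expo_blow m, expo_blow n), (m, n); split; [|exact: hmn|by []].
  by rewrite mem_decomp expo_blowD.
rewrite mem_decomp => /eqP <- h.
have /allpairsP[[a1 a2] [+ + [-> ->]]] : (m, n) \in
  [seq (a, a') | a <- blow_fiber x.1, a' <- blow_fiber x.2] := h.
rewrite !mem_blow_fiber => /eqP <- /eqP <- /=.
by exists (a1 + a2), (a1, a2); split; rewrite ?mem_blow_fiber ?mem_decomp ?expo_blowD.
Qed.

(** A power series in [d.+2] variables as a series in all of them but the first
    whose coefficients are series in the first variable; the factor rescales
    the second variable. *)
Definition expand (s : C) (g : ps) : ser I pw :=
  fun i j => s ^+ i.1 * g (expo_mk j i.1 i.2).

Lemma expandB s f g : expand s (f - g) = expand s f - expand s g.
Proof. by apply/funext => i; apply/funext => j; rewrite !serB /expand serB mulrBr. Qed.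

Lemma expandD s f g : expand s (f + g) = expand s f + expand s g.
Proof. by apply/funext => i; apply/funext => j; rewrite !serD /expand serD mulrDr. Qed.

Lemma expand_mono s m c :
  expand s (mono m c) = mono (m (ord_snd d), expo_tail m)
    (mono (m (ord_fst d)) (s ^+ m (ord_snd d) * c)).
Proof.
apply/funext => -[n a]; apply/funext => j; rewrite /expand /mono /=.
case: eqP => [<-|h].
  by rewrite expo_mk_fst expo_mk_snd expo_mk_tail !eqxx.
rewrite mulr0; case: eqP => // -[hn ha]; case: eqP => // hj.
by case: h; rewrite hn ha hj expo_mkE.
Qed.

Lemma expandM s f g : expand s (f * g) = expand s f * expand s g.
Proof.
apply/funext => i; apply/funext => j; rewrite serM ser_sumE.
under [RHS]eq_bigr do rewrite serM.
pose H (ab : expo d.+2 * expo d.+2) : C := s ^+ i.1 * (f ab.1 * g ab.2).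
pose h (xy : I * I) (kl : nat * nat) :=
  (expo_mk kl.1 xy.1.1 xy.1.2, expo_mk kl.2 xy.2.1 xy.2.2).
transitivity (\sum_(ab <- decomp (expo_mk j i.1 i.2)) H ab).
  by rewrite /expand serM big_distrr.
transitivity (\sum_(ab <- [seq h xy kl | xy <- decomp i, kl <- decomp j]) H ab); last first.
  rewrite big_allpairs_dep big_seq [RHS]big_seq; apply: eq_bigr => xy.
  rewrite mem_decomp /H => /eqP <-; apply: eq_bigr => kl _.
  by rewrite /h /expand /= exprD mulrACA.
apply/perm_big/uniq_perm; first exact: decomp_uniq.
  apply: allpairs_uniq; rewrite ?decomp_uniq//.
  move=> [[[? ?] [? ?]] [? ?]] [[[? ?] [? ?]] [? ?]] _ _ /= [].
  move=> e1 e2; have := (congr1 (@expo_tail d) e1, congr1 (@expo_tail d) e2).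
  rewrite !expo_mk_tail => -[-> ->].
  have := (congr1 (fun m : expo d.+2 => m (ord_fst d)) e1,
           congr1 (fun m : expo d.+2 => m (ord_fst d)) e2).
  rewrite !expo_mk_fst => -[-> ->].
  have := (congr1 (fun m : expo d.+2 => m (ord_snd d)) e1,
           congr1 (fun m : expo d.+2 => m (ord_snd d)) e2).
  by rewrite !expo_mk_snd => -[-> ->].
move=> [m n]; rewrite mem_decomp /=; apply/eqP/allpairsP => [e|].
  exists (((m (ord_snd d), expo_tail m), (n (ord_snd d), expo_tail n)),
    (m (ord_fst d), n (ord_fst d))); rewrite !mem_decomp /h /= !expo_mkE.
  case: i {H} e => i1 i2 /= e; split => //.
    have := congr1 (fun m : expo d.+2 => m (ord_snd d)) e; rewrite expo_mk_snd expoD => <-.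
    by have := congr1 (@expo_tail d) e; rewrite expo_mk_tail expo_tailD => <-.
  by have := congr1 (fun m : expo d.+2 => m (ord_fst d)) e; rewrite expo_mk_fst expoD => <-.
move=> [[[[x1 x2] [y1 y2]] [k l]] []]; rewrite !mem_decomp => /eqP <- /eqP <- [-> ->].
by rewrite expo_mkD.
Qed.

Lemma expand1 s : expand s 1 = 1.
Proof.
rewrite -!mono0 expand_mono expo0 expr0 mul1r expo0.
have -> : expo_tail (0 : expo d.+2) = 0 by apply/ffunP => k; rewrite !ffunE.
by [].
Qed.

Lemma expandX s f n : expand s (f ^+ n) = expand s f ^+ n.
Proof. by elim: n => [|n IH]; rewrite ?expr0 ?expand1// !exprS expandM IH. Qed.

Definition chart_scale (xi : proj_line C) : C := if xi is Some _ then b^-1 else 1.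

Lemma chart_scale_neq0 xi : chart_scale xi != 0.
Proof. by case: xi => [c|]; rewrite /= ?oner_neq0 ?invr_eq0 ?b_neq0. Qed.

Definition expo_unit (k : 'I_d) : expo d := [ffun j => nat_of_bool (j == k)].

Lemma fpsX_mono i : fpsX C i = mono [ffun j : 'I_d.+2 => nat_of_bool (j == i)] 1 :> ps.
Proof. by apply/funext => m; rewrite /fpsX /mono; case: eqP. Qed.

Lemma fpsX_tail0 (i : 'I_d.+2) : (forall k, ord_tail k != i) ->
  expo_tail [ffun j : 'I_d.+2 => nat_of_bool (j == i)] = 0.
Proof. by move=> h; apply/ffunP => k; rewrite !ffunE (negPf (h k)). Qed.

Lemma expand_fpsX_fst s : expand s (fpsX C (ord_fst d)) = mono 0 (mono 1%N 1).
Proof. by rewrite fpsX_mono expand_mono !ffunE /= fpsX_tail0// expr0 mulr1. Qed.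

Lemma expand_fpsX_snd s : expand s (fpsX C (ord_snd d)) = mono (1%N, 0) (mono 0%N s).
Proof. by rewrite fpsX_mono expand_mono !ffunE /= fpsX_tail0// expr1 mulr1. Qed.

Lemma expand_fpsX_tail s k : expand s (fpsX C (ord_tail k)) = mono (0%N, expo_unit k) 1.
Proof.
rewrite fpsX_mono expand_mono !ffunE /= expr0 mulr1.
have -> : expo_tail [ffun j : 'I_d.+2 => nat_of_bool (j == ord_tail k)] = expo_unit k.
  by apply/ffunP => j; rewrite !ffunE.
by rewrite mono0.
Qed.

Lemma expand_blowup_fst xi :
  expand (chart_scale xi) (blowup xi (ord_fst d)) = mono (1%N, 0) (coordX xi).
Proof.
case: xi => [c|] /=; rewrite /blowup /=.
  rewrite -/(ord_snd d) expand_fpsX_snd; congr mono.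
  by apply/funext => -[|[|j]].
rewrite fpsME expandM -/(ord_snd d) -/(ord_fst d) expand_fpsX_snd expand_fpsX_fst monoM add0r.
congr mono; rewrite monoM mulr1; by apply/funext => -[|[|j]].
Qed.

Lemma expand_blowup_snd xi :
  expand (chart_scale xi) (blowup xi (ord_snd d)) = mono (1%N, 0) (coordY xi).
Proof.
case: xi => [c|] /=; rewrite /blowup /=; last first.
  rewrite -/(ord_snd d) expand_fpsX_snd; congr mono.
  by apply/funext => -[|[|j]].
rewrite fpsME expandM -/(ord_snd d) -/(ord_fst d) expand_fpsX_snd.
rewrite [expand _ _](_ : _ = mono 0 (mono 0%N c + mono 1%N 1)); last first.
  rewrite monoD -(expand_fpsX_fst (chart_scale (Some c))) -[RHS]/(_ + _).
  rewrite (_ : mono 0 (mono 0%N c) = expand (chart_scale (Some c)) (fpsC c : fps C d.+2)) -?expandD//.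
  rewrite fpsCE expand_mono !expo0 expr0 mul1r.
  by have -> : expo_tail (0 : expo d.+2) = 0 by apply/ffunP => k; rewrite !ffunE.
rewrite monoM add0r; congr mono; apply/funext => j.
rewrite mulrDl serD !monoM mul1r.
by case: j => [|[|j]]; rewrite /mono /= ?addr0 ?add0r.
Qed.

Lemma expand_blowup_tail xi k :
  expand (chart_scale xi) (blowup xi (ord_tail k)) = mono (0%N, expo_unit k) 1.
Proof. by rewrite -(expand_fpsX_tail (chart_scale xi)); case: xi => [c|]. Qed.

Lemma big_fpsM (T : Type) (s : seq T) (F : T -> ps) :
  \big[@fpsM C d.+2/fpsC 1]_(t <- s) F t = \prod_(t <- s) F t.
Proof.
elim: s => [|t s IH]; first by rewrite !big_nil -mono0.
by rewrite !big_cons IH fpsME.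
Qed.

Lemma expand_prod s (T : Type) (r : seq T) (F : T -> ps) :
  expand s (\prod_(t <- r) F t) = \prod_(t <- r) expand s (F t).
Proof. exact: (big_morph (expand s) (expandM s) (expand1 s)). Qed.

Lemma expand_blowup_mono xi (m : expo d.+2) :
  expand (chart_scale xi)
    (\big[@fpsM C d.+2/fpsC 1]_(i < d.+2) fpsXn (blowup xi i) (m i)) =
  mono (expo_blow m) (coord_mono m xi).
Proof.
rewrite big_fpsM expand_prod.
under eq_bigr do rewrite fpsXnE expandX.
rewrite 2!big_ord_recl /=.
have -> : ord0 = ord_fst d by apply/val_inj.
have -> : lift (ord_fst d) ord0 = ord_snd d by apply/val_inj.
rewrite expand_blowup_fst expand_blowup_snd !monoX.
under eq_bigr => k _.
  have -> : lift (ord_fst d) (lift ord0 k) = ord_tail k by apply/val_inj.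
  rewrite expand_blowup_tail monoX expr1n; over.
have -> : \prod_(k < d) mono ((0%N, expo_unit k) *+ m (ord_tail k)) (1 : pw) =
    mono (\sum_(k < d) (0%N, expo_unit k) *+ m (ord_tail k)) 1.
  elim/big_ind2: _ => [|? x ? y -> ->|//]; first by rewrite mono0.
  by rewrite monoM mulr1.
rewrite [X in _ * X]monoM monoM mulr1; apply: congr2; last first.
  rewrite /coord_mono chartM; congr (_ * _).
    by elim: (m _) => [|n IH]; rewrite ?expr0// !exprS chartM IH.
  by elim: (m _) => [|n IH]; rewrite ?expr0// !exprS chartM IH.
have mulnP (x : I) n : x *+ n = (x.1 *+ n, x.2 *+ n).
  by elim: n => [|n IH]; rewrite ?mulr0n// !mulrS IH.
have sumP (T : Type) (s : seq T) (f : T -> I) :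
    \sum_(t <- s) f t = (\sum_(t <- s) (f t).1, \sum_(t <- s) (f t).2).
  by elim: s => [|t s IH]; rewrite ?big_nil// !big_cons IH.
rewrite sumP !mulnP /expo_blow.
have natmul n : (1%N *+ n)%R = n by rewrite -[LHS]/(1 *+ n)%R natn.
have natmul0 n : (0%N *+ n)%R = 0%N by elim: n => [|n IH]; rewrite ?mulr0n// mulrS IH.
congr (_, _) => /=.
  rewrite !natmul big1 ?addr0// => k _; rewrite mulnP /=; exact: natmul0.
rewrite !mul0rn !add0r; apply/ffunP => k; rewrite sum_ffunE.
rewrite (bigD1 k)//= big1 ?addr0 => [|j jk].
  by rewrite mulnP /= ffunMnE !ffunE eqxx natmul.
by rewrite mulnP /= ffunMnE !ffunE eq_sym (negPf jk) natmul0.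
Qed.

(** The link with formal substitution: each monomial is mapped to a monomial in
    the variables other than [v1]. *)
Lemma expand_comp xi (p : ps) i :
  expand (chart_scale xi) (fps_comp p (blowup (d := d) xi)) i = pullback p i xi.
Proof.
have s0 : chart_scale xi ^+ i.1 != 0 by rewrite expf_neq0// chart_scale_neq0.
apply/funext => j; rewrite /expand /fps_comp.
pose Q (m : expo d.+2) := \big[@fpsM C d.+2/fpsC 1]_(i < d.+2) fpsXn (blowup xi i) (m i).
have QE m : chart_scale xi ^+ i.1 * Q m (expo_mk j i.1 i.2) =
    if expo_blow m == i then coord_mono m xi j else 0.
  transitivity (expand (chart_scale xi) (Q m) i j); first by [].
  by rewrite expand_blowup_mono /mono eq_sym; case: eqP.
rewrite (@fsbig_fset _ _ (blow_fiber i)) ?blow_fiber_uniq//; last first.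
  move=> m; rewrite mem_blow_fiber => mi; have := QE m; rewrite (negPf mi).
  by move/eqP; rewrite mulf_eq0 (negPf s0) /= => /eqP; rewrite /Q => ->; rewrite mulr0.
rewrite /pullback fct_sumE ser_sumE big_distrr /= big_seq [RHS]big_seq.
apply: eq_bigr => m; rewrite mem_blow_fiber => mi.
by rewrite mulrCA -/(Q m) QE mi chartM const_linE const_mulE.
Qed.

End Pullback.

(** * The dominant term *)

Lemma seq_argmin (R : realDomainType) (T : eqType) (f : T -> R) (s : seq T) (x : T) :
  x \in s -> exists2 y, y \in s & forall z, z \in s -> f y <= f z.
Proof.
elim: s x => // a s IH x _; case: s IH => [|b s] IH.
  by exists a; rewrite ?mem_head// => z; rewrite inE => /eqP->.
have [y ys ymin] := IH b (mem_head _ _).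
have [ay|/ltW ya] := leP (f a) (f y).
  exists a; rewrite ?mem_head// => z; rewrite in_cons => /orP[/eqP->//|/ymin].
  exact: le_trans.
exists y => [|z]; first by rewrite in_cons ys orbT.
by rewrite in_cons => /orP[/eqP->//|/ymin].
Qed.

Section LinearForm.
Variables (R : realType) (d : nat) (L : {additive expo d -> R}).
Hypothesis L_ge0 : forall m, 0 <= L m.
Hypothesis L_inj : injective L.

Lemma L_unit_gt0 k : 0 < L (expo_unit k).
Proof.
rewrite lt_neqAle L_ge0 andbT -(raddf0 L); apply/eqP => /L_inj/ffunP/(_ k).
by rewrite !ffunE eqxx.
Qed.

Lemma L_coord_le (a : expo d) k : (a k)%:R * L (expo_unit k) <= L a.
Proof.
pose r : expo d := [ffun j => if j == k then 0%N else a j].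
have -> : a = expo_unit k *+ a k + r.
  apply/ffunP => j; rewrite expoD ffunMnE !ffunE; case: eqP => [->|_].
    by rewrite addn0 -[LHS]natn.
  by rewrite mul0rn.
have -> : (expo_unit k *+ a k + r) k = a k.
  rewrite expoD ffunMnE !ffunE eqxx addn0.
  by rewrite -[RHS]natn.
by rewrite raddfD raddfMn mulr_natl lerDl.
Qed.

(** The values of [L] on the unit vectors are positive, so they bound every
    coordinate. *)
Lemma L_sublevel_finite c : exists N, forall a, L a <= c -> a \in expo_box d N.
Proof.
pose N k := (Num.truncn (c / L (expo_unit k))).+1.
exists (\sum_k N k)%N => a ac; rewrite mem_expo_box; apply/forallP => k.
apply: (@leq_trans (N k)); last by rewrite (bigD1 k)//= leq_addr.
have Lk := L_unit_gt0 k.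
rewrite -(ltr_nat R); apply: (@le_lt_trans _ _ (c / L (expo_unit k))).
  by rewrite ler_pdivlMr//; exact: le_trans (L_coord_le a k) ac.
rewrite /N; have /truncn_itv/andP[_] // : 0 <= c / L (expo_unit k).
by rewrite divr_ge0// ?(ltW Lk)//; exact: le_trans ac.
Qed.

(** Sublevel sets are finite, so the minimum is attained, and by injectivity the
    next value is larger by a positive gap. *)
Lemma L_argmin (A : set (expo d)) a1 : A a1 ->
  exists a0 : expo d, [/\ A a0, (forall a, A a -> L a0 <= L a) &
    exists2 g, 0 < g & forall a, A a -> a != a0 -> L a0 + g <= L a].
Proof.
move=> Aa1.
have amin (D : set (expo d)) b : D b -> exists2 a, D a & forall e, D e -> L a <= L e.
  move=> Db; have [N hN] := L_sublevel_finite (L b).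
  have bs : b \in [seq a <- expo_box d N | `[< D a >]].
    by rewrite mem_filter hN// andbT; apply/asboolP.
  have [a + amin] := seq_argmin L bs; rewrite mem_filter => /andP[/asboolP Da _].
  exists a => // e De; have [eb|/ltW be] := leP (L e) (L b).
    by apply: amin; rewrite mem_filter hN// andbT; apply/asboolP.
  by apply: le_trans be; exact: amin.
have [a0 Aa0 a0min] := amin A a1 Aa1; exists a0; split => //.
have [[b [Ab ba0]]|none] := pselect (exists b, A b /\ b != a0).
  have [e [Ae ea0] emin] := amin [set b | A b /\ b != a0] b (conj Ab ba0).
  exists (L e - L a0); last by move=> a Aa aa0; rewrite addrC subrK emin.
  rewrite subr_gt0 lt_neqAle a0min// andbT; apply: contra ea0 => /eqP/L_inj ->.
  by rewrite eqxx.
by exists 1 => // a Aa aa0; case: none; exists a.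
Qed.

End LinearForm.

Lemma expo_deg2 (m : expo 2) : expo_deg m = (m 0%R + m 1%R)%N.
Proof.
by rewrite /expo_deg big_ord_recl big_ord1; congr (_ + m _)%N; apply/val_inj.
Qed.

Section LeadingTerm.
Variables (R : realType) (d : nat) (L : {additive expo d -> R}).
Hypothesis L_ge0 : forall m, 0 <= L m.
Hypothesis L_inj : injective L.
Variable P : fps R[i] d.+2.
Hypothesis P_neq0 : P <> fpsC 0.
Local Notation C := R[i].

Lemma min_expoP : exists2 g, 0 < g &
  occurs P (min_expo L P) /\
  forall a, occurs P a -> a != min_expo L P -> L (min_expo L P) + g <= L a.
Proof.
have [a1 Pa1] : exists a, occurs P a.
  apply: contrapT => none; apply: P_neq0; apply/funext => m; rewrite /fpsC if_same.
  apply: contrapT => /eqP Pm; apply: none; exists (expo_tail m).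
  exists [ffun k : 'I_2 => if k == 0 then m (ord_fst d) else m (ord_snd d)].
  by rewrite -/(expo_mk _ _ _) expo_mkE.
have [a0 [Pa0 a0min [g g0 hg]]] := L_argmin L_ge0 L_inj Pa1.
have e : min_expo L P = a0.
  have : [set a | occurs P a /\ (forall b, occurs P b -> L a <= L b)] (min_expo L P).
    by apply: xgetPex; exists a0.
  move=> [h1 h2]; apply: L_inj; apply/eqP; rewrite eq_le.
  by rewrite h2// a0min.
by exists g => //; rewrite e.
Qed.

Lemma fps_orderP e (p : fps C e) (m1 : expo e) : p m1 != 0 ->
  (exists2 m, p m != 0 & expo_deg m = fps_order p) /\
  forall m, p m != 0 -> (fps_order p <= expo_deg m)%N.
Proof.
move=> pm1; have ex : exists n, `[< exists2 m, p m != 0 & expo_deg m = n >].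
  by exists (expo_deg m1); apply/asboolP; exists m1.
apply: (xgetPex 0%N (P := [set n | (exists2 m, p m != 0 & expo_deg m = n) /\
  forall m, p m != 0 -> (n <= expo_deg m)%N])).
case: (ex_minnP ex) => n /asboolP hn nmin; exists n; split=> // m pm.
by apply: nmin; apply/asboolP; exists m.
Qed.

Definition lead_deg : nat := fps_order (P_L L P).
Definition lead_index : nat * expo d := (lead_deg, min_expo L P).

(** The dehomogenization of [H_L L P]. *)
Definition lead_poly : {poly C} :=
  \poly_(j < lead_deg.+1) P (expo_mk (lead_deg - j) j (min_expo L P)).

(** The dominant term has minimal weight for suitable weights of the variables:
    one for the total degree in the first two variables, and a large multiple of
    the given linear form for the others. *)
Lemma lead_gap : exists2 K, 0 < K & forall m, P m != 0 -> expo_blow m != lead_index ->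
  lead_deg%:R + K * L (min_expo L P) + 1 <=
  (expo_blow m).1%:R + K * L (expo_blow m).2.
Proof.
have [g g0 [[m1 Pm1] hg]] := min_expoP.
have [_ ordmin] := @fps_orderP _ (P_L L P) _ Pm1.
exists (lead_deg.+1%:R / g) => [|m Pm]; first by rewrite divr_gt0// ltr0Sn.
rewrite -[m]expo_mkE; set p := m _; set q := m _; set a := expo_tail m.
rewrite /expo_blow expo_mk_fst expo_mk_snd expo_mk_tail /=.
pose m2 : expo 2 := [ffun k : 'I_2 => if k == 0 then p else q].
have Pm2 : P (expo_cat m2 a) != 0 by move: Pm; rewrite -{1}[m]expo_mkE.
have [ea|ea] := eqVneq a (min_expo L P).
  rewrite ea => ne.
  have : (lead_deg <= p + q)%N.
    have hm2 : P_L L P m2 != 0 by rewrite /P_L -ea.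
    by have := ordmin m2 hm2; rewrite expo_deg2 !ffunE.
  rewrite leq_eqVlt => /orP[/eqP e|].
    by move: ne; rewrite /lead_index e eqxx.
  by rewrite -(ler_nat R) -natr1; lra.
move=> _; have := hg a (ex_intro _ m2 Pm2) ea.
move=> hL; have h0 : 0 <= lead_deg.+1%:R / g :> R by rewrite divr_ge0 ?ler0n ?ltW.
have := ler_wpM2l h0 hL; rewrite mulrDr divfK ?gt_eqF// -natr1 => h1.
by have : 0 <= (p + q)%:R :> R by []; lra.
Qed.

Lemma lead_poly_neq0 : lead_poly != 0.
Proof.
have [g g0 [[m1 Pm1] hg]] := min_expoP.
have [[m Pm dm] _] := @fps_orderP _ (P_L L P) _ Pm1.
move: Pm dm; rewrite /P_L expo_cat_mk => Pm; rewrite -/lead_deg => dm.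
have {}dm : (m 0%R + m 1%R)%N = lead_deg by rewrite -dm expo_deg2.
apply/eqP => /(congr1 (fun h : {poly C} => h`_(m 1))); rewrite coef0 coef_poly.
rewrite ltnS -dm leq_addl addnK => e.
by rewrite e eqxx in Pm.
Qed.

Lemma size_lead_poly : (size lead_poly <= lead_deg.+1)%N.
Proof. exact: size_poly. Qed.

Lemma H_L_lead (p q : nat) : (p + q = lead_deg)%N ->
  H_L L P [ffun k : 'I_2 => if k == 0 then p else q] = lead_poly`_q.
Proof.
move=> pq; rewrite /H_L /fps_lowest -/lead_deg coef_poly ltnS -pq leq_addl addnK.
by rewrite expo_deg2 !ffunE /= pq eqxx.
Qed.

Lemma H_L_off (m : expo 2) : expo_deg m != lead_deg -> H_L L P m = 0.
Proof. by rewrite /H_L /fps_lowest -/lead_deg => /negPf ->. Qed.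

Lemma H_L_constant : fps_constant (H_L L P) <-> lead_deg = 0%N.
Proof.
split=> [[c Hc]|h0].
  have : exists j, lead_poly`_j != 0.
    apply: contrapT => none; have /eqP := lead_poly_neq0; apply; apply/polyP => j.
    by rewrite coef0; apply: contrapT => /eqP hj; apply: none; exists j.
  move=> [j hj]; have jh : (j <= lead_deg)%N.
    by rewrite -ltnS; move: hj; rewrite coef_poly; case: ifP; rewrite ?eqxx.
  move: hj; rewrite -(@H_L_lead (lead_deg - j) j) ?subnK// Hc /fpsC.
  case: ifP => [/eqP e _|]; last by rewrite eqxx.
  have := congr1 (fun m : expo 2 => m 0) e; have := congr1 (fun m : expo 2 => m 1) e.
  by rewrite !ffunE /= => j0; rewrite j0 subn0.
exists (H_L L P 0); apply/funext => m; rewrite /fpsC; case: eqP => [->//|m0].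
apply: H_L_off; rewrite h0 /expo_deg sum_nat_eq0; apply/negP => /forallP h.
by apply: m0; apply/ffunP => k; rewrite ffunE; apply/eqP/(h k).
Qed.

Lemma fps_eval_H_L (z : 'rV[C]_2) :
  fps_eval (H_L L P) z =
  \sum_(j < lead_deg.+1) lead_poly`_j * (z 0 0 ^+ (lead_deg - j) * z 0 1 ^+ j).
Proof.
pose E j : expo 2 := [ffun k : 'I_2 => if k == 0 then (lead_deg - j)%N else j].
rewrite /fps_eval (@fsbig_fset _ _ [seq E j | j <- iota 0 lead_deg.+1]).
- rewrite big_map -(subn0 lead_deg.+1) -/(index_iota 0 lead_deg.+1) big_mkord subn0.
  apply: eq_bigr => j _; have jh : (j <= lead_deg)%N by rewrite -ltnS.
  rewrite H_L_lead ?subnK// /monomial big_ord_recl big_ord1 !ffunE /=.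
  by have -> : lift ord0 ord0 = 1 :> 'I_2 by apply/val_inj.
- rewrite map_inj_uniq ?iota_uniq// => j k /ffunP/(_ 1).
  by rewrite !ffunE.
move=> m mE; have [dm|dm] := eqVneq (expo_deg m) lead_deg; last by rewrite H_L_off// mul0r.
case/mapP: mE; exists (m 1); first by rewrite mem_iota ltnS /= ?add0n -dm leq_expo_deg.
apply/ffunP => k; rewrite ffunE -dm expo_deg2.
by case: k => -[|[|//]] hk; rewrite /= ?addnK; congr (m _); apply/val_inj.
Qed.

Lemma zero_set_H_L (z : proj_line C) : zero_set (H_L L P) z <->
  match z with Some c => lead_poly.[c] == 0 | None => lead_poly`_lead_deg == 0 end.
Proof.
rewrite /zero_set /= fps_eval_H_L; case: z => [c|] /=.
  under eq_bigr => j _ do rewrite !mxE /= expr1n mul1r.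
  rewrite -(horner_coef_wide _ size_lead_poly).
  by split => /eqP.
rewrite big_ord_recr /= big1 ?add0r => [|j _].
  by rewrite !mxE /= subnn expr0 expr1n !mulr1; split => /eqP.
by rewrite !mxE /= expr0n subn_eq0 leqNgt ltn_ord /= mul0r mulr0.
Qed.

Lemma pullback_lead B : pullback B P lead_index = form B lead_deg lead_poly.
Proof. exact: pullback_form. Qed.

Lemma pullback_neq0 B i : pullback B P i != 0 ->
  exists2 m, P m != 0 & expo_blow m = i.
Proof.
apply: contraNP => none; apply/eqP; rewrite /pullback big_seq big1// => m.
rewrite mem_blow_fiber => /eqP mi; rewrite (_ : P m = 0) ?const0 ?mul0r//.
by apply: contrapT => /eqP Pm; apply: none; exists m.
Qed.

End LeadingTerm.

(** * Absolutely summable families *)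

Section AbsoluteSums.
Variable R : realType.
Local Notation C := R[i].

Definition sums_to (T : choiceType) (c : T -> C) (l : C) : Prop :=
  forall e : R, 0 < e -> exists A : seq T, forall D, uniq D -> {subset A <= D} ->
    cabs (l - \sum_(m <- D) c m) <= e.

Lemma partial_sum_seq (T : choiceType) (c : T -> C) (D : {fset T}) :
  partial_sum c D = \sum_(m <- enum_fset D) c m.
Proof. by rewrite /partial_sum big_seq_fsetE. Qed.

(** Convergence along the filter of finite sets, with lists for the finite sets. *)
Lemma sums_toP (T : choiceType) (c : T -> C) (l : C) :
  (partial_sum c @ totally --> (l : C^o)) <-> sums_to c l.
Proof.
have cvgP := @cvgrPdist_le C (C^o) {fset T} totally totally_filter (partial_sum c) l.
split=> [/cvgP h e e0|h].
  have e0' : 0 < e%:C :> C by rewrite ltcR.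
  have [A _ hA] := h _ e0'.
  exists (enum_fset A) => D uD AD.
  have := hA [fset x in D]%fset; rewrite /= partial_sum_seq.
  have -> : \sum_(m <- enum_fset [fset x in D]%fset) c m = \sum_(m <- D) c m.
    apply/perm_big/uniq_perm => // x; by rewrite in_fset.
  rewrite cabs_le; apply; apply/fsubsetP => x xA.
  by rewrite in_fset; exact: AD.
apply/cvgP => e e0.
have eE : e = (complex.Re e)%:C by move/gtr0_real/RRe_real: e0.
have : 0 < complex.Re e by rewrite -ltcR -eE.
move=> /h[A hA]; exists [fset x in A]%fset => // D /= /fsubsetP AD.
rewrite partial_sum_seq eE -cabs_le; apply: hA => // x xA.
by apply: AD; rewrite in_fset.
Qed.

Definition abs_bounded (T : choiceType) (c : T -> C) (M : R) : Prop :=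
  forall s, uniq s -> \sum_(m <- s) cabs (c m) <= M.

Section Sums.
Variable T : choiceType.
Implicit Types (c : T -> C) (l : C).

Lemma sums_tail c l A M : sums_to c l -> uniq A ->
  (forall s, uniq s -> (forall m, m \in s -> m \notin A) -> \sum_(m <- s) cabs (c m) <= M) ->
  cabs (l - \sum_(m <- A) c m) <= M.
Proof.
move=> cl uA h; apply/ler_addgt0Pr => e /cl[A' hA'].
pose s := [seq m <- undup A' | m \notin A].
have us : uniq s by rewrite filter_uniq ?undup_uniq.
have sA m : m \in s -> m \notin A by rewrite mem_filter => /andP[].
have /hA' : uniq (A ++ s).
  rewrite cat_uniq uA us andbT; apply/hasPn => m /sA; exact.
rewrite big_cat /= => /(_ _) h1.
have {}h1 : cabs (l - (\sum_(m <- A) c m + \sum_(m <- s) c m)) <= e.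
  apply: h1 => m mA'; rewrite mem_cat mem_filter mem_undup mA' andbT.
  exact: orbN.
have -> : l - \sum_(m <- A) c m =
  \sum_(m <- s) c m + (l - (\sum_(m <- A) c m + \sum_(m <- s) c m)) by ring.
apply: le_trans (cabsD _ _) _; apply: lerD => //.
by apply: le_trans (cabs_sum _ _ _) _; exact: h.
Qed.

Lemma sums_le c l M : sums_to c l -> abs_bounded c M -> cabs l <= M.
Proof.
move=> cl cM; rewrite -[l]subr0 -(@big_nil _ 0 +%R T xpredT c).
by apply: sums_tail => // s us _; exact: cM.
Qed.

Lemma sums_coef_bounded c l : sums_to c l -> exists2 M, 0 < M & forall m, cabs (c m) <= M.
Proof.
move=> /(_ 1 ltr01)[A hA]; exists (2 + \sum_(m <- undup A) cabs (c m)).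
  by rewrite ltr_pwDl// sumr_ge0// => m _; exact: cabs_ge0.
move=> m; have uA := undup_uniq A.
have [mA|mA] := boolP (m \in undup A).
  rewrite (bigD1_seq m)//= addrCA lerDl addr_ge0// sumr_ge0// => k _; exact: cabs_ge0.
have h1 : cabs (l - \sum_(m <- undup A) c m) <= 1.
  by apply: hA => // k; rewrite mem_undup.
have h2 : cabs (l - \sum_(m <- m :: undup A) c m) <= 1.
  by apply: hA => [|k]; rewrite /= ?mA// inE mem_undup => ->; rewrite orbT.
rewrite big_cons in h2.
have -> : c m = (l - \sum_(m <- undup A) c m) - (l - (c m + \sum_(m <- undup A) c m)) by ring.
apply: le_trans (cabsD _ _) _; rewrite cabsN.
have : 0 <= \sum_(m <- undup A) cabs (c m) by apply: sumr_ge0 => k _; exact: cabs_ge0.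
by lra.
Qed.

Lemma sums_toD c c' l l' : sums_to c l -> sums_to c' l' ->
  sums_to (fun m => c m + c' m) (l + l').
Proof.
move=> cl cl' e e0; have e20 : 0 < e / 2 by rewrite divr_gt0.
have [A hA] := cl _ e20; have [A' hA'] := cl' _ e20; exists (A ++ A') => D uD AD.
rewrite big_split /= opprD addrACA; apply: le_trans (cabsD _ _) _.
rewrite [leRHS]splitr; apply: lerD; [apply: hA|apply: hA'] => // m mA; apply: AD;
  by rewrite mem_cat mA ?orbT.
Qed.

Lemma sums_toZ c l a : sums_to c l -> sums_to (fun m => a * c m) (a * l).
Proof.
move=> cl e e0; have a0 : 0 < cabs a + 1 by rewrite ltr_wpDl ?cabs_ge0.
have [|A hA] := cl (e / (cabs a + 1)); first by rewrite divr_gt0.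
exists A => D uD /hA - /(_ uD) h; rewrite -big_distrr /= -mulrBr cabsM.
apply: (@le_trans _ _ ((cabs a + 1) * (e / (cabs a + 1)))).
  by apply: ler_pM; rewrite ?cabs_ge0// lerDl.
by rewrite mulrCA mulfV ?mulr1// gt_eqF.
Qed.

Lemma sums_to_fin c (s : seq T) : uniq s -> (forall m, m \notin s -> c m = 0) ->
  sums_to c (\sum_(m <- s) c m).
Proof.
move=> us c0 e e0; exists s => D uD sD.
suff -> : \sum_(m <- D) c m = \sum_(m <- s) c m by rewrite subrr cabs0 ltW.
rewrite (bigID (mem s)) /= addrC big1 ?add0r => [|m]; last exact: c0.
rewrite -big_filter; apply/perm_big/uniq_perm => //; first exact: filter_uniq.
by move=> m; rewrite mem_filter; case: (boolP (m \in s)) => //= /sD ->.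
Qed.

Lemma sums_to_pos (x : T -> R) M : (forall m, 0 <= x m) ->
  (forall s, uniq s -> \sum_(m <- s) x m <= M) ->
  exists l : R, sums_to (fun m => (x m)%:C) l%:C.
Proof.
move=> x0 xM; pose E := [set y | exists2 s, uniq s & y = \sum_(m <- s) x m].
have supE : has_sup E.
  split; first by exists 0, [::]; rewrite ?big_nil.
  by exists M => _ [s us ->]; exact: xM.
exists (sup E) => e e0; have [_ [A uA ->] hA] := sup_adherent e0 supE.
exists A => D uD AD; rewrite -rmorph_sum -rmorphB /=.
have h1 : \sum_(m <- D) x m <= sup E by apply: ub_le_sup; [case: supE|exists D].
have h2 : \sum_(m <- A) x m <= \sum_(m <- D) x m by exact: ler_sum_sub.
by rewrite cabs_real; lra.
Qed.

(** The real and imaginary parts are differences of bounded families of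
    nonnegative numbers, for which the supremum of the finite sums is the sum. *)
Lemma sums_exists c M : abs_bounded c M -> exists l, sums_to c l.
Proof.
move=> cM.
have part (x : T -> R) : (forall m, `|x m| <= cabs (c m)) ->
    exists l, sums_to (fun m => (x m)%:C) l.
  move=> xc.
  have [||l hl] := @sums_to_pos (fun m => `|x m| + x m) (M + M).
  - by move=> m; have := ler_norm (- x m); rewrite normrN; lra.
  - move=> s us; rewrite big_split; apply: lerD; apply: le_trans (cM s us);
      apply: ler_sum => m _; [exact: xc|exact: le_trans (ler_norm _) (xc m)].
  have [||l' hl'] := @sums_to_pos (fun m => `|x m|) M => //.
    by move=> s us; apply: le_trans (cM s us); apply: ler_sum => m _; exact: xc.
  exists (l%:C + -1 * l'%:C) => e e0.
  have [A hA] := sums_toD hl (sums_toZ (-1) hl') e0; exists A => D uD /hA - /(_ uD).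
  congr (cabs (_ - _) <= _); apply: eq_bigr => m _.
  by rewrite rmorphD /= mulN1r addrAC subrr add0r.
have [|l hl] := part (fun m => complex.Re (c m)).
  by move=> m; rewrite -lecR -cabsE normc_ge_Re.
have [|l' hl'] := part (fun m => complex.Im (c m)).
  move=> m; case: (c m) => a b /=; rewrite -sqrtr_sqr /cabs /Normc.normc.
  by rewrite ler_wsqrtr// lerDr sqr_ge0.
exists (l + 'i * l') => e e0.
have [A hA] := sums_toD hl (sums_toZ 'i hl') e0; exists A => D uD /hA - /(_ uD).
by congr (cabs (_ - _) <= _); apply: eq_bigr => m _; rewrite -complexE.
Qed.

End Sums.

Lemma sums_to_ext (T : choiceType) (c c' : T -> C) l :
  (forall m, c m = c' m) -> sums_to c l -> sums_to c' l.
Proof. by move=> e; rewrite (funext e). Qed.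

Lemma sums_fubini (S T : choiceType) (c : S -> T -> C) (p : T -> C) l :
  sums_to (fun st => c st.1 st.2) l -> (forall t, sums_to (c^~ t) (p t)) -> sums_to p l.
Proof.
move=> cl cp e e0; have e20 : 0 < e / 2 by rewrite divr_gt0.
have [A hA] := cl _ e20; exists [seq st.2 | st <- A] => D uD AD.
have [A1 hA1] : exists A1 : seq S, forall t, t \in D -> forall D1, uniq D1 ->
    {subset A1 <= D1} -> cabs (p t - \sum_(s <- D1) c s t) <= e / 2 / (size D).+1%:R.
  elim: D {uD AD}(size D) => [|t D IH] N; first by exists [::].
  have [A1 hA1] := IH N; have [|A2 hA2] := cp t (e / 2 / N.+1%:R).
    by rewrite divr_gt0// ltr0Sn.
  exists (A1 ++ A2) => t'; rewrite inE => /orP[/eqP->|t'D] D1 uD1 h.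
    by apply: hA2 => // s sA; apply: h; rewrite mem_cat sA orbT.
  by apply: hA1 => // s sA; apply: h; rewrite mem_cat sA.
pose D1 := undup (A1 ++ [seq st.1 | st <- A]).
have -> : l - \sum_(t <- D) p t =
   (l - \sum_(st <- [seq (s, t) | s <- D1, t <- D]) c st.1 st.2) -
   \sum_(t <- D) (p t - \sum_(s <- D1) c s t).
  rewrite sumrB opprB addrA; congr (_ - _); rewrite big_allpairs_dep /= exchange_big /=.
  by rewrite subrK.
apply: le_trans (cabsD _ _) _; rewrite [leRHS]splitr cabsN; apply: lerD.
  apply: hA => [|[s t] st].
    by apply: allpairs_uniq; rewrite ?undup_uniq// => -[? ?] [? ?] _ _ [-> ->].
  apply: allpairs_f.
    by rewrite mem_undup mem_cat; apply/orP; right; apply/mapP; exists (s, t).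
  by apply: AD; apply/mapP; exists (s, t).
apply: le_trans (cabs_sum _ _ _) _.
apply: (@le_trans _ _ (\sum_(t <- D) e / 2 / (size D).+1%:R)).
  rewrite big_seq [leRHS]big_seq; apply: ler_sum => t tD; apply: hA1 => //.
    exact: undup_uniq.
  by move=> s sA; rewrite mem_undup mem_cat sA.
move: (e / 2) e20 => a a0; rewrite big_const_seq count_predT iter_addr_0 -[leLHS]mulr_natr.
rewrite -mulrA ler_piMr ?(ltW a0)// ler_pdivrMl ?ltr0Sn// mulr1 ler_nat.
exact: leqnSn.
Qed.

Lemma sums_to_swap (S T : choiceType) (c : S -> T -> C) l :
  sums_to (fun st => c st.1 st.2) l -> sums_to (fun ts => c ts.2 ts.1) l.
Proof.
move=> cl e /cl[A hA]; exists [seq (st.2, st.1) | st <- A] => D uD AD.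
have := hA [seq (ts.2, ts.1) | ts <- D]; rewrite big_map; apply.
  by rewrite map_inj_uniq// => -[? ?] [? ?] [-> ->].
move=> [s t] stA; apply/mapP; exists (t, s) => //.
by apply: AD; apply/mapP; exists (s, t).
Qed.

End AbsoluteSums.

(** * Coefficient bounds and convergent power series *)

Section CoefficientBounds.
Variables (R : realType) (d : nat).
Local Notation C := R[i].
Implicit Types (p : fps C d) (z : 'rV[C]_d) (m : expo d).

Lemma fps_sums_toP p z l :
  fps_sums_to p z l <-> sums_to (fun m => p m * monomial z m) l.
Proof. exact: sums_toP. Qed.

Lemma prod_pow_deg (K : comNzRingType) (r : K) m : \prod_(i < d) r ^+ m i = r ^+ expo_deg m.
Proof. by rewrite /expo_deg; elim/big_ind2: _ => // x a y b -> ->; rewrite exprD. Qed.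

Lemma cabs_monomial_le z (r : R) m : (forall i, cabs (z 0 i) <= r) ->
  cabs (monomial z m) <= r ^+ expo_deg m.
Proof.
move=> zr; rewrite /monomial cabs_prod -prod_pow_deg; apply: ler_prod => i _.
rewrite cabs_ge0 cabsX /=; apply: lerXn2r => //; rewrite nnegrE ?cabs_ge0//.
exact: le_trans (cabs_ge0 _) (zr i).
Qed.

Lemma geometric_half_le (n : nat) : \sum_(j < n) (2^-1 : R) ^+ j <= 2.
Proof.
suff -> : \sum_(j < n) (2^-1 : R) ^+ j = 2 - 2 * 2^-1 ^+ n.
  by rewrite lerBlDr lerDl mulr_ge0// exprn_ge0// invr_ge0.
elim: n => [|n IH]; first by rewrite big_ord0 expr0; ring.
by rewrite big_ord_recr /= IH exprS; field.
Qed.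

Lemma geometric_sum_le (s : seq (expo d)) : uniq s ->
  \sum_(m <- s) (2^-1 : R) ^+ expo_deg m <= 2 ^+ d.
Proof.
move=> us; pose N := (\sum_(m <- s) expo_deg m).+1.
have h0 n : 0 <= (2^-1 : R) ^+ n by rewrite exprn_ge0// invr_ge0.
apply: (@le_trans _ _ (\sum_(m <- expo_box d N) (2^-1 : R) ^+ expo_deg m)).
  apply: ler_sum_sub => //; first exact: expo_box_uniq.
  move=> m ms; rewrite mem_expo_box; apply/forallP => i; rewrite ltnS.
  by rewrite (leq_trans (leq_expo_deg m i))// (big_rem m)//= leq_addr.
rewrite /expo_box big_map big_enum /=.
under eq_bigr => f _.
  rewrite -prod_pow_deg; under eq_bigr => i _ do rewrite ffunE; over.
rewrite -(bigA_distr_bigA (fun (_ : 'I_d) (j : 'I_N) => (2^-1 : R) ^+ j)) /=.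
rewrite -[X in 2 ^+ X](card_ord d) -prodr_const; apply: ler_prod => i _.
by rewrite sumr_ge0//= geometric_half_le.
Qed.

(** The bound on the coefficients that a convergent series satisfies; up to a
    change of radius it is equivalent to convergence, and it is stable under
    the operations used below. *)
Definition coef_bounded p (M r : R) : Prop :=
  forall m, cabs (p m) * r ^+ expo_deg m <= M.

Lemma coef_bounded_ge0 p M r : 0 < r -> coef_bounded p M r -> 0 <= M.
Proof.
by move=> r0 /(_ 0); apply: le_trans; rewrite mulr_ge0 ?cabs_ge0 ?exprn_ge0 ?ltW.
Qed.

Lemma sums_coef_bound p (r : R) l : 0 <= r ->
  fps_sums_to p (const_mx r%:C) l -> exists2 M, 0 < M & coef_bounded p M r.
Proof.
move=> r0 /fps_sums_toP/sums_coef_bounded[M M0 hM]; exists M => // m.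
have := hM m; rewrite cabsM /monomial cabs_prod.
under eq_bigr do rewrite mxE cabsX cabs_real//.
by rewrite prod_pow_deg.
Qed.

Lemma convergent_coef_bounded p : fps_convergent p ->
  exists2 r, 0 < r & exists2 M, 0 < M & coef_bounded p M r.
Proof.
move=> [r r0 h]; exists (r / 2); first by rewrite divr_gt0.
have [|l /sums_coef_bound hl] := h (const_mx (r / 2)%:C).
  move=> i; rewrite !mxE subr0 cabsE ltcR cabs_real ?divr_ge0 ?ltW//; lra.
by apply: hl; rewrite divr_ge0// ltW.
Qed.

Lemma power_series_coef_bounded f a p : power_series_at f a p ->
  exists2 r, 0 < r & (forall z, polydisc a r z -> fps_sums_to p (z - a) (f z)) /\
    exists2 M, 0 < M & coef_bounded p M r.
Proof.
move=> [r r0 h]; exists (r / 2); first by rewrite divr_gt0.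
split=> [z hz|].
  by apply: h => i; apply: lt_le_trans (hz i) _; rewrite lecR; lra.
have : fps_sums_to p (a + const_mx (r / 2)%:C - a) (f (a + const_mx (r / 2)%:C)).
  apply: h => i; rewrite !mxE addrAC subrr add0r cabsE ltcR cabs_real ?divr_ge0 ?ltW//; lra.
rewrite addrAC subrr add0r => /sums_coef_bound; apply.
by rewrite divr_ge0// ltW.
Qed.

(** The remainder of order [k] of a power series on a small multiple of its
    polydisc of convergence. *)
Lemma coef_bounded_tail p M r z (theta : R) k s :
  0 < r -> coef_bounded p M r -> 0 <= theta <= 1 ->
  (forall i, cabs (z 0 i) <= theta * (r / 2)) -> uniq s ->
  (forall m, m \in s -> (k <= expo_deg m)%N) ->
  \sum_(m <- s) cabs (p m * monomial z m) <= 2 ^+ d * M * theta ^+ k.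
Proof.
move=> r0 pM /andP[t0 t1] zr us sk; have M0 := coef_bounded_ge0 r0 pM.
apply: (@le_trans _ _ (\sum_(m <- s) (M * theta ^+ k) * 2^-1 ^+ expo_deg m)).
  rewrite big_seq [leRHS]big_seq; apply: ler_sum => m /sk km; rewrite cabsM.
  apply: (@le_trans _ _ (cabs (p m) * (theta * (r / 2)) ^+ expo_deg m)).
    by rewrite ler_wpM2l ?cabs_ge0// cabs_monomial_le.
  rewrite !exprMn.
  have h1 := pM m; have h2 : theta ^+ expo_deg m <= theta ^+ k by exact: ler_wiXn2l.
  rewrite [leLHS](_ : _ = (cabs (p m) * r ^+ expo_deg m) * theta ^+ expo_deg m *
    2^-1 ^+ expo_deg m); last by ring.
  rewrite ler_wpM2r ?exprn_ge0 ?invr_ge0//; apply: ler_pM => //.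
    by rewrite mulr_ge0 ?cabs_ge0 ?exprn_ge0 ?ltW.
  by rewrite exprn_ge0.
rewrite -big_distrr /= [leRHS](_ : _ = (M * theta ^+ k) * 2 ^+ d); last by ring.
by rewrite ler_wpM2l ?mulr_ge0 ?exprn_ge0// geometric_sum_le.
Qed.

Lemma coef_bounded_abs p M r z : 0 < r -> coef_bounded p M r ->
  (forall i, cabs (z 0 i) <= r / 2) ->
  abs_bounded (fun m => p m * monomial z m) (2 ^+ d * M).
Proof.
move=> r0 pM zr s us.
rewrite -[leRHS]mulr1 -(expr0 1); apply: (coef_bounded_tail r0 pM) => //.
  by rewrite ler01 lexx.
by move=> i; rewrite mul1r.
Qed.

End CoefficientBounds.

Section Reexpansion.
Variables (R : realType) (d : nat).
Local Notation C := R[i].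
Implicit Types (p : fps C d) (z a h : 'rV[C]_d) (m k : expo d).

Lemma sums_to_unique (T : choiceType) (c : T -> C) l l' :
  sums_to c l -> sums_to c l' -> l = l'.
Proof.
move=> cl cl'; apply/eqP; rewrite -subr_eq0 -[_ == 0]negbK -cabs_gt0 -leNgt.
apply/ler_addgt0Pr => e e0; rewrite add0r.
have e20 : 0 < e / 2 by rewrite divr_gt0.
have [A hA] := cl _ e20; have [A' hA'] := cl' _ e20.
have h1 : cabs (l - \sum_(m <- undup (A ++ A')) c m) <= e / 2.
  by apply: hA; rewrite ?undup_uniq// => m mA; rewrite mem_undup mem_cat mA.
have h2 : cabs (l' - \sum_(m <- undup (A ++ A')) c m) <= e / 2.
  by apply: hA'; rewrite ?undup_uniq// => m mA; rewrite mem_undup mem_cat mA orbT.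
move: h1 h2; set S := \sum_(m <- _) _ => h1 h2.
have -> : l - l' = (l - S) - (l' - S) by ring.
by apply: le_trans (cabsD _ _) _; rewrite cabsN; lra.
Qed.

Definition binom_mono (K : comNzRingType) (x y : 'I_d -> K) m k : K :=
  \prod_(i < d) (x i ^+ (m i - k i) * y i ^+ k i *+ 'C(m i, k i)).

Lemma binom_mono_sum (K : comNzRingType) (x y : 'I_d -> K) m N :
  (forall i, (m i < N)%N) ->
  \sum_(k <- expo_box d N) binom_mono x y m k = \prod_(i < d) (x i + y i) ^+ m i.
Proof.
move=> mN; rewrite /expo_box big_map big_enum /=.
under eq_bigr => f _.
  rewrite /binom_mono; under eq_bigr => i _ do rewrite ffunE; over.
rewrite -(bigA_distr_bigA (fun (i : 'I_d) (j : 'I_N) =>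
  x i ^+ (m i - j) * y i ^+ j *+ 'C(m i, j))) /=.
apply: eq_bigr => i _; rewrite exprDn.
rewrite -!(big_mkord xpredT (fun j => x i ^+ (m i - j) * y i ^+ j *+ 'C(m i, j))).
rewrite (big_cat_nat (n := (m i).+1))//= [X in _ + X = _]big_nat_cond [X in _ + X = _]big1 ?addr0// => j.
by move=> /andP[/andP[mj _] _]; rewrite bin_small// mulr0n.
Qed.

Lemma binom_mono_out (K : comNzRingType) (x y : 'I_d -> K) m k :
  k \notin expo_box d (expo_deg m).+1 -> binom_mono x y m k = 0.
Proof.
rewrite mem_expo_box negb_forall => /existsP[j]; rewrite -leqNgt => mk.
rewrite /binom_mono (bigD1 j)//= bin_small ?mulr0n ?mul0r//.
by apply: leq_trans mk; rewrite ltnS leq_expo_deg.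
Qed.

Lemma cabs_nat (n : nat) : cabs (n%:R : C) = n%:R.
Proof. by rewrite -(rmorph_nat (real_complex R)) cabs_real. Qed.

Lemma cabs_binom_mono (x y : 'I_d -> C) m k :
  cabs (binom_mono x y m k) = binom_mono (fun i => cabs (x i)) (fun i => cabs (y i)) m k.
Proof.
rewrite /binom_mono cabs_prod; apply: eq_bigr => i _.
by rewrite -[in LHS]mulr_natr -[in RHS]mulr_natr !cabsM !cabsX cabs_nat.
Qed.

Lemma binom_double_bounded p M (r : R) a h : 0 < r -> coef_bounded p M r ->
  (forall i, cabs (a 0 i) + cabs (h 0 i) <= r / 2) ->
  abs_bounded (fun mk : expo d * expo d => p mk.1 * binom_mono (a 0) (h 0) mk.1 mk.2)
    (2 ^+ d * M).
Proof.
move=> r0 pM ah s us; have M0 := coef_bounded_ge0 r0 pM.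
pose s1 := undup [seq mk.1 | mk <- s].
pose N := (\sum_(mk <- s) (expo_deg mk.1 + expo_deg mk.2)).+1.
have sN mk : mk \in s -> forall i, (mk.1 i < N)%N /\ (mk.2 i < N)%N.
  move=> mks i; rewrite !ltnS (big_rem mk)//=; split.
    by rewrite (leq_trans (leq_expo_deg _ i))// -addnA leq_addr.
  by rewrite (leq_trans (leq_expo_deg _ i))// addnAC leq_addl.
pose x i := cabs (a 0 i); pose y i := cabs (h 0 i).
have b0 m k : 0 <= binom_mono x y m k.
  by rewrite -cabs_binom_mono cabs_ge0.
apply: (@le_trans _ _ (\sum_(mk <- [seq (m, k) | m <- s1, k <- expo_box d N])
   cabs (p mk.1) * binom_mono x y mk.1 mk.2)).
  under eq_bigr do rewrite cabsM cabs_binom_mono.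
  apply: ler_sum_sub => //.
  - apply: allpairs_uniq; rewrite ?undup_uniq ?expo_box_uniq// => -[? ?] [? ?] _ _ [-> ->]//.
  - move=> [m k] mks; apply: allpairs_f.
      by rewrite mem_undup; apply/mapP; exists (m, k).
    by rewrite mem_expo_box; apply/forallP => i; have [] := sN _ mks i.
  - by move=> mk; rewrite mulr_ge0 ?cabs_ge0.
rewrite big_allpairs_dep /=.
apply: (@le_trans _ _ (\sum_(m <- s1) M * 2^-1 ^+ expo_deg m)).
  rewrite big_seq [leRHS]big_seq; apply: ler_sum => m ms.
  rewrite -big_distrr /= binom_mono_sum; last first.
    move=> i; move: ms; rewrite mem_undup => /mapP[mk mks ->].
    by have [] := sN _ mks i.
  apply: (@le_trans _ _ (cabs (p m) * (r / 2) ^+ expo_deg m)).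
    rewrite ler_wpM2l ?cabs_ge0// -prod_pow_deg; apply: ler_prod => i _.
    rewrite exprn_ge0 ?addr_ge0 ?cabs_ge0//= lerXn2r ?nnegrE ?addr_ge0 ?cabs_ge0//.
      by rewrite divr_ge0// ltW.
    exact: ah.
  rewrite exprMn mulrA ler_wpM2r ?exprn_ge0 ?invr_ge0//; exact: pM.
by rewrite -big_distrr /= mulrC ler_wpM2r// geometric_sum_le// undup_uniq.
Qed.

Lemma monomialD a h m : monomial (a + h) m = \prod_(i < d) (a 0 i + h 0 i) ^+ m i.
Proof. by apply: eq_bigr => i _; rewrite mxE. Qed.

(** Expand all the monomials by the binomial formula around the new centre and
    exchange the sums, which converge absolutely. *)
Lemma reexpansion p M (r : R) a : 0 < r -> coef_bounded p M r ->
  (forall i, cabs (a 0 i) <= r / 4) ->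
  exists q : fps C d, forall h l, (forall i, cabs (h 0 i) <= r / 4) ->
    fps_sums_to p (a + h) l -> fps_sums_to q h l.
Proof.
move=> r0 pM ar.
pose h0 : 'rV[C]_d := const_mx (r / 4)%:C.
have r40 : 0 < r / 4 by rewrite divr_gt0.
have h0r i : cabs (h0 0 i) = r / 4 by rewrite mxE cabs_real// ltW.
pose a1 (i : 'I_d) : C := 1.
have binomE h m k : binom_mono (a 0) (h 0) m k = binom_mono (a 0) a1 m k * monomial h k.
  rewrite /binom_mono /monomial -big_split; apply: eq_bigr => i _ /=.
  by rewrite expr1n mulr1 mulrnAl.
have : forall k, exists l, sums_to (fun m => p m * binom_mono (a 0) a1 m k) l.
  move=> k; apply: (@sums_exists _ _ _ ((r / 4) ^- expo_deg k * (2 ^+ d * M))) => s us.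
  have := @binom_double_bounded p M r a h0 r0 pM _ [seq (m, k) | m <- s].
  rewrite big_map; under eq_bigr do rewrite /= binomE mulrA cabsM.
  rewrite -big_distrl /= => h; rewrite mulrC ler_pdivlMr ?exprn_gt0//.
  have -> : (r / 4) ^+ expo_deg k = cabs (monomial h0 k).
    rewrite /monomial cabs_prod -prod_pow_deg; apply: eq_bigr => i _.
    by rewrite cabsX h0r.
  apply: h; last by rewrite map_inj_uniq// => ? ? [].
  by move=> i; rewrite h0r; have := ar i; lra.
move=> /choice[q hq]; exists q => h l hr /fps_sums_toP hl; apply/fps_sums_toP.
pose c m k := p m * binom_mono (a 0) (h 0) m k.
have ah i : cabs (a 0 i) + cabs (h 0 i) <= r / 2 by have := ar i; have := hr i; lra.
have [L hL] := sums_exists (binom_double_bounded r0 pM ah).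
have hrow : sums_to (fun m => p m * monomial (a + h) m) L.
  apply: (@sums_fubini _ _ _ (fun k m => c m k)); first exact: (sums_to_swap (c := c)).
  move=> m; have -> : p m * monomial (a + h) m =
      \sum_(k <- expo_box d (expo_deg m).+1) c m k.
    rewrite -big_distrr /= binom_mono_sum ?monomialD// => i.
    by rewrite ltnS leq_expo_deg.
  apply: sums_to_fin; first exact: expo_box_uniq.
  by move=> k kN; rewrite /c binom_mono_out ?mulr0.
rewrite -(sums_to_unique hrow hl); apply: (@sums_fubini _ _ _ c _ _ hL) => k.
have := sums_toZ (monomial h k) (hq k); rewrite mulrC; apply: sums_to_ext => m.
by rewrite /c binomE mulrC mulrA.
Qed.

(** The values are the sums at the points of the polydisc; [reexpansion] gives the
    local expansions that holomorphy requires. *)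
Lemma power_series_function p M (r : R) : 0 < r -> coef_bounded p M r ->
  exists f : 'rV[C]_d -> C, [/\ power_series_at f 0 p,
    holomorphic_on (polydisc 0 (r / 4)) f &
    forall z, polydisc 0 (r / 4) z -> `|f z| <= (2 ^+ d * M)%:C].
Proof.
move=> r0 pM; have r40 : 0 < r / 4 by rewrite divr_gt0.
pose f z := xget 0 [set l | fps_sums_to p z l].
have fE z : (forall i, cabs (z 0 i) <= r / 2) -> fps_sums_to p z (f z).
  move=> zr; apply: (xgetPex 0 (P := [set l | fps_sums_to p z l])).
  have [l hl] := sums_exists (coef_bounded_abs r0 pM zr).
  by exists l; apply/fps_sums_toP.
have pd z : polydisc 0 (r / 4) z -> forall i, cabs (z 0 i) < r / 4.
  by move=> hz i; have := hz i; rewrite mxE subr0 cabsE ltcR.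
exists f; split.
- exists (r / 4) => // z /pd hz; rewrite subr0; apply: fE => i.
  by have := hz i; lra.
- move=> a /pd ha; have [|q hq] := @reexpansion p M r a r0 pM.
    by move=> i; exact: ltW.
  exists q, (r / 4) => // z hz; apply: hq; first last.
    by rewrite addrC subrK; apply: fE => i; have := hz i; rewrite cabsE ltcR => h1;
      have := ha i; have := cabsD (z 0 i - a 0 i) (a 0 i); rewrite subrK; lra.
  by move=> i; have := hz i; rewrite !mxE cabsE ltcR => /ltW.
move=> z /pd hz; rewrite -cabs_le.
have zr i : cabs (z 0 i) <= r / 2 by have := hz i; lra.
by apply: sums_le (coef_bounded_abs r0 pM zr); apply/fps_sums_toP/fE.
Qed.

End Reexpansion.

(** * Cauchy estimates *)

Section MaximumPrinciple.
Variable R : realType.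
Local Notation C := R[i].
Implicit Types (f g u : C -> C) (t h : C).

Definition bounded_near (r : R) u : Prop :=
  exists K, forall h, cabs h <= r -> cabs (u h) <= K.

Lemma bounded_near_cst r a : bounded_near r (fun=> a).
Proof. by exists (cabs a). Qed.

Lemma bounded_near_id r : bounded_near r (fun h => h).
Proof. by exists r. Qed.

Lemma bounded_nearD r u v :
  bounded_near r u -> bounded_near r v -> bounded_near r (fun h => u h + v h).
Proof.
move=> [K hK] [L hL]; exists (K + L) => h hr.
by apply: le_trans (cabsD _ _) _; rewrite lerD ?hK ?hL.
Qed.

Lemma bounded_nearM r u v :
  bounded_near r u -> bounded_near r v -> bounded_near r (fun h => u h * v h).
Proof.
move=> [K hK] [L hL]; exists (K * L) => h hr.
by rewrite cabsM ler_pM ?cabs_ge0 ?hK ?hL.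
Qed.

(** Expansion to second order at a point, with a remainder of order three. This
    consequence of holomorphy suffices for the maximum principle, and unlike
    expansions in power series it passes to products and quotients by a finite
    computation. *)
Definition taylor2 f t : Prop := exists r a1 a2 rho, [/\ 0 < r :> R, bounded_near r rho &
  forall h, cabs h <= r -> f (t + h) = f t + a1 * h + a2 * h ^+ 2 + h ^+ 3 * rho h].

Lemma bounded_near_le r r' u : r' <= r -> bounded_near r u -> bounded_near r' u.
Proof. by move=> rr' [K hK]; exists K => h hr; apply: hK; exact: le_trans rr'. Qed.

Lemma taylor2M f g t : taylor2 f t -> taylor2 g t -> taylor2 (fun x => f x * g x) t.
Proof.
move=> [r [a1 [a2 [rho [r0 rhob fE]]]]] [s [b1 [b2 [sig [s0 sigb gE]]]]].
have m0 : 0 < Order.min r s by rewrite lt_min r0.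
have mr : Order.min r s <= r by rewrite ge_min lexx.
have ms : Order.min r s <= s by rewrite ge_min lexx orbT.
exists (Order.min r s), (a1 * g t + f t * b1), (a2 * g t + a1 * b1 + f t * b2),
  (fun h => a1 * b2 + a2 * b1 + a2 * b2 * h + rho h * (g t + b1 * h + b2 * (h * h)) +
     (f t + a1 * h + a2 * (h * h)) * sig h + h * h * h * (rho h * sig h)); split => //.
  have c a := bounded_near_cst (Order.min r s) a.
  have i := bounded_near_id (Order.min r s).
  have rb := bounded_near_le mr rhob; have sb := bounded_near_le ms sigb.
  by repeat (apply: bounded_nearD || apply: bounded_nearM);
    first [exact: rb|exact: sb|exact: i|exact: c].
move=> h hm; rewrite fE ?(le_trans hm)// gE ?(le_trans hm)//; ring.
Qed.

Lemma taylor2_affine (a b : C) t : taylor2 (fun x => a * x + b) t.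
Proof.
exists 1, a, 0, (fun=> 0); split => // [|h _]; first exact: bounded_near_cst.
by ring.
Qed.

Lemma taylor2_cst (a : C) t : taylor2 (fun=> a) t.
Proof.
exists 1, 0, 0, (fun=> 0); split => // [|h _]; first exact: bounded_near_cst.
by ring.
Qed.

Lemma taylor2D f g t : taylor2 f t -> taylor2 g t -> taylor2 (fun x => f x + g x) t.
Proof.
move=> [r [a1 [a2 [rho [r0 rhob fE]]]]] [s [b1 [b2 [sig [s0 sigb gE]]]]].
have m0 : 0 < Order.min r s by rewrite lt_min r0.
have mr : Order.min r s <= r by rewrite ge_min lexx.
have ms : Order.min r s <= s by rewrite ge_min lexx orbT.
exists (Order.min r s), (a1 + b1), (a2 + b2), (fun h => rho h + sig h); split => //.
  by apply: bounded_nearD; [exact: bounded_near_le mr _|exact: bounded_near_le ms _].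
move=> h hm; rewrite fE ?(le_trans hm)// gE ?(le_trans hm)//; ring.
Qed.

Lemma taylor2V t : t != 0 -> taylor2 (fun x => x^-1) t.
Proof.
move=> t0; have ct : 0 < cabs t by rewrite cabs_gt0.
have half h : cabs h <= cabs t / 2 -> cabs t / 2 <= cabs (t + h).
  by move=> hh; have := cabsD (t + h) (- h); rewrite addrK cabsN; lra.
exists (cabs t / 2), (- t ^- 2), (t ^- 3), (fun h => - (t ^- 3 * (t + h)^-1)).
split; first by rewrite divr_gt0.
  exists (cabs (t ^- 3) * (cabs t / 2)^-1) => h /half hh.
  rewrite cabsN cabsM ler_wpM2l ?cabs_ge0// cabsV lef_pV2// posrE ?divr_gt0//.
  by apply: lt_le_trans hh; rewrite divr_gt0.
move=> h /half hh.
have th : t + h != 0.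
  by rewrite -cabs_gt0; apply: lt_le_trans hh; rewrite divr_gt0.
by field; rewrite t0 th.
Qed.

Lemma taylor2VX t n : t != 0 -> taylor2 (fun x => x ^- n) t.
Proof.
move=> t0; elim: n => [|n IH].
  by under [X in taylor2 X]funext do rewrite expr0 invr1; exact: taylor2_cst.
have -> : (fun x : C => x ^- n.+1) = (fun x => x^-1 * x ^- n).
  by apply/funext => x; rewrite exprS invfM mulrC.
by apply: taylor2M => //; exact: taylor2V.
Qed.

Lemma taylor2X t n : taylor2 (fun x => x ^+ n) t.
Proof.
elim: n => [|n IH].
  by under [X in taylor2 X]funext do rewrite expr0; exact: taylor2_cst.
have -> : (fun x : C => x ^+ n.+1) = (fun x => (1 * x + 0) * x ^+ n).
  by apply/funext => x; rewrite exprS mul1r addr0.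
by apply: taylor2M => //; exact: taylor2_affine.
Qed.

Lemma taylor2_sum (n : nat) (F : nat -> C -> C) t :
  (forall j, taylor2 (F j) t) -> taylor2 (fun x => \sum_(j < n) F j x) t.
Proof.
move=> hF; elim: n => [|n IH].
  by under [X in taylor2 X]funext do rewrite big_ord0; exact: taylor2_cst.
by under [X in taylor2 X]funext do rewrite big_ord_recr /=; exact: taylor2D.
Qed.

Lemma taylor2_near f g t (r : R) : 0 < r -> (forall h, cabs h <= r -> f (t + h) = g (t + h)) ->
  taylor2 g t -> taylor2 f t.
Proof.
move=> r0 fg [s [b1 [b2 [sig [s0 sigb gE]]]]].
have m0 : 0 < Order.min r s by rewrite lt_min r0.
have mr : Order.min r s <= r by rewrite ge_min lexx.
have ms : Order.min r s <= s by rewrite ge_min lexx orbT.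
exists (Order.min r s), b1, b2, sig; split => //; first exact: bounded_near_le ms _.
move=> h hm; rewrite fg ?(le_trans hm)// gE ?(le_trans hm)//.
have := fg 0; rewrite addr0 => -> //.
by rewrite cabs0 ltW.
Qed.

Lemma taylor2_lipschitz f t : taylor2 f t -> exists r K, [/\ 0 < r, 0 <= K &
  forall h, cabs h <= r -> cabs (f (t + h) - f t) <= K * cabs h].
Proof.
move=> [r [a1 [a2 [rho [r0 rhob fE]]]]].
have [K hK] : bounded_near r (fun h => a1 + a2 * h + h * h * rho h).
  have i := bounded_near_id r; have c a := bounded_near_cst r a.
  by repeat (apply: bounded_nearD || apply: bounded_nearM);
    first [exact: rhob|exact: i|exact: c].
exists r, K; split => // [|h hr].
  by apply: le_trans (hK 0 _); rewrite ?cabs_ge0// cabs0 ltW.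
have -> : f (t + h) - f t = (a1 + a2 * h + h * h * rho h) * h by rewrite fE//; ring.
by rewrite cabsM ler_wpM2r ?cabs_ge0 ?hK.
Qed.

Lemma cabs_sqr (x y : R) : cabs (x +i* y) ^+ 2 = x ^+ 2 + y ^+ 2.
Proof. by rewrite /cabs /= sqr_sqrtr// addr_ge0 ?sqr_ge0. Qed.

Lemma cabs_i : cabs ('i : C) = 1.
Proof. by apply: complexI; rewrite -cabsE normCi. Qed.

Lemma cabs_le_sum (x y : R) : cabs (x +i* y) <= `|x| + `|y|.
Proof.
have xy : 0 <= `|x| + `|y| by rewrite addr_ge0.
rewrite -(@ler_pXn2r _ 2)// ?nnegrE ?cabs_ge0// cabs_sqr sqrrD !real_normK ?num_real//.
by rewrite addrAC lerDl mulrn_wge0// mulr_ge0.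
Qed.

(** The mean over the four vertices of a small square: the terms of orders one
    and two of the expansion cancel. *)
Lemma taylor2_mean f t : taylor2 f t -> exists r K, [/\ 0 < r, 0 <= K &
  forall del : R, 0 < del <= r -> 4 * cabs (f t) <=
    cabs (f (t + del%:C)) + cabs (f (t + 'i * del%:C)) +
    cabs (f (t - del%:C)) + cabs (f (t - 'i * del%:C)) + 4 * K * del ^+ 3].
Proof.
move=> [r [a1 [a2 [rho [r0 [K hK] fE]]]]].
exists r, K; split => // [|del /andP[d0 dr]].
  by apply: le_trans (hK 0 _); rewrite ?cabs_ge0// cabs0 ltW.
have cd : cabs del%:C = del by rewrite cabs_real// ltW.
have h1 : cabs del%:C <= r by rewrite cd.
have h2 : cabs ('i * del%:C) <= r by rewrite cabsM cabs_i mul1r cd.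
have h3 : cabs (- del%:C) <= r by rewrite cabsN cd.
have h4 : cabs (- ('i * del%:C)) <= r by rewrite cabsN.
have e1 := fE _ h1; have e2 := fE _ h2; have e3 := fE _ h3; have e4 := fE _ h4.
have b1 := hK _ h1; have b2 := hK _ h2; have b3 := hK _ h3; have b4 := hK _ h4.
set x1 := f _ in e1 *; set x2 := f _ in e2 *; set x3 := f _ in e3 *; set x4 := f _ in e4 *.
set r1 := rho _ in e1 b1; set r2 := rho _ in e2 b2; set r3 := rho _ in e3 b3.
set r4 := rho _ in e4 b4.
have key : 4 * f t = x1 + x2 + x3 + x4 - del%:C ^+ 3 * (r1 - 'i * r2 - r3 + 'i * r4).
  have ii : 'i * 'i = -1 :> C by rewrite -expr2 sqrCi.
  have ii2 : 'i ^+ 2 = -1 :> C by exact: sqrCi.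
  have ii3 : 'i ^+ 3 = - 'i :> C by rewrite exprS ii2 mulrN1.
  rewrite e1 e2 e3 e4 !exprMn !sqrrN !exprMn ii2.
  have -> : (- ('i * del%:C)) ^+ 3 = 'i * del%:C ^+ 3.
    by rewrite exprNn exprMn ii3 !exprS expr0; ring.
  by rewrite ii3 exprNn !exprS !expr0; ring.
have -> : 4 * cabs (f t) = cabs (4 * f t) by rewrite cabsM cabs_nat.
rewrite key; apply: le_trans (cabsD _ _) _; apply: lerD.
  by do 3![apply: le_trans (cabsD _ _) _; apply: lerD => //].
rewrite cabsN cabsM cabsX cd mulrC ler_wpM2r ?exprn_ge0 ?(ltW d0)//.
have b : cabs (r1 - 'i * r2 - r3 + 'i * r4) <= cabs r1 + cabs r2 + cabs r3 + cabs r4.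
  apply: le_trans (cabsD _ _) _; rewrite cabsM cabs_i mul1r lerD2r.
  apply: le_trans (cabsD _ _) _; rewrite cabsN lerD2r.
  by apply: le_trans (cabsD _ _) _; rewrite cabsN cabsM cabs_i mul1r.
by apply: le_trans b _; lra.
Qed.

Lemma shift_half (x del : R) : `|x| < 1 / 2 -> 0 <= del -> del <= 1 / 2 - `|x| ->
  [/\ - (1 / 2) <= x <= 1 / 2, - (1 / 2) <= x + del <= 1 / 2 &
      - (1 / 2) <= x - del <= 1 / 2].
Proof.
move=> hx d0 dx; have /andP[x1 x2] : - `|x| <= x <= `|x| by rewrite -ler_norml.
by split; apply/andP; split; lra.
Qed.

(** Adding a small multiple of the square of the modulus makes the mean over the
    vertices of a small square strictly larger than the value at the centre, so
    a maximum over the square is attained at the boundary. *)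
Lemma maximum_principle f M :
  (forall t, cabs t < 1 -> taylor2 f t) ->
  (forall t, 1 / 2 <= cabs t -> cabs t < 1 -> cabs (f t) <= M) ->
  cabs (f 0) <= M.
Proof.
move=> hf hM; apply/ler_addgt0Pr => eps eps0.
pose psi (p : R * R) := cabs (f (p.1 +i* p.2)) + eps * cabs (p.1 +i* p.2) ^+ 2.
pose A := `[- (1 / 2) : R, 1 / 2] `*` `[- (1 / 2) : R, 1 / 2].
have A1 (p : R * R) : A p -> cabs (p.1 +i* p.2) < 1.
  move=> [/=]; rewrite !in_itv /= => /andP[x1 x2] /andP[y1 y2].
  rewrite -(@ltr_pXn2r _ 2)// ?nnegrE ?cabs_ge0// cabs_sqr expr1n; nra.
have cA : compact A by apply: compact_setX; exact: segment_compact.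
have A0 : A !=set0.
  by exists (0, 0); split; rewrite /= in_itv /=; apply/andP; split; lra.
have psi_cont : {within A, continuous psi}.
  apply: continuous_in_subspaceT => p; rewrite inE => /A1 tp.
  set t := p.1 +i* p.2 in tp.
  have [r [K [r0 K0 hK]]] := taylor2_lipschitz (hf t tp).
  apply/cvgrPdist_le => e e0.
  pose KK := K + eps * 3.
  have KK0 : 0 < KK by rewrite /KK; have := mulr_gt0 eps0 (ltr0Sn R 2); lra.
  pose del := Order.min (Order.min r 1) (e / KK) / 2.
  have min0 : 0 < Order.min (Order.min r 1) (e / KK).
    by rewrite !lt_min r0 ltr01 divr_gt0.
  have del0 : 0 < del by rewrite divr_gt0.
  exists (ball p.1 del, ball p.2 del); first by split; exact: nbhsx_ballx.
  move=> q [/= q1 q2].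
  have qE : q.1 +i* q.2 = t + ((q.1 - p.1) +i* (q.2 - p.2)).
    by rewrite /t /= addrC; apply/eqP; rewrite eq_complex /= !subrK !eqxx.
  set h := (q.1 - p.1) +i* (q.2 - p.2) in qE.
  have hh : cabs h <= Order.min (Order.min r 1) (e / KK).
    apply: le_trans (cabs_le_sum _ _) _; rewrite [leRHS]splitr.
    by rewrite lerD// ltW// distrC; [exact: q1|exact: q2].
  have [hr h1 he] : [/\ cabs h <= r, cabs h <= 1 & cabs h <= e / KK].
    by move: hh; rewrite !le_min => /andP[/andP[]].
  have hf1 := hK _ hr; have h0 := cabs_ge0 h.
  have d1 : `|cabs (f (t + h)) - cabs (f t)| <= K * cabs h.
    apply: le_trans hf1; rewrite ler_norml; apply/andP; split.
      have e1 : cabs (f t - f (t + h)) = cabs (f (t + h) - f t) by rewrite -cabsN opprB.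
      by have := cabsD (f t - f (t + h)) (f (t + h)); rewrite subrK e1; lra.
    by have := cabsD (f (t + h) - f t) (f t); rewrite subrK; lra.
  have d2 : `|cabs (t + h) ^+ 2 - cabs t ^+ 2| <= 3 * cabs h.
    have t0 := cabs_ge0 t; have th0 := cabs_ge0 (t + h); have a1 := cabsD t h.
    have a2 : cabs t <= cabs (t + h) + cabs h.
      by have := cabsD (t + h) (- h); rewrite addrK cabsN.
    rewrite ler_norml; apply/andP; split; nra.
  rewrite /psi -/t qE distrC opprD addrACA -mulrBr.
  apply: le_trans (ler_normD _ _) _; rewrite normrM (gtr0_norm eps0).
  apply: (@le_trans _ _ (KK * cabs h)).
    by rewrite /KK mulrDl lerD// -mulrA ler_wpM2l// ltW.
  by rewrite mulrC -ler_pdivlMr.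
have [[x y] /[!inE] cin cmax] := compact_EVT_max A0 cA psi_cont.
have c1 := A1 _ cin; set t := x +i* y in c1.
have := cmax (0, 0); rewrite inE => /(_ _).
have in00 : A (0, 0) by split; rewrite /= in_itv /=; apply/andP; split; lra.
move=> /(_ in00); rewrite /psi /= -/t.
have -> : (0 +i* 0 : C) = 0 by [].
rewrite cabs0 expr0n mulr0 addr0 => h00.
have [tb|tb] := leP (1 / 2) (cabs t).
  apply: le_trans h00 _; rewrite lerD ?hM//.
  rewrite -[leRHS]mulr1 ler_wpM2l ?(ltW eps0)// expr_le1 ?cabs_ge0//; exact: ltW.
exfalso.
have [r [K [r0 K0 hmean]]] := taylor2_mean (hf t c1).
have tx : `|x| < 1 / 2 /\ `|y| < 1 / 2.
  have h2 : x ^+ 2 + y ^+ 2 < (1 / 2) ^+ 2.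
    by rewrite -cabs_sqr ltrXn2r// ?nnegrE ?cabs_ge0//.
  by split; rewrite -(@ltr_pXn2r _ 2)// ?nnegrE// real_normK ?num_real//;
    apply: le_lt_trans h2; rewrite ?lerDl ?lerDr sqr_ge0.
case: tx => tx ty.
pose del := Order.min (Order.min r (eps / (2 * (K + 1))))
  (Order.min (1 / 2 - `|x|) (1 / 2 - `|y|)).
have K1 : 0 < 2 * (K + 1) by rewrite mulr_gt0// ltr_wpDl.
have del0 : 0 < del by rewrite !lt_min r0 divr_gt0//= !subr_gt0 tx ty.
have [dr dK dx dy] : [/\ del <= r, del <= eps / (2 * (K + 1)), del <= 1 / 2 - `|x| &
    del <= 1 / 2 - `|y|].
  have : del <= del by []. by rewrite {2}/del !le_min => /andP[/andP[-> ->] /andP[-> ->]].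
have := hmean del; rewrite del0 dr => /(_ isT).
have e1 : t + del%:C = (x + del) +i* y.
  by apply/eqP; rewrite eq_complex /= addr0 !eqxx.
have e2 : t + 'i * del%:C = x +i* (y + del).
  apply/eqP; rewrite eq_complex /=; apply/andP; split; apply/eqP; ring.
have e3 : t - del%:C = (x - del) +i* y.
  by apply/eqP; rewrite eq_complex /= oppr0 addr0 !eqxx.
have e4 : t - 'i * del%:C = x +i* (y - del).
  apply/eqP; rewrite eq_complex /=; apply/andP; split; apply/eqP; ring.
rewrite e1 e2 e3 e4.
have inA a b : - (1 / 2) <= a <= 1 / 2 -> - (1 / 2) <= b <= 1 / 2 -> A (a, b).
  by move=> ha hb; split; rewrite /= in_itv.
have p1 := cmax (x + del, y); have p2 := cmax (x, y + del).
have p3 := cmax (x - del, y); have p4 := cmax (x, y - del).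
rewrite /psi !inE /= -/t !cabs_sqr in p1 p2 p3 p4.
have [hx hxp hxm] := shift_half tx (ltW del0) dx.
have [hy hyp hym] := shift_half ty (ltW del0) dy.
have {}p1 := p1 (inA _ _ _ _); have {}p2 := p2 (inA _ _ _ _).
have {}p3 := p3 (inA _ _ _ _); have {}p4 := p4 (inA _ _ _ _).
have q1 := p1 hxp hy.
have q2 := p2 hx hyp.
have q3 := p3 hxm hy.
have q4 := p4 hx hym.
have dK2 : K * del < eps.
  move: dK; rewrite ler_pdivlMr// => dK; have := mulr_ge0 K0 (ltW del0).
  by clear - dK del0; lra.
have d3 : K * del ^+ 3 < eps * del ^+ 2.
  have -> : K * del ^+ 3 = (K * del) * del ^+ 2 by ring.
  by rewrite ltr_pM2r// exprn_gt0.
clear - q1 q2 q3 q4 d3 => hh.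
have s1 : eps * ((x + del) ^+ 2 + y ^+ 2) + eps * (x ^+ 2 + (y + del) ^+ 2) +
  eps * ((x - del) ^+ 2 + y ^+ 2) + eps * (x ^+ 2 + (y - del) ^+ 2) =
  4 * (eps * (x ^+ 2 + y ^+ 2)) + 4 * (eps * del ^+ 2) by ring.
by lra.
Qed.

(** Cauchy estimates on the unit disc: the maximum principle is applied to the
    quotient of the remainder of order [k] by the power [k] of the variable. *)
Lemma cauchy_estimate_disc f (c : nat -> C) M :
  (forall t, cabs t < 1 -> taylor2 f t) ->
  (forall t, cabs t < 1 -> cabs (f t) <= M) ->
  (forall k, exists r K, 0 < r /\ forall h, cabs h <= r ->
     cabs (f h - \sum_(j < k) c j * h ^+ j) <= K * cabs h ^+ k) ->
  forall k, cabs (c k) <= 4 ^+ k * M.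
Proof.
move=> hf hM hc k; elim/ltn_ind: k => k IH.
have M0 : 0 <= M by apply: le_trans (cabs_ge0 _) (hM 0 _); rewrite cabs0.
pose g t := if t == 0 then c k else (f t - \sum_(j < k) c j * t ^+ j) * t ^- k.
rewrite [c k](_ : _ = g 0); last by rewrite /g eqxx.
apply: maximum_principle => [t t1|t tge tlt].
  have [->|t0] := eqVneq t 0.
    have [r [K [r0 hK]]] := hc (k + 3)%N.
    exists r, (c k.+1), (c k.+2), (fun h => if h == 0 then 0 else
      (f h - \sum_(j < k + 3) c j * h ^+ j) * h ^- (k + 3)); split => //.
      exists `|K| => h hr; case: eqP => [_|/eqP h0]; first by rewrite cabs0.
      have hp : 0 < cabs h ^+ (k + 3) by rewrite exprn_gt0// cabs_gt0.
      rewrite cabsM cabsV cabsX ler_pdivrMr//; apply: le_trans (hK h hr) _.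
      by rewrite ler_wpM2r ?(ltW hp)// ler_norm.
    move=> h hr; rewrite add0r /g eqxx; case: eqP => [->|/eqP h0]; first by ring.
    rewrite addn3 !big_ord_recr /= !exprS; have hk : h ^+ k != 0 by rewrite expf_neq0.
    by field; rewrite h0 hk.
  apply: (@taylor2_near _ (fun x => (f x + \sum_(j < k) (- c j) * x ^+ j) * x ^- k) _
    (cabs t / 2)); first by rewrite divr_gt0// cabs_gt0.
    move=> h hh; rewrite /g.
    have th : t + h != 0.
      have ct : 0 < cabs t by rewrite cabs_gt0.
      by rewrite -cabs_gt0; have := cabsD (t + h) (- h); rewrite addrK cabsN; lra.
    rewrite (negPf th) -sumrN; congr ((_ + _) * _).
    by apply: eq_bigr => j _; rewrite mulNr.
  apply: taylor2M; last exact: taylor2VX.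
  apply: taylor2D; first exact: hf.
  apply: (@taylor2_sum k (fun j x => - c j * x ^+ j)) => j.
  by apply: taylor2M; [exact: taylor2_cst|exact: taylor2X].
have ct : 0 < cabs t by apply: lt_le_trans tge; lra.
have t0 : t != 0 by rewrite -cabs_gt0.
rewrite /g (negPf t0) cabsM cabsV cabsX ler_pdivrMr ?exprn_gt0//.
apply: le_trans (cabsD _ _) _; rewrite cabsN.
apply: (@le_trans _ _ (M + \sum_(j < k) 4 ^+ j * M * cabs t ^+ j)).
  apply: lerD; first exact: hM.
  apply: le_trans (cabs_sum _ _ _) _; apply: ler_sum => j _.
  by rewrite cabsM cabsX ler_wpM2r ?exprn_ge0 ?(ltW ct)// IH.
have x2 : 1 <= 2 * cabs t by lra.
move: (cabs t) ct x2 => x x0 x2.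
suff h (n : nat) : M + \sum_(j < n) 4 ^+ j * M * x ^+ j <= 4 ^+ n * M * x ^+ n by exact: h.
elim: n => [|n IHn]; first by rewrite big_ord0 !expr0 addr0; lra.
rewrite big_ord_recr /= addrA; apply: (@le_trans _ _ (4 ^+ n * M * x ^+ n *+ 2)).
  by rewrite mulr2n lerD.
rewrite -mulr_natr !exprS.
have h0 : 0 <= 4 ^+ n * M * x ^+ n by rewrite !mulr_ge0 ?exprn_ge0// ltW.
have -> : 4 * 4 ^+ n * M * (x * x ^+ n) = 4 ^+ n * M * x ^+ n * (4 * x) by ring.
by rewrite ler_wpM2l//; lra.
Qed.

End MaximumPrinciple.

Section CauchyEstimates.
Variables (R : realType) (d : nat).
Local Notation C := R[i].
Implicit Types (p : fps C d) (z a : 'rV[C]_d) (m : expo d).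

Definition hom_part p z (k : nat) : C :=
  \sum_(m <- expo_box d k.+1 | expo_deg m == k) p m * monomial z m.

Lemma big_expo_box_deg (V : nmodType) (F : expo d -> V) (j k : nat) : (j < k)%N ->
  \sum_(m <- expo_box d k | expo_deg m == j) F m =
  \sum_(m <- expo_box d j.+1 | expo_deg m == j) F m.
Proof.
move=> jk; rewrite -big_filter -[RHS]big_filter; apply/perm_big/uniq_perm.
- exact/filter_uniq/expo_box_uniq.
- exact/filter_uniq/expo_box_uniq.
move=> m; rewrite !mem_filter !mem_expo_box; case: eqP => //= mj.
have mi i : (m i < j.+1)%N by rewrite ltnS -mj leq_expo_deg.
have -> : [forall i, (m i < j.+1)%N] by apply/forallP.
by apply/forallP => i; apply: leq_trans (mi i) _.
Qed.

Lemma monomialZ (h : C) z m : monomial (h *: z) m = h ^+ expo_deg m * monomial z m.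
Proof.
rewrite /monomial -prod_pow_deg -big_split; apply: eq_bigr => i _ /=.
by rewrite mxE exprMn.
Qed.

Lemma sum_hom_part p z (h : C) k :
  \sum_(m <- [seq m <- expo_box d k | (expo_deg m < k)%N]) p m * monomial (h *: z) m =
  \sum_(j < k) hom_part p z j * h ^+ j.
Proof.
rewrite big_filter.
under [RHS]eq_bigr => j _.
  rewrite /hom_part -(@big_expo_box_deg _ _ _ k)// big_distrl /= big_mkcond.
  over.
rewrite /= exchange_big /= big_mkcond; apply: eq_bigr => m _.
case: ifP => mk; last first.
  rewrite big1// => j _; case: eqP => // mj.
  by rewrite mj ltn_ord in mk.
rewrite (bigD1 (Ordinal mk))//= eqxx big1 ?addr0 => [|j jm].
  by rewrite monomialZ; ring.
by case: eqP => // mj; case/eqP: jm; apply/val_inj.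
Qed.

(** On a complex line the remainders of a power series in several variables obey
    the same estimates as in one variable. *)
Lemma slice_expansion f a p z (zeta : R) : power_series_at f a p ->
  0 < zeta -> (forall i, cabs (z 0 i) <= zeta) ->
  exists2 r, 0 < r & forall k, exists K, forall h, cabs h <= r ->
    cabs (f (a + h *: z) - \sum_(j < k) hom_part p z j * h ^+ j) <= K * cabs h ^+ k.
Proof.
move=> /power_series_coef_bounded[r r0 [hs [M M0 pM]]] z0 hz.
exists (r / (2 * zeta)); first by rewrite divr_gt0// mulr_gt0.
move=> k; exists (2 ^+ d * M * (2 * zeta / r) ^+ k) => h hr.
have h0 := cabs_ge0 h; have hzi i : cabs ((h *: z) 0 i) <= cabs h * (2 * zeta / r) * (r / 2).
  rewrite mxE cabsM -mulrA ler_wpM2l//.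
  by rewrite (_ : _ / r * _ = zeta) ?hz//; field; exact: lt0r_neq0.
have th1 : cabs h * (2 * zeta / r) <= 1.
  move: hr; rewrite ler_pdivlMr ?mulr_gt0// => hr.
  by rewrite mulrA ler_pdivrMr// mul1r.
have /fps_sums_toP hsum : fps_sums_to p (h *: z) (f (a + h *: z)).
  rewrite -{1}[h *: z](addrK a) [_ + a]addrC; apply: hs => i.
  rewrite mxE addrAC subrr add0r cabsE ltcR; apply: le_lt_trans (hzi i) _.
  have : cabs h * (2 * zeta / r) * (r / 2) <= 1 * (r / 2).
    by rewrite ler_wpM2r// divr_ge0// ltW.
  by lra.
rewrite -sum_hom_part.
have -> : 2 ^+ d * M * (2 * zeta / r) ^+ k * cabs h ^+ k =
  2 ^+ d * M * (cabs h * (2 * zeta / r)) ^+ k by rewrite [in RHS]exprMn; ring.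
apply: sums_tail => //; first exact/filter_uniq/expo_box_uniq.
move=> s us hsA; apply: (coef_bounded_tail r0 pM) => //.
  by rewrite th1 mulr_ge0// divr_ge0 ?mulr_ge0 ?ltW.
move=> m /hsA; rewrite mem_filter negb_and -leqNgt => /orP[//|].
apply: contraR; rewrite -ltnNge => mk; rewrite mem_expo_box; apply/forallP => i.
exact: leq_ltn_trans (leq_expo_deg m i) mk.
Qed.

Lemma slice_taylor2 f p z (t0 : C) : power_series_at f (t0 *: z) p ->
  taylor2 (fun t => f (t *: z)) t0.
Proof.
move=> fp; have [zeta z0 hz] : exists2 zeta : R, 0 < zeta & forall i, cabs (z 0 i) <= zeta.
  exists (1 + \sum_i cabs (z 0 i)).
    by rewrite ltr_pwDl// sumr_ge0// => i _; exact: cabs_ge0.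
  move=> i; rewrite (bigD1 i)//= addrCA lerDl addr_ge0// sumr_ge0// => j _; exact: cabs_ge0.
have [r r0 hk] := slice_expansion fp z0 hz.
have c0 : hom_part p z 0 = f (t0 *: z).
  have [K /(_ 0)] := hk 1%N; rewrite cabs0 big_ord1 expr0 mulr1 scale0r addr0 expr1 mulr0.
  move=> /(_ (ltW r0)) h0; apply/esym/eqP; rewrite -subr_eq0 -[_ == 0]negbK -cabs_gt0 -leNgt.
  exact: h0.
have [K hK] := hk 3%N.
exists r, (hom_part p z 1), (hom_part p z 2), (fun h => if h == 0 then 0 else
  (f (t0 *: z + h *: z) - \sum_(j < 3) hom_part p z j * h ^+ j) / h ^+ 3); split => //.
  exists `|K| => h hr; case: eqP => [_|/eqP h0]; first by rewrite cabs0.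
  have hp : 0 < cabs h ^+ 3 by rewrite exprn_gt0// cabs_gt0.
  rewrite cabsM cabsV cabsX ler_pdivrMr//; apply: le_trans (hK h hr) _.
  by rewrite ler_wpM2r ?(ltW hp)// ler_norm.
move=> h hr; rewrite scalerDl -c0 !big_ord_recr big_ord0 /=.
case: eqP => [->|/eqP h0]; first by rewrite scale0r addr0 c0; ring.
by field.
Qed.

(** A polynomial that is homogeneous of degree [k] and bounded on a polydisc has
    bounded coefficients: average over the roots of unity in each variable. *)
Lemma hom_part_coef p (r : R) k X : 0 <= r ->
  (forall z, (forall i, cabs (z 0 i) <= r) -> cabs (hom_part p z k) <= X) ->
  forall m0, expo_deg m0 = k -> cabs (p m0) * r ^+ k <= X.
Proof.
move=> r0 hX m0 m0k; pose N := k.+1.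
have [zeta prim] : exists zeta : C, N.-primitive_root zeta.
  pose q : {poly C} := 'X^N - 1; have [rs qE] := closed_field_poly_normal q.
  rewrite (monicP _) ?monicXnsubC// scale1r in qE.
  have rs1 : all N.-unity_root rs by apply/allP => z; rewrite -root_prod_XsubC -qE.
  have sz : (N < (size rs).+1)%N by rewrite -(size_prod_XsubC rs id) -qE size_XnsubC.
  have [|z] := hasP (has_prim_root (ltn0Sn k) rs1 _ sz); last by exists z.
  by rewrite -separable_prod_XsubC -qE separable_Xn_sub_1// pnatr_eq0.
have zN := prim_expr_order prim.
have cz : cabs zeta = 1.
  apply/eqP; rewrite -(@pexpr_eq1 _ _ N)// ?cabs_ge0//.
  by rewrite -cabsX zN cabs1.
have orth (x y : nat) : (x < N)%N -> (y < N)%N ->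
    \sum_(j < N) zeta ^+ (j * (N - y)) * zeta ^+ (j * x) = if x == y then N%:R else 0.
  move=> xN yN; under eq_bigr => j _ do rewrite -exprD -mulnDr mulnC exprM.
  case: eqP => [->|xy].
    rewrite subnK 1?ltnW// zN.
    by under eq_bigr do rewrite expr1n; rewrite sumr_const card_ord.
  pose w := zeta ^+ (N - y + x).
  have w1 : w != 1.
    rewrite /w -(prim_order_dvd prim); apply/negP => /dvdnP[q hq].
    move: hq xN yN xy; move: (N) => n; case: q => [|[|q]]; first by lia.
      by lia.
    by rewrite !mulSn; lia.
  have : (w - 1) * \sum_(j < N) w ^+ j = 0.
    by rewrite -subrX1 /w exprAC zN expr1n subrr.
  by move/eqP; rewrite mulf_eq0 subr_eq0 (negPf w1) /= => /eqP.
pose zw (v : {ffun 'I_d -> 'I_N}) : 'rV[C]_d := \row_i (r%:C * zeta ^+ v i).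
have czw v i : cabs (zw v 0 i) <= r.
  by rewrite mxE cabsM cabsX cz expr1n mulr1 cabs_real.
pose S := \sum_(v : {ffun 'I_d -> 'I_N})
  (\prod_i zeta ^+ (v i * (N - m0 i))) * hom_part p (zw v) k.
have m0N i : (m0 i < N)%N by rewrite ltnS -m0k leq_expo_deg.
have SE : S = (N ^ d)%:R * (p m0 * r%:C ^+ k).
  rewrite /S; under eq_bigr do rewrite /hom_part big_distrr /=.
  rewrite exchange_big /=.
  transitivity (\sum_(m <- expo_box d N | expo_deg m == k)
      p m * r%:C ^+ k * \prod_i (if m i == m0 i then N%:R else 0 : C)).
    rewrite big_seq_cond [RHS]big_seq_cond; apply: eq_bigr => m /andP[+ /eqP mk].
    rewrite mem_expo_box => /forallP mN.
    under [in RHS]eq_bigr => i _ do rewrite -orth//.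
    rewrite bigA_distr_bigA big_distrr /=; apply: eq_bigr => v _.
    rewrite mulrCA -mulrA; congr (_ * _); rewrite /monomial -mk -prod_pow_deg.
    rewrite -!big_split; apply: eq_bigr => i _ /=.
    by rewrite mxE exprMn -exprM mulrCA.
  rewrite big_mkcond (bigD1_seq m0) ?expo_box_uniq ?mem_expo_box//=; last by apply/forallP.
  rewrite m0k eqxx [X in _ + X = _]big1 ?addr0 => [|m mm0].
    rewrite (eq_bigr (fun=> N%:R)) => [|i _]; last by rewrite eqxx.
    by rewrite prodr_const card_ord natrX mulrC.
  have [i mi] : exists i, m i != m0 i.
    apply/existsP; rewrite -negb_forall; apply: contra mm0 => /forallP h.
    by apply/eqP/ffunP => i; apply/eqP.
  by case: ifP => // _; rewrite (bigD1 i)//= (negPf mi) mul0r mulr0.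
have Nd0 : 0 < (N ^ d)%:R :> R by rewrite ltr0n expn_gt0.
have cS : cabs S <= (N ^ d)%:R * X.
  apply: le_trans (cabs_sum _ _ _) _.
  apply: (@le_trans _ _ (\sum_(v : {ffun 'I_d -> 'I_N}) X)); last first.
    by rewrite sumr_const card_ffun !card_ord mulr_natl.
  apply: ler_sum => v _; rewrite cabsM cabs_prod big1 ?mul1r; first exact: hX.
  by move=> i _; rewrite cabsX cz expr1n.
by move: cS; rewrite SE !cabsM cabs_nat cabsX cabs_real// ler_pM2l.
Qed.

(** The radius is divided by two to stay inside the polydisc, and by four for the
    factor [4 ^+ k] of the estimate on the disc. *)
Lemma cauchy_estimate f p (rho M : R) : 0 < rho ->
  holomorphic_on (polydisc 0 rho) f ->
  (forall z, polydisc 0 rho z -> `|f z| <= M%:C) ->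
  power_series_at f 0 p -> coef_bounded p M (rho / 8).
Proof.
move=> rho0 hol fM fp m0.
have key z k : (forall i, cabs (z 0 i) <= rho / 2) -> cabs (hom_part p z k) <= 4 ^+ k * M.
  move=> hz; have inD t : cabs t < 1 -> polydisc 0 rho (t *: z).
    move=> t1 i; rewrite !mxE subr0 cabsE ltcR cabsM.
    apply: (@le_lt_trans _ _ (1 * (rho / 2))); last by lra.
    by apply: ler_pM; rewrite ?cabs_ge0// ltW.
  apply: (@cauchy_estimate_disc _ (fun t => f (t *: z)) (hom_part p z)).
  - by move=> t /inD/hol[q]; exact: slice_taylor2.
  - by move=> t /inD/fM; rewrite -cabs_le.
  have rho20 : 0 < rho / 2 by rewrite divr_gt0.
  have [r r0 hk] := slice_expansion fp rho20 hz.
  move=> j; have [K hK] := hk j; exists r, K; split=> // h hr.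
  by have := hK h hr; rewrite add0r.
have r0 : 0 <= rho / 2 by rewrite divr_ge0// ltW.
have := hom_part_coef r0 (fun z => key z _) (erefl (expo_deg m0)).
have -> : rho / 8 = rho / 2 * 4^-1 by field.
rewrite [X in _ -> _ * X <= _]exprMn mulrA [X in _ -> _ * X <= _]exprVn.
by rewrite [_ <= M]ler_pdivrMr ?exprn_gt0// [M * _]mulrC.
Qed.

End CauchyEstimates.

(** * Division by the pulled back series *)

Section CongruenceStep.
Variables (A : comNzRingType) (F g z p q f : A) (n : nat).
Hypothesis congr_Fg : F - g = z * p ^+ n.+1.

Lemma congruence_shift : g + z * p ^+ n * p = F.
Proof. by rewrite -mulrA -exprSr -congr_Fg addrC subrK. Qed.

Lemma congruence_remainder : F - (q + z * p ^+ n) * p + f * p = g - q * p + f * p.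
Proof.
rewrite mulrDl -mulrA -exprSr -congr_Fg; congr (_ + _).
by rewrite opprD opprB addrCA [F + _]addrC subrK addrC.
Qed.

End CongruenceStep.

Section LeadDivision.
Variables (R : realType) (d : nat) (B : R).
Hypothesis B_ge1 : 1 <= B.
Local Notation C := R[i].
Local Notation pw := (ser nat C).
Local Notation chart := (proj_line C -> pw).
Local Notation I := (nat * expo d)%type.
Local Notation ps := (ser (expo d.+2) C).
Let b : C := B%:C.

Lemma pullback0 : pullback B (0 : ps) = 0.
Proof. by rewrite -(subrr (0 : ps)) pullbackB subrr. Qed.

Lemma pullbackD (F G : ps) : pullback B (F + G) = pullback B F + pullback B G.
Proof.
have -> : F + G = F - (0 - G) by rewrite sub0r opprK.
by rewrite !pullbackB pullback0 sub0r opprK.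
Qed.

(** The forms: the coefficients that occur in the pull back of a series. *)
Definition is_form (m : I) (x : chart) : Prop := exists F : ps, pullback B F = mono m x.

Lemma is_form_restrict (F : ps) m : is_form m (pullback B F m).
Proof.
exists (fun k => if expo_blow k == m then F k else 0); apply/funext => i.
rewrite /mono /pullback; case: eqP => [->|im].
  rewrite big_seq [RHS]big_seq; apply: eq_bigr => k.
  by rewrite mem_blow_fiber => ->.
rewrite big_seq big1// => k; rewrite mem_blow_fiber => /eqP ki; rewrite ki.
by case: eqP => [//|_]; rewrite const0 mul0r.
Qed.

Lemma is_formP m x : is_form m x <->
  exists2 h : {poly C}, (size h <= m.1.+1)%N & x = form B m.1 h.
Proof.
split=> [[F Fx]|[h hm ->]].
  exists (\poly_(j < m.1.+1) F (expo_mk (m.1 - j) j m.2)); first exact: size_poly.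
  by rewrite -pullback_form Fx /mono eqxx.
rewrite (_ : form B m.1 h =
  pullback B (fun k : expo d.+2 => h`_(k (ord_snd d))) m); first exact: is_form_restrict.
rewrite pullback_form; congr form; apply/polyP => j; rewrite coef_poly expo_mk_snd.
by case: ltnP => // jm; rewrite nth_default// (leq_trans hm).
Qed.

Lemma is_form_choice (q : ser I chart) :
  (forall m, is_form m (q m)) -> exists Q : ps, pullback B Q = q.
Proof.
move=> /choice[F hF]; exists (fun k => F (expo_blow k) k); apply/funext => i.
transitivity (pullback B (F i) i); last by rewrite hF /mono eqxx.
rewrite /pullback big_seq [RHS]big_seq; apply: eq_bigr => k.
by rewrite mem_blow_fiber => /eqP ->.
Qed.

Variables (zs : seq (proj_line C)) (c : C) (m0 : I).
Hypothesis c_neq0 : c != 0.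
Hypothesis size_zs : size zs = m0.1.

Definition divide_lead (m : I) (x : chart) : chart :=
  const c^-1 * divide_seq B zs (m.1 + m0.1) x.

Lemma divide_leadB m x y : divide_lead m (x - y) = divide_lead m x - divide_lead m y.
Proof. by rewrite /divide_lead divide_seqB mulrBr. Qed.

Lemma divide_leadK m x :
  divide_lead m (x * (const c * \prod_(z <- zs) vanish_at B z)) = x.
Proof.
rewrite /divide_lead [x * _]mulrC -mulrA mulrCA divide_seqK// mulrA -constM.
by rewrite mulVf// const1 mul1r.
Qed.

Lemma divide_lead_form m x : is_form (m + m0) x -> is_form m (divide_lead m x).
Proof.
move=> /is_formP[h hm ->]; apply/is_formP; rewrite /divide_lead /=.
have [|k hk] := @divide_seq_form R B B_ge1 zs m.1 h; rewrite size_zs//.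
move=> /= ->; exists (c^-1 *: k); first exact: leq_trans (size_scale_leq _ _) hk.
by rewrite formZ.
Qed.

(** * Successive approximation *)

Variables (P : ps) (K : R) (L : {additive expo d -> R}).
Hypothesis P_lead : pullback B P m0 = const c * \prod_(z <- zs) vanish_at B z.
Hypotheses (K_gt0 : 0 < K) (L_ge0 : forall a, 0 <= L a).

Definition blow_weight (m : I) : R := m.1%:R + K * L m.2.

Lemma blow_weight_ge0 m : 0 <= blow_weight m.
Proof. by rewrite addr_ge0// mulr_ge0// ltW. Qed.

Lemma blow_weight0 : blow_weight 0 = 0.
Proof.
by rewrite /blow_weight [_.2](_ : _ = 0)// [_.1](_ : _ = 0%N)// (raddf0 L) mulr0 addr0.
Qed.

Lemma blow_weightD m n : blow_weight (m + n) = blow_weight m + blow_weight n.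
Proof.
rewrite /blow_weight [(m + n).1](_ : _ = (m.1 + n.1)%N)// [(m + n).2](_ : _ = m.2 + n.2)//.
by rewrite natrD (raddfD L) mulrDr addrACA.
Qed.

Hypothesis P_gap : forall m, pullback B P m != 0 -> m != m0 ->
  blow_weight m0 + 1 <= blow_weight m.

Section ExpWeight.
Variable T : R.
Let wexp (m : I) : R := expR (- T * blow_weight m).
Lemma exp_weight_ge0 m : 0 <= wexp m. Proof. exact: expR_ge0. Qed.
Lemma exp_weight0 : wexp 0 = 1.
Proof. by rewrite /wexp blow_weight0 mulr0 expR0. Qed.
Lemma exp_weightD m n : wexp (m + n) = wexp m * wexp n.
Proof. by rewrite /wexp blow_weightD mulrDr expRD. Qed.
Definition exp_weight : weight R I := Weight exp_weight_ge0 exp_weight0 exp_weightD.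
End ExpWeight.

Variables (nb : normBound R chart) (C1 T S : R) (p : I -> R).
Hypothesis C1_gt0 : 0 < C1.
Hypothesis divide_lead_nb : forall m x y, nb x y -> nb (divide_lead m x) (C1 * y).
Let w := exp_weight T.
Hypothesis P_nb : forall m, nb (pullback B P m) (p m).
Hypothesis p_sum : forall s, uniq s -> \sum_(m <- s) p m * w m <= S.
Hypothesis p_small : forall s, uniq s -> m0 \notin s ->
  \sum_(m <- s) p m * w m <= w m0 / (2 * C1).

Definition quotient_bound : R := 2 * C1 / w m0.
Definition approx_bound : R := 1 + 2 * quotient_bound * S.

Lemma w_m0_gt0 : 0 < w m0. Proof. exact: expR_gt0. Qed.
Lemma quotient_bound_ge0 : 0 <= quotient_bound.
Proof. by rewrite divr_ge0 ?(ltW w_m0_gt0)// mulr_ge0// ltW. Qed.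
Lemma S_ge0 : 0 <= S.
Proof. by have := p_sum (isT : uniq [::]); rewrite big_nil. Qed.
Lemma approx_bound_ge1 : 1 <= approx_bound.
Proof.
rewrite lerDl; apply: mulr_ge0 S_ge0.
by apply: mulr_ge0 quotient_bound_ge0.
Qed.

(** The remainder of the division depends only on the class modulo [P]; it is
    therefore the pull back of a series, as the remainder of a pull back, and
    bounded, as the remainder of a bounded series. Each of the [n] steps costs a
    constant factor, and no radius shrinks. *)
Lemma approximation n (F : ps) (g z : ser I chart) x :
  pullback B F - g = z * pullback B P ^+ n -> ser_nb nb w g x ->
  exists2 f : ps, exists h, f - F = P ^+ n * h &
    ser_nb nb w (pullback B f) (approx_bound ^+ n * x).
Proof.
elim: n F g z x => [|n IH] F g z x Fg gx.
  exists 0; first by exists (0 - F); rewrite expr0 mul1r.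
  by rewrite pullback0; apply: ser_nb_le (ser_nb0 _ _) _; rewrite expr0 mul1r (ser_nb_ge0 gx).
set PP := pullback B P in Fg.
have tauP m y : divide_lead m (y * PP m0) = y by rewrite /PP P_lead divide_leadK.
have [q qg] := quotient_exists blow_weight_ge0 blow_weightD ltr01 P_gap divide_leadB tauP g.
have qx : ser_nb nb w q (quotient_bound * x).
  exact: (quotient_nb blow_weight_ge0 blow_weightD ltr01 P_gap divide_leadB tauP C1_gt0
    divide_lead_nb w_m0_gt0 P_nb p_small gx qg).
have qF : is_quotient m0 PP divide_lead (pullback B F) (q + z * PP ^+ n).
  by have := quotientD (z * PP ^+ n) qg; rewrite (congruence_shift Fg).
have [|Q QE] := @is_form_choice (q + z * PP ^+ n).
  apply: (quotient_closed blow_weight_ge0 blow_weightD ltr01 P_gap divide_leadB tauP _ _ _ _ _ _ _ qF).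
  - by move=> m y y' [G hG] [G' hG']; exists (G + G'); rewrite pullbackD hG hG' monoD.
  - by move=> m y [G hG]; exists (0 - G); rewrite pullbackB pullback0 hG monoN sub0r.
  - move=> m; exists 0; rewrite pullback0; apply/funext => i.
    by rewrite /mono; case: eqP.
  - by move=> m k y y' [G hG] [G' hG']; exists (G * G'); rewrite pullbackM hG hG' monoM.
  - exact: divide_lead_form.
  - exact: is_form_restrict.
  - exact: is_form_restrict.
have [||f' [h fh] f'x] := IH Q q z (quotient_bound * x).
  by rewrite QE; apply/eqP; rewrite subr_eq addrC.
  exact: qx.
exists (F - Q * P + f' * P).
  exists h; rewrite exprSr -mulrA [P * h]mulrC mulrA -fh mulrBl.
  by rewrite addrC addrA addrAC -addrA addrC; ring.
have -> : pullback B (F - Q * P + f' * P) = g - q * PP + pullback B f' * PP.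
  by rewrite pullbackD pullbackB !pullbackM QE; exact: congruence_remainder.
have Px : ser_nb nb w PP S by exists p.
have x0 := ser_nb_ge0 gx.
have h1 := ser_nbD (ser_nbD gx (ser_nbN (ser_nbM qx Px))) (ser_nbM f'x Px).
apply: ser_nb_le h1 _; rewrite exprS.
have a1 : 1 <= approx_bound ^+ n by rewrite exprn_ege1// approx_bound_ge1.
move: (approx_bound ^+ n) a1 => a a1; rewrite /approx_bound.
have q0 := quotient_bound_ge0; have S0 := S_ge0.
have y0 : 0 <= quotient_bound * x * S by exact: mulr_ge0 (mulr_ge0 q0 x0) S0.
rewrite (_ : (1 + 2 * quotient_bound * S) * a * x =
  a * x + 2 * a * (quotient_bound * x * S)); last by ring.
rewrite (_ : a * (quotient_bound * x) * S = a * (quotient_bound * x * S)); last by ring.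
have h2 : x <= a * x by rewrite ler_peMl.
have h3 : quotient_bound * x * S <= a * (quotient_bound * x * S) by rewrite ler_peMl.
by lra.
Qed.

End LeadDivision.

(** * Comparison of the norms *)

Section WeightEstimates.
Variables (R : realType) (d : nat) (L : {additive expo d -> R}).
Hypothesis L_ge0 : forall m, 0 <= L m.
Hypothesis L_inj : injective L.
Variables (K : R) (K_gt0 : 0 < K).
Local Notation C := R[i].
Local Notation I := (nat * expo d)%type.
Let W := blow_weight K L.

Definition blow_deg (i : I) : nat := (i.1 + expo_deg i.2)%N.

Lemma blow_degE (m : expo d.+2) : blow_deg (expo_blow m) = expo_deg m.
Proof.
rewrite /blow_deg /= /expo_deg 2!big_ord_recl addnA.
have -> : ord0 = ord_fst d by apply/val_inj.
have -> : lift (ord_fst d) ord0 = ord_snd d by apply/val_inj.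
congr (_ + _)%N; apply: eq_bigr => k _; rewrite ffunE; congr (m _); exact/val_inj.
Qed.

Lemma L_expand (a : expo d) : L a = \sum_k (a k)%:R * L (expo_unit k).
Proof.
have {1}-> : a = \sum_k expo_unit k *+ a k.
  apply/ffunP => j; rewrite sum_ffunE (bigD1 j)//= big1 ?addr0 => [|k kj].
    by rewrite ffunMnE ffunE eqxx -[LHS]natn.
  by rewrite ffunMnE ffunE eq_sym (negPf kj) mul0rn.
by rewrite raddf_sum; apply: eq_bigr => k _; rewrite raddfMn mulr_natl.
Qed.

Lemma blow_weight_lower : exists2 omega, 0 < omega & forall i, omega * (blow_deg i)%:R <= W i.
Proof.
have [||D D0 hD] := @uniform_radius R _ (fun k D => D <= K * L (expo_unit k)) (enum 'I_d).
- by move=> k D D' h _ h'; apply: le_trans h.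
- by move=> k _; exists (K * L (expo_unit k)) => //; rewrite mulr_gt0// L_unit_gt0.
have m0 : 0 < Order.min 1 D by rewrite lt_min ltr01.
exists (Order.min 1 D) => // -[n a]; rewrite /W /blow_weight /blow_deg /= natrD mulrDr.
apply: lerD; first by rewrite ler_piMl ?ler0n// ge_min lexx.
rewrite L_expand /expo_deg natr_sum !big_distrr /=; apply: ler_sum => k _.
rewrite [leRHS]mulrCA [leLHS]mulrC ler_wpM2l ?ler0n//.
by apply: le_trans (hD k _); rewrite ?mem_enum// ge_min lexx orbT.
Qed.

Lemma blow_weight_upper : exists2 Omega, 0 < Omega & forall i, W i <= Omega * (blow_deg i)%:R.
Proof.
have [||D D0 hD] := @uniform_bound R _ (fun k D => K * L (expo_unit k) <= D) (enum 'I_d).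
- by move=> k D D' h h'; apply: le_trans h'.
- by move=> k _; exists (K * L (expo_unit k)) => //; rewrite mulr_gt0// L_unit_gt0.
exists (1 + D); first exact: addr_gt0.
move=> [n a]; rewrite /W /blow_weight /blow_deg /= natrD mulrDr.
apply: lerD; first by rewrite ler_peMl ?ler0n// lerDl ltW.
rewrite L_expand /expo_deg natr_sum !big_distrr /=; apply: ler_sum => k _.
rewrite [leLHS]mulrCA [leRHS]mulrC ler_wpM2l ?ler0n//.
by apply: le_trans (hD k _) _; rewrite ?mem_enum// lerDr.
Qed.

Lemma expRN_le (y : R) : 0 < y -> expR (- y) <= y^-1.
Proof.
move=> y0; rewrite expRN lef_pV2 ?posrE ?expR_gt0//.
by apply: le_trans (expR_ge1Dx y); rewrite lerDr.
Qed.

Lemma exp_weight_le theta : 0 < theta -> exists2 T0, 0 < T0 &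
  forall T i, T0 <= T -> expR (- T * W i) <= theta ^+ blow_deg i.
Proof.
move=> th0; have [om om0 hom] := blow_weight_lower.
exists (om * theta)^-1; first by rewrite invr_gt0 mulr_gt0.
move=> T i hT; have T0 : 0 < T by apply: lt_le_trans hT; rewrite invr_gt0 mulr_gt0.
apply: (@le_trans _ _ (expR (- (T * om)) ^+ blow_deg i)).
  rewrite -expRM_natr ler_expR !mulNr lerN2 -mulrA.
  by rewrite ler_wpM2l// ltW.
apply: lerXn2r; rewrite ?nnegrE ?expR_ge0 ?(ltW th0)//.
apply: le_trans (expRN_le _) _; first by rewrite mulr_gt0.
rewrite -[leRHS]invrK lef_pV2 ?posrE ?invr_gt0 ?mulr_gt0//.
by move: hT; rewrite invfM [om^-1 * _]mulrC ler_pdivrMr.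
Qed.

Lemma blow_deg_sum (s : seq I) : uniq s ->
  \sum_(i <- s) (2^-1 : R) ^+ blow_deg i <= 2 ^+ d.+2.
Proof.
move=> us; apply: le_trans (@geometric_sum_le R d.+2 [seq expo_mk i.1 0 i.2 | i <- s] _).
  rewrite big_map le_eqVlt; apply/orP; left; apply/eqP; apply: eq_bigr => i _.
  by rewrite -blow_degE /blow_deg /= expo_mk_fst expo_mk_snd expo_mk_tail addn0.
rewrite map_inj_uniq// => -[n a] [n' a'] /= e.
have := congr1 (fun m : expo d.+2 => m (ord_fst d)) e; rewrite !expo_mk_fst => ->.
by have := congr1 (@expo_tail d) e; rewrite !expo_mk_tail => ->.
Qed.

Lemma blow_fiber_sum (s : seq I) (F : expo d.+2 -> R) : uniq s ->
  exists2 t, uniq t & \sum_(i <- s) \sum_(m <- blow_fiber i) F m = \sum_(m <- t) F m.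
Proof.
move=> us; exists [seq m | i <- s, m <- blow_fiber i]; last by rewrite big_allpairs_dep.
apply: allpairs_uniq_dep => // [i _|]; first exact: blow_fiber_uniq.
move=> [i m] [i' m'] /allpairsPdep[? [? [_ + [? ?]]]] /allpairsPdep[? [? [_ + [? ?]]]].
by subst; rewrite !mem_blow_fiber /= => /eqP<- /eqP<- ->.
Qed.

Variables (P : fps C d.+2) (M r : R).
Hypothesis r_gt0 : 0 < r.
Hypothesis PM : coef_bounded P M r.

(** A bound for the norm of the coefficient [pullback B P i] in all charts. *)
Definition fiber_norm (i : I) : R := \sum_(m <- blow_fiber i) cabs (P m).

Lemma fiber_norm_ge0 i : 0 <= fiber_norm i.
Proof. by apply: sumr_ge0 => m _; exact: cabs_ge0. Qed.

Lemma fiber_norm_sum T : (forall i, expR (- T * W i) <= (r / 2) ^+ blow_deg i) ->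
  forall s, uniq s -> \sum_(i <- s) fiber_norm i * expR (- T * W i) <= M * 2 ^+ d.+2.
Proof.
move=> hT s us; have M0 := coef_bounded_ge0 r_gt0 PM.
have [t ut tE] := blow_fiber_sum (fun m => M * 2^-1 ^+ expo_deg m) us.
apply: (@le_trans _ _ (\sum_(m <- t) M * 2^-1 ^+ expo_deg m)); last first.
  by rewrite -big_distrr /= ler_wpM2l// geometric_sum_le.
rewrite -tE; apply: ler_sum => i _; rewrite /fiber_norm big_distrl /=.
rewrite big_seq [leRHS]big_seq; apply: ler_sum => m; rewrite mem_blow_fiber => /eqP <-.
apply: (@le_trans _ _ (cabs (P m) * (r / 2) ^+ blow_deg (expo_blow m))).
  by rewrite ler_wpM2l ?cabs_ge0.
rewrite blow_degE exprMn mulrA ler_wpM2r ?exprn_ge0 ?invr_ge0//; exact: PM.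
Qed.

Variables (i0 : I) (C1 : R).
Hypothesis C1_gt0 : 0 < C1.
Hypothesis gap : forall m, P m != 0 -> expo_blow m != i0 -> W i0 + 1 <= W (expo_blow m).

(** A series becomes small with respect to its dominant term when the radii of
    the remaining variables shrink along the curve given by the weights. *)
Lemma small_radius (T2 : R) : exists T, [/\ T2 <= T,
  (forall s, uniq s -> \sum_(i <- s) fiber_norm i * expR (- T * W i) <= M * 2 ^+ d.+2) &
  (forall s, uniq s -> i0 \notin s ->
   \sum_(i <- s) fiber_norm i * expR (- T * W i) <= expR (- T * W i0) / (2 * C1))].
Proof.
have [T0 T00 hT0] : exists2 T0, 0 < T0 &
    forall T i, T0 <= T -> expR (- T * W i) <= (r / 2) ^+ blow_deg i.
  by apply: exp_weight_le; rewrite divr_gt0.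
pose T3 := T0 + `|T2|; have T30 : T0 <= T3 by rewrite lerDl.
have M0 := coef_bounded_ge0 r_gt0 PM.
pose S0 := M * 2 ^+ d.+2 + 1.
have S00 : 0 < S0 by apply: ltr_wpDl => //; apply: mulr_ge0 => //; exact: exprn_ge0.
pose th := expR (- T3 * W i0) / (2 * C1 * S0).
have th0 : 0 < th.
  by apply: divr_gt0; rewrite ?expR_gt0//; apply: mulr_gt0 S00; rewrite mulr_gt0.
have thi0 : 0 < th^-1 by rewrite invr_gt0.
have h3 := fiber_norm_sum (fun i => hT0 T3 i T30).
have TT : T0 <= T3 + th^-1 by apply: le_trans T30 _; rewrite lerDl ltW.
exists (T3 + th^-1); split.
- by have := ler_norm T2; rewrite /T3; lra.
- by apply: fiber_norm_sum => i; exact: hT0.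
move=> s us i0s.
apply: (@le_trans _ _ (expR (- th^-1 * (W i0 + 1)) *
    \sum_(i <- s) fiber_norm i * expR (- T3 * W i))).
  rewrite big_distrr /= big_seq [leRHS]big_seq; apply: ler_sum => i si.
  have [->|] := eqVneq (fiber_norm i) 0; first by rewrite !mul0r mulr0.
  move=> fi; have [m [mi Pm]] : exists m, m \in blow_fiber i /\ P m != 0.
    apply: contrapT => none; case/eqP: fi; rewrite /fiber_norm big_seq big1// => m mi.
    by rewrite (_ : P m = 0) ?cabs0//; apply: contrapT => /eqP Pm; apply: none; exists m.
  rewrite mulrCA ler_wpM2l ?fiber_norm_ge0// -expRD ler_expR.
  have : W i0 + 1 <= W i.
    move: mi; rewrite mem_blow_fiber => /eqP mi; rewrite -mi; apply: gap => //.
    by rewrite mi; apply: contraNneq i0s => <-.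
  by move=> /(ler_wpM2l (ltW thi0)); lra.
apply: (@le_trans _ _ (expR (- th^-1 * (W i0 + 1)) * S0)).
  by rewrite ler_wpM2l ?expR_ge0//; apply: le_trans (h3 s us) _; rewrite lerDl.
have e0 : expR (- th^-1 * (W i0 + 1)) = expR (- th^-1 * W i0) * expR (- th^-1).
  by rewrite -expRD; congr expR; ring.
have e1 : expR (- (T3 + th^-1) * W i0) = expR (- th^-1 * W i0) * expR (- T3 * W i0).
  by rewrite -expRD; congr expR; ring.
have e2 : expR (- th^-1) <= th by apply: le_trans (expRN_le thi0) _; rewrite invrK.
rewrite e0 e1 -!mulrA ler_wpM2l ?expR_ge0//.
apply: (@le_trans _ _ (th * S0)); first by rewrite ler_wpM2r// ltW.
rewrite /th le_eqVlt; apply/orP; left; apply/eqP; field.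
by rewrite !gt_eqF.
Qed.

End WeightEstimates.

Section FormCoefficients.
Variables (R : realType) (B : R).
Hypothesis B_ge1 : 1 <= B.
Local Notation C := R[i].
Local Notation pw := (ser nat C).
Implicit Types (h q : {poly C}).

Definition poly_ser q : pw := fun j => q`_j.

Lemma poly_serM p q : poly_ser (p * q) = poly_ser p * poly_ser q.
Proof. by apply/funext => n; rewrite pwM /poly_ser coefM. Qed.

Lemma poly_serD p q : poly_ser (p + q) = poly_ser p + poly_ser q.
Proof. by apply/funext => n; rewrite serD /poly_ser coefD. Qed.

Lemma poly_ser0 : poly_ser 0 = 0.
Proof. by apply/funext => n; rewrite /poly_ser coef0. Qed.

Lemma poly_ser1 : poly_ser 1 = 1.
Proof. by apply/funext => n; rewrite /poly_ser coef1 ser1. Qed.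

Lemma poly_serX q n : poly_ser (q ^+ n) = poly_ser q ^+ n.
Proof. by elim: n => [|n IH]; rewrite ?expr0 ?poly_ser1// !exprS poly_serM IH. Qed.

Lemma poly_ser_lin (a b : C) : poly_ser (a%:P + b *: 'X) = pw_lin a b.
Proof.
apply/funext => j; rewrite /poly_ser coefD coefC coefZ coefX.
by case: j => [|[|j]]; rewrite /= ?mulr0 ?mulr1 ?addr0 ?add0r.
Qed.

(** A form of degree [n] is controlled by its expansion at any single point: in a
    finite chart, translate the point back to the origin. *)
Lemma form_coef_le (eps : R) (eps_gt0 : 0 < eps) (eps_le1 : eps <= 1) xi :
  exists2 D, 1 <= D & forall n h y, (size h <= n.+1)%N ->
    pw_nb eps_gt0 (form B n h xi) y -> forall j, (j <= n)%N -> cabs h`_j <= y * D ^+ n.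
Proof.
have B0 : 0 < B by exact: lt_le_trans B_ge1.
have powE (f : proj_line C -> pw) (k : nat) z : (f ^+ k) z = f z ^+ k.
  by elim: k => [|k IH]; rewrite ?expr0// !exprS chartM IH.
have formE n h z : form B n h z =
    \sum_(j < n.+1) pw_lin h`_j 0 * coordX B z ^+ (n - j) * coordY B z ^+ j.
  by rewrite /form fct_sumE; apply: eq_bigr => j _; rewrite !chartM !powE const_linE.
case: xi => [c|]; last first.
  exists eps^-1; first by rewrite invf_ge1.
  move=> n h y hn hy j jn.
  have := pw_nb_coef (n - j)%N hy; rewrite formE ser_sumE /=.
  have oneE : pw_lin 1 0 = 1 :> pw by apply/funext => -[|[|i]].
  have powX k i : (pw_lin 0 1 ^+ k : pw) i = (i == k)%:R.
    have -> : pw_lin 0 1 = mono 1%N 1 :> pw by apply/funext => -[|[|l]].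
    rewrite monoX expr1n [(1%N *+ k)%R](_ : _ = k); last first.
      by rewrite -[LHS]/(1 *+ k)%R natn.
    by rewrite /mono; case: eqP.
  rewrite (bigD1 (inord j))//= inordK ?ltnS// big1 ?addr0 => [|i ij]; last first.
    rewrite oneE expr1n mulr1 const_mulE powX; case: eqP => [e|]; last by rewrite mulr0.
    case/eqP: ij; apply/val_inj; rewrite /= inordK ?ltnS//.
    by have := ltn_ord i; lia.
  rewrite oneE expr1n mulr1 const_mulE powX eqxx mulr1 => hj.
  rewrite exprVn ler_pdivlMr ?exprn_gt0//; apply: le_trans hj.
  by rewrite ler_wpM2l ?cabs_ge0// ler_wiXn2l ?(ltW eps_gt0)// leq_subr.
have c0 := cabs_ge0 c.
exists (2 * (B * ((1 + cabs c) / eps))).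
  have h1 : 1 <= (1 + cabs c) / eps by rewrite ler_pdivlMr// mul1r; lra.
  have h2 : 1 <= B * ((1 + cabs c) / eps) by exact: mulr_ege1.
  by lra.
move=> n h y hn hy j jn.
pose b : C := (B%:C)^-1.
pose q := h \Po ('X + c%:P).
have fE : form B n h (Some c) = poly_ser (b ^+ n *: q).
  rewrite formE /q comp_polyE -(big_mkord xpredT (fun i => h`_i *: ('X + c%:P) ^+ i)).
  have -> : \sum_(0 <= i < size h) h`_i *: ('X + c%:P) ^+ i =
      \sum_(0 <= i < n.+1) h`_i *: ('X + c%:P) ^+ i.
    rewrite [RHS](big_cat_nat (n := size h))//= [X in _ = _ + X]big_nat_cond.
    rewrite [X in _ = _ + X]big1 ?addr0// => i /andP[/andP[hi _] _].
    by rewrite nth_default// scale0r.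
  rewrite big_mkord scaler_sumr (big_morph poly_ser poly_serD poly_ser0).
  apply: eq_bigr => i _; have ni : (i <= n)%N by rewrite -ltnS.
  rewrite /coordX /coordY -!poly_ser_lin -!poly_serX -!poly_serM; congr poly_ser.
  rewrite !scale0r !addr0 -rmorphXn /=.
  have -> : (c / B%:C)%:P + (B%:C)^-1 *: 'X = b *: ('X + c%:P) :> {poly C}.
    by rewrite scalerDr -!mul_polyC -polyCM addrC mulrC [b * c]mulrC.
  rewrite exprZn -!mul_polyC !mulrA -!polyCM; congr (_%:P * _).
  by rewrite -/b -mulrA -exprD subnK// mulrC.
have hq : h = q \Po ('X - c%:P).
  by rewrite /q -comp_polyA comp_polyD comp_polyX comp_polyC subrK comp_polyXr.
have y0 : 0 <= y := nb_ge0 hy.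
have qb i : cabs q`_i <= y * B ^+ n / eps ^+ i.
  rewrite ler_pdivlMr ?exprn_gt0//.
  have := pw_nb_coef i hy; rewrite fE /poly_ser coefZ cabsM cabsX cabsV cabs_real ?(ltW B0)//.
  by rewrite -mulrA exprVn ler_pdivrMl ?exprn_gt0// [B ^+ n * y]mulrC.
have xb i l : cabs (('X - c%:P : {poly C}) ^+ i)`_l <= (1 + cabs c) ^+ i.
  have nbX1 : pw_nb (ltr01 : 0 < 1 :> R) (poly_ser ('X - c%:P)) (1 + cabs c).
    have -> : 'X - c%:P = (- c)%:P + 1 *: 'X :> {poly C}.
      by rewrite scale1r polyCN addrC.
    rewrite poly_ser_lin; apply: nb_le (pw_nb_lin _ _ _) _.
    by rewrite cabsN cabs1 mul1r addrC.
  have := pw_nb_coef l (nbX i nbX1); rewrite expr1n mulr1 -poly_serX.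
  exact.
have sq : (size q <= n.+1)%N.
  have -> : q = h \Po ('X - (- c)%:P) by rewrite polyCN opprK.
  by rewrite size_comp_poly2 ?size_XsubC.
rewrite hq comp_polyE coef_sum; apply: le_trans (cabs_sum _ _ _) _.
apply: (@le_trans _ _ (\sum_(i < size q) y * (B * ((1 + cabs c) / eps)) ^+ n)).
  apply: ler_sum => i _; rewrite coefZ cabsM.
  apply: (@le_trans _ _ (y * B ^+ n / eps ^+ i * (1 + cabs c) ^+ i)).
    by apply: ler_pM; rewrite ?cabs_ge0.
  rewrite -!mulrA ler_wpM2l// exprMn ler_wpM2l ?exprn_ge0 ?(ltW B0)//.
  rewrite mulrC -expr_div_n; apply: ler_weXn2l.
    by rewrite ler_pdivlMr// mul1r; lra.
  by rewrite -ltnS (leq_trans (ltn_ord i)).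
have X0 : 0 <= B * ((1 + cabs c) / eps).
  by rewrite mulr_ge0 ?(ltW B0)// divr_ge0 ?(ltW eps_gt0)//; lra.
move: (B * ((1 + cabs c) / eps)) X0 => X X0.
rewrite sumr_const card_ord -[leLHS]mulr_natr.
have -> : y * (2 * X) ^+ n = y * X ^+ n * 2 ^+ n by rewrite exprMn; ring.
rewrite ler_wpM2l ?mulr_ge0 ?exprn_ge0// -natrX ler_nat.
by apply: leq_trans sq _; exact: ltn_expl.
Qed.

End FormCoefficients.

(** * Gevrey series *)

Section GevreyCoefficients.
Variables (R : realType) (d : nat).
Local Notation C := R[i].
Implicit Types (Q fhat J : fps C d) (s D : R).

Lemma coef_bounded_le J M M' r r' : coef_bounded J M r -> M <= M' -> 0 <= r' <= r ->
  coef_bounded J M' r'.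
Proof.
move=> JM MM' /andP[r0 rr'] m; apply: le_trans MM'; apply: le_trans (JM m).
by rewrite ler_wpM2l ?cabs_ge0// lerXn2r ?nnegrE// (le_trans r0).
Qed.

Lemma Gamma_ge0 (x : R) : 0 <= Gamma x.
Proof. by apply: Rintegral_ge0 => t _; rewrite mulr_ge0 ?powR_ge0 ?expR_ge0. Qed.

(** A description of Gevrey series by the coefficients of the approximating
    series only, with a single constant. *)
Definition gevrey_coef Q s fhat D : Prop :=
  forall n, exists2 J, coef_bounded J (D * D ^+ n * Gamma (s * n%:R + 1)) D^-1 &
    fps_congr (fpsXn Q n) J fhat.

Lemma gevrey_coef_le Q s fhat D D' : 0 < D -> D <= D' ->
  gevrey_coef Q s fhat D -> gevrey_coef Q s fhat D'.
Proof.
move=> D0 DD' h n; have [J JD Jf] := h n; exists J => //.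
have D'0 : 0 < D' by exact: lt_le_trans DD'.
apply: coef_bounded_le JD _ _.
  rewrite ler_wpM2r ?Gamma_ge0//; apply: ler_pM => //; first exact: ltW.
    by rewrite exprn_ge0// ltW.
  by rewrite lerXn2r ?nnegrE ?(ltW D0) ?(ltW D'0).
by rewrite invr_ge0 ltW//= lef_pV2.
Qed.

Lemma gevrey_coef_exists Q s fhat : gevrey Q s fhat ->
  exists2 D, 0 < D & gevrey_coef Q s fhat D.
Proof.
move=> [rho [K [A [f [[rho0 K0 A0] hol fb fJ]]]]].
have h8 : 0 < (rho / 8)^-1 by rewrite invr_gt0 divr_gt0.
pose D := K + A + (rho / 8)^-1.
have KD : K <= D by rewrite /D; lra.
have AD : A <= D by rewrite /D; lra.
have rD : (rho / 8)^-1 <= D by rewrite /D; lra.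
have D0 : 0 < D by exact: lt_le_trans KD.
exists D => // n; have [J fJn Jf] := fJ n; exists J => //.
have [holn _] := hol n.
apply: coef_bounded_le (cauchy_estimate rho0 holn (fb n) fJn) _ _.
  rewrite ler_wpM2r ?Gamma_ge0//; apply: ler_pM => //; rewrite ?exprn_ge0 ?(ltW K0) ?(ltW A0)//.
  by rewrite lerXn2r ?nnegrE ?(ltW A0) ?(ltW D0).
by rewrite invr_ge0 (ltW D0)/= -[leRHS]invrK lef_pV2 ?posrE.
Qed.

Lemma gevrey_of_coef Q s fhat D : 0 < D -> gevrey_coef Q s fhat D -> gevrey Q s fhat.
Proof.
move=> D0 h.
have /choice[J hJ] n : exists J,
    coef_bounded J (D * D ^+ n * Gamma (s * n%:R + 1)) D^-1 /\
    fps_congr (fpsXn Q n) J fhat.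
  by have [J] := h n; exists J.
have JD n := (hJ n).1; have Jf n := (hJ n).2.
have Dinv : 0 < D^-1 by rewrite invr_gt0.
have hf n := power_series_function Dinv (JD n).
have [f hfn] := choice hf.
exists (D^-1 / 4), (2 ^+ d * D), D, f; split.
- by rewrite divr_gt0 ?invr_gt0// mulr_gt0// exprn_gt0.
- move=> n; have [_ hol fb] := hfn n; split=> //.
  by exists (2 ^+ d * (D * D ^+ n * Gamma (s * n%:R + 1))).
- by move=> n x hx; have [_ _ fb] := hfn n; rewrite -!mulrA in fb *; exact: fb.
by move=> n; exists (J n) => //; have [] := hfn n.
Qed.

End GevreyCoefficients.

Section ChartBounds.
Variables (R : realType) (d : nat).
Local Notation C := R[i].

Lemma expo_deg_mk (j n : nat) (a : expo d) :
  expo_deg (expo_mk j n a) = (j + blow_deg (n, a))%N.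
Proof.
by rewrite -blow_degE /blow_deg /= expo_mk_fst expo_mk_snd expo_mk_tail addnA.
Qed.

Lemma expand_nb (J : fps C d.+2) (s : C) (x r eps : R) (eps_gt0 : 0 < eps) i :
  coef_bounded J x r -> 0 < r -> eps <= r / 2 -> cabs s <= 1 ->
  pw_nb eps_gt0 (expand s J i) (2 * x * r^-1 ^+ blow_deg i).
Proof.
move=> Jx r0 er s1; have x0 := coef_bounded_ge0 r0 Jx; apply/pw_nbP => n.
apply: (@le_trans _ _ (\sum_(j < n) (x * r^-1 ^+ blow_deg i) * 2^-1 ^+ j)); last first.
  rewrite -big_distrr /= -(mulrA 2 x) mulrC ler_wpM2r ?geometric_half_le//.
  by apply: mulr_ge0 => //; apply: exprn_ge0; rewrite invr_ge0 ltW.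
apply: ler_sum => j _; rewrite /expand cabsM cabsX.
set m := expo_mk _ _ _.
have hm : expo_deg m = (j + blow_deg i)%N by rewrite expo_deg_mk -surjective_pairing.
have s2 : cabs s ^+ i.1 <= 1 by rewrite exprn_ile1 ?cabs_ge0.
apply: (@le_trans _ _ (cabs (J m) * eps ^+ j)).
  by rewrite ler_wpM2r ?exprn_ge0 ?(ltW eps_gt0)// ler_piMl ?cabs_ge0.
apply: (@le_trans _ _ (cabs (J m) * (r / 2) ^+ j)).
  by rewrite ler_wpM2l ?cabs_ge0// lerXn2r ?nnegrE ?divr_ge0 ?(ltW r0) ?(ltW eps_gt0).
rewrite exprMn mulrA ler_wpM2r ?exprn_ge0 ?invr_ge0//.
rewrite exprVn ler_pdivlMr ?exprn_gt0// -mulrA -exprD -hm; exact: Jx.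
Qed.

Lemma pullback_nb (B eps : R) (B_ge1 : 1 <= B) (eps_gt0 : 0 < eps)
    (pts : seq (proj_line C)) (P : fps C d.+2) :
  (forall c, Some c \in pts -> cabs c + eps <= B) -> eps * B <= 1 / 2 ->
  forall i, chart_nb eps_gt0 pts (pullback B P i) (fiber_norm P i).
Proof.
move=> hc he i; rewrite /pullback /fiber_norm.
apply: nb_sum => m _; rewrite -[cabs _]mulr1; apply: nbM; first exact: const_nb.
rewrite -[1](mulr1 1) /coord_mono; apply: nbM.
  by rewrite -(expr1n _ (m (ord_fst d))); apply: nbX; exact: coordX_nb.
by rewrite -(expr1n _ (m (ord_snd d))); apply: nbX; exact: coordY_nb.
Qed.

End ChartBounds.

(** * From the charts to the base *)

Section Evaluation.
Variables (R : realType) (I : expMonoidType).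
Local Notation C := R[i].
Local Notation pw := (ser nat C).
Local Notation chart := (proj_line C -> pw).

Definition at_chart (xi : proj_line C) (G : ser I chart) : ser I pw := fun i => G i xi.

Lemma at_chartM xi G H : at_chart xi (G * H) = at_chart xi G * at_chart xi H.
Proof. by apply/funext => i; rewrite /at_chart !serM fct_sumE. Qed.

Lemma at_chart1 xi : at_chart xi 1 = 1.
Proof.
by apply/funext => i; rewrite /at_chart !ser1; case: eqP.
Qed.

Lemma at_chartX xi G n : at_chart xi (G ^+ n) = at_chart xi G ^+ n.
Proof. by elim: n => [|n IH]; rewrite ?expr0 ?at_chart1// !exprS at_chartM IH. Qed.

End Evaluation.

Lemma separation_radius (R : realType) (pts : seq (proj_line R[i])) :
  exists2 delta : R, 0 < delta & forall c e, Some c \in pts -> Some e \in pts -> c != e ->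
    delta <= cabs (c - e).
Proof.
pose Q (x y : proj_line R[i]) (D : R) :=
  match x, y with Some c, Some e => c != e -> D <= cabs (c - e) | _, _ => True end.
have Qmono x y D D' : Q x y D -> 0 < D' -> D' <= D -> Q x y D'.
  by case: x y => [c|] [e|] //= h _ D'D ce; apply: le_trans (h ce).
have Qex x y : exists2 D, 0 < D & Q x y D.
  case: x y => [c|] [e|]; try by exists 1.
  have [<-|ce] := eqVneq c e; first by exists 1 => //=; rewrite eqxx.
  by exists (cabs (c - e)) => //; rewrite cabs_gt0 subr_eq0.
have [D D0 hD] := @uniform_radius R _ (fun x D => forall y, y \in pts -> Q x y D) pts
  (fun x D D' h D'0 D'D y yp => Qmono x y D D' (h y yp) D'0 D'D)
  (fun x _ => @uniform_radius R _ (Q x) pts (Qmono x) (fun y _ => Qex x y)).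
by exists D => // c e cp ep; exact: (hD _ cp _ ep).
Qed.

Section ChartsToBase.
Variables (R : realType) (d : nat) (L : {additive expo d -> R}).
Hypothesis L_ge0 : forall m, 0 <= L m.
Hypothesis L_inj : injective L.
Local Notation C := R[i].
Local Notation I := (nat * expo d)%type.
Variables (P : fps C d.+2) (MP rP : R).
Hypothesis P_neq0 : P <> fpsC 0.
Hypotheses (rP_gt0 : 0 < rP) (P_bounded : coef_bounded P MP rP).
Variables (pts : seq (proj_line C)) (xi0 : proj_line C) (B : R).
Hypothesis xi0_pts : xi0 \in pts.
Hypothesis B_ge1 : 1 <= B.
Hypothesis B_center : forall c, Some c \in pts -> cabs c + 1 <= B.
Variables (zs : seq (proj_line C)) (lc : C).
Hypothesis size_zs : size zs = lead_deg L P.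
Hypothesis lc_neq0 : lc != 0.
Hypothesis P_factor : form B (lead_deg L P) (lead_poly L P) =
  const lc * \prod_(z <- zs) vanish_at B z.
Hypothesis zs_pts : {subset zs <= pts}.

(** The approximations in the charts form one family [g], congruent to the pull
    back of [fhat]; outside the given points [g] equals this pull back. *)
Lemma gevrey_of_charts (s D : R) (fhat : fps C d.+2) : 0 < D ->
  (forall xi, xi \in pts ->
     gevrey_coef (fps_comp P (blowup xi)) s (fps_comp fhat (blowup xi)) D) ->
  exists2 D', 0 < D' & gevrey_coef P s fhat D'.
Proof.
move=> D0 hD; have B0 : 0 < B by exact: lt_le_trans B_ge1.
have [delta delta0 hdelta] := separation_radius pts.
pose eps := Order.min (Order.min (2 * B)^-1 (delta / 2)) (D^-1 / 2).
have eps0 : 0 < eps by rewrite !lt_min !divr_gt0 ?invr_gt0 ?mulr_gt0.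
have [e1 e2 e3] : [/\ eps <= (2 * B)^-1, eps <= delta / 2 & eps <= D^-1 / 2].
  have : eps <= eps by []. by rewrite {2}/eps !le_min => /andP[/andP[-> ->] ->].
have eps_B : eps * B <= 1 / 2.
  apply: (@le_trans _ _ ((2 * B)^-1 * B)); first by rewrite ler_pM2r.
  by rewrite le_eqVlt; apply/orP; left; apply/eqP; field; rewrite gt_eqF.
have eps1 : eps <= 1.
  by apply: (@le_trans _ _ (eps * B)); [rewrite ler_peMr// ltW|lra].
have eps_center c : Some c \in pts -> cabs c + eps <= B.
  by move=> /B_center h; apply: le_trans h; rewrite lerD2l.
have eps_sep c e : Some c \in pts -> Some e \in pts -> c != e -> eps <= cabs (c - e) / 2.
  by move=> cp ep ce; apply: le_trans e2 _; rewrite ler_pM2r// hdelta.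
pose nb := chart_nb eps0 pts.
have [K K0 gap] := lead_gap L_ge0 L_inj P_neq0.
pose i0 := lead_index L P.
have [E E0 hE] := divide_seq_nb B_ge1 eps0 eps_center eps_B eps_sep zs_pts.
pose C1 := cabs lc^-1 * E.
have C10 : 0 < C1 by rewrite mulr_gt0// cabs_gt0 invr_neq0.
have tau_nb m x y : nb x y -> nb (divide_lead B zs lc i0 m x) (C1 * y).
  by move=> xy; rewrite /C1 -mulrA; apply: nbM; [exact: const_nb|exact: hE].
pose W := blow_weight K L.
have [T2 T20 hT2] : exists2 T0, 0 < T0 &
    forall T i, T0 <= T -> expR (- T * W i) <= (2 * D)^-1 ^+ blow_deg i.
  by apply: exp_weight_le => //; rewrite invr_gt0 mulr_gt0.
have [T [T2T hsum hsmall]] := small_radius L_ge0 L_inj K0 rP_gt0 P_bounded C10 gap T2.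
have T0 : 0 < T by exact: lt_le_trans T2T.
have hT i : expR (- T * W i) <= (2 * D)^-1 ^+ blow_deg i by exact: hT2.
have P_gap m : pullback B P m != 0 -> m != i0 -> W i0 + 1 <= W m.
  by move=> /pullback_neq0[k Pk <-] ki; exact: gap.
have P_nb := pullback_nb B_ge1 eps0 P eps_center eps_B.
have P_lead : pullback B P i0 = const lc * \prod_(z <- zs) vanish_at B z.
  by rewrite pullback_lead.
pose ab := approx_bound i0 K L C1 T (MP * 2 ^+ d.+2).
have [Om Om0 hOm] := blow_weight_upper L_ge0 L_inj K0.
have [D2 D21 hD2] := form_coef_le B_ge1 eps0 eps1 xi0.
have approx := approximation (m0 := i0) B_ge1 lc_neq0 size_zs P_lead K0 L_ge0 P_gap C10 tau_nb
  P_nb hsum hsmall.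

have ab1 : 1 <= ab by exact: approx_bound_ge1 C10 hsum.
pose Th := expR (T * Om) * D2.
have Th0 : 0 < Th by rewrite mulr_gt0 ?expR_gt0// (lt_le_trans ltr01 D21).
pose c2 := 2 * 2 ^+ d.+2 * D : R.
have c20 : 0 < c2 by apply: mulr_gt0 D0; apply: mulr_gt0 => //; exact: exprn_gt0.
have abD0 : 0 < ab * D by rewrite mulr_gt0// (lt_le_trans ltr01 ab1).
(* [Th] accounts for the radius of the polydisc, [c2] for the number of exponents
   of a given degree, [ab * D] for the [n] divisions. *)
pose D' := Th + c2 + ab * D.
have [h1 h2 h3] : [/\ Th <= D', c2 <= D' & ab * D <= D'].
  by rewrite /D'; split; lra.
have D'0 : 0 < D' by exact: lt_le_trans h1.
exists D' => // n.
pose G := Gamma (s * n%:R + 1); have G0 : 0 <= G := Gamma_ge0 _.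
pose x := D * D ^+ n * G.
have x0 : 0 <= x by apply: mulr_ge0 G0; rewrite mulr_ge0 ?exprn_ge0 ?(ltW D0).
have x20 : 0 <= 2 * x by apply: mulr_ge0.
have /choice[J hJ] xi : exists J, xi \in pts ->
    coef_bounded J x D^-1 /\ exists h : ser (expo d.+2) C,
    (J : ser (expo d.+2) C) - fps_comp fhat (blowup xi) =
    (fps_comp P (blowup xi) : ser (expo d.+2) C) ^+ n * h.
  have [xp|_] := boolP (xi \in pts); last by exists (fun=> 0).
  have [J JD /fps_congrE[h hh]] := hD _ xp n; exists J => _; split; first exact: JD.
  by exists h; rewrite hh fpsXnE.
have /choice[h hh] xi : exists h : ser (expo d.+2) C, xi \in pts ->
    (J xi : ser (expo d.+2) C) - fps_comp fhat (blowup xi) =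
    (fps_comp P (blowup xi) : ser (expo d.+2) C) ^+ n * h.
  have [xp|_] := boolP (xi \in pts); last by exists 0.
  by have [_ [h hE']] := hJ _ xp; exists h.
pose g : ser I (proj_line C -> ser nat C) := fun i xi =>
  if xi \in pts then expand (chart_scale B xi) (J xi) i else pullback B fhat i xi.
pose z : ser I (proj_line C -> ser nat C) := fun i xi =>
  if xi \in pts then - expand (chart_scale B xi) (h xi) i else 0.
have congr_g : pullback B fhat - g = z * pullback B P ^+ n.
  apply/funext => i; apply/funext => xi.
  rewrite -[RHS]/(at_chart xi (z * pullback B P ^+ n) i) at_chartM at_chartX.
  rewrite serB chartB /g.
  have [xp|xp] := boolP (xi \in pts); last first.
    rewrite subrr (_ : at_chart xi z = 0) ?mul0r//.
    by apply/funext => k; rewrite /at_chart /z (negPf xp).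
  have -> : at_chart xi z = - expand (chart_scale B xi) (h xi).
    by apply/funext => k; rewrite /at_chart /z xp.
  have -> : at_chart xi (pullback B P) = expand (chart_scale B xi) (fps_comp P (blowup xi)).
    by apply/funext => k; rewrite /at_chart expand_comp.
  rewrite -expandX mulrC mulrN -expandM -(hh _ xp) expandB opprB serB.
  by rewrite expand_comp.
have g_nb : ser_nb nb (exp_weight K L T) g (2 * x * 2 ^+ d.+2).
  exists (fun i => 2 * x * D ^+ blow_deg i) => [i|t ut].
    split=> [|xi xp]; first by rewrite !mulr_ge0 ?exprn_ge0 ?(ltW D0).
    rewrite /g xp; have [JD _] := hJ _ xp; rewrite -[D in D ^+ _]invrK.
    apply: expand_nb JD _ e3 _; first by rewrite invr_gt0.
    case: (xi) => [c|] /=; rewrite ?cabs1// cabsV cabs_real ?(ltW B0)//.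
    by rewrite invf_le1.
  apply: (@le_trans _ _ (\sum_(i <- t) (2 * x) * 2^-1 ^+ blow_deg i)).
    apply: ler_sum => i _; rewrite -[leLHS]mulrA ler_wpM2l//.
    apply: (@le_trans _ _ (D ^+ blow_deg i * (2 * D)^-1 ^+ blow_deg i)).
      by apply: ler_wpM2l (hT i); rewrite exprn_ge0 ?(ltW D0).
    rewrite -exprMn (_ : D * (2 * D)^-1 = 2^-1)//.
    by field; rewrite gt_eqF.
  by rewrite -big_distrr /= ler_wpM2l// blow_deg_sum.
have [f [q fq] [F fF Fsum]] := approx n fhat g z _ congr_g g_nb.
exists f; last by apply/fps_congrE; exists q; rewrite fpsXnE.
move=> m; pose i := expo_blow m.
have Fi : F i * expR (- T * W i) <= ab ^+ n * (2 * x * 2 ^+ d.+2).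
  by have := Fsum [:: i] isT; rewrite big_seq1.
have mi : (m (ord_snd d) <= i.1)%N by rewrite leq_addl.
have fm : cabs (f m) <= F i * D2 ^+ i.1.
  have [_ /(_ xi0 xi0_pts)] := fF i; rewrite pullback_form => hFi.
  have := hD2 _ _ _ (size_poly _ _) hFi _ mi.
  rewrite coef_poly ltnS mi (_ : expo_mk _ _ _ = m)//.
  by rewrite /i /= addnK expo_mkE.
have Fi0 : 0 <= F i by exact: nb_ge0 (fF i).
have wi : expR (T * W i) <= expR (T * Om) ^+ expo_deg m.
  rewrite -expRM_natr ler_expR -mulrA ler_wpM2l ?(ltW T0)// -blow_degE.
  exact: hOm.
have D2i : D2 ^+ i.1 <= D2 ^+ expo_deg m.
  by rewrite ler_weXn2l// -blow_degE leq_addr.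
have D20 : 0 <= D2 by exact: le_trans D21.
rewrite exprVn ler_pdivrMr ?exprn_gt0//.
apply: (@le_trans _ _ (ab ^+ n * (2 * x * 2 ^+ d.+2) * Th ^+ expo_deg m)).
  apply: le_trans fm _; rewrite /Th exprMn.
  have -> : F i = F i * expR (- T * W i) * expR (T * W i).
    by rewrite -mulrA -expRD mulNr addNr expR0 mulr1.
  have y0 : 0 <= F i * expR (- T * W i) := mulr_ge0 Fi0 (expR_ge0 _).
  rewrite [leRHS]mulrA; apply: ler_pM; [exact: mulr_ge0 y0 (expR_ge0 _)|exact: exprn_ge0| |exact: D2i].
  by apply: ler_pM => //; exact: expR_ge0.
apply: ler_pM.
- apply: mulr_ge0; first by rewrite exprn_ge0// (le_trans ler01 ab1).
  by apply: mulr_ge0 => //; exact: exprn_ge0.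
- by apply: exprn_ge0; exact: ltW.
- rewrite (_ : ab ^+ n * _ = c2 * (ab * D) ^+ n * G); last first.
    by rewrite /c2 /x exprMn; ring.
  rewrite -/G ler_wpM2r//; apply: ler_pM; rewrite ?exprn_ge0 ?(ltW c20) ?(ltW abD0)//.
  by rewrite lerXn2r ?nnegrE ?(ltW abD0) ?(ltW D'0).
by rewrite lerXn2r ?nnegrE ?(ltW Th0) ?(ltW D'0).
Qed.

End ChartsToBase.

Theorem theorem7p10 (R : realType) (d : nat)
  (P : fps R[i] d.+2) (P_conv : fps_convergent P)
  (P_neq0 : P <> fpsC 0) (P_0 : P 0 = 0)
  (s : R) (s_gt0 : 0 < s)
  (L : {additive expo d -> R}) (L_ge0 : forall m, 0 <= L m)
  (L_inj : injective L)
  (Z : set (proj_line R[i]))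
  (Z_nonconstant : ~ fps_constant (H_L L P) -> Z = zero_set (H_L L P))
  (Z_constant : fps_constant (H_L L P) -> exists xi, Z = [set xi])
  (fhat : fps R[i] d.+2)
  (fhat_gevrey : forall xi, Z xi ->
     gevrey (fps_comp P (blowup xi)) s (fps_comp fhat (blowup xi))) :
  gevrey P s fhat.
Proof.
have [rP rP0 [MP MP0 PM]] := convergent_coef_bounded P_conv.
have slp := size_lead_poly L P; have lp0 := lead_poly_neq0 L_ge0 L_inj P_neq0.
have [pts [xi0 [xi0p Zp factor]]] : exists (pts : seq (proj_line R[i])) xi0, [/\ xi0 \in pts,
    (forall xi, xi \in pts -> Z xi) & forall B : R, 1 <= B ->
    exists (zs : seq (proj_line R[i])) (c : R[i]), [/\ size zs = lead_deg L P, c != 0, {subset zs <= pts} &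
      form B (lead_deg L P) (lead_poly L P) = const c * \prod_(z <- zs) vanish_at B z]].
  (* The roots do not depend on the scaling [B]; any admissible value serves to find
     them, and the final one is chosen once the points are known. *)
  have [zs [c [szs c0 _ mem_zs]]] := @form_factor R 1 _ _ slp lp0.
  have [h0|h0] := eqVneq (lead_deg L P) 0%N.
    have [xi ZE] := Z_constant ((H_L_constant L_ge0 L_inj P_neq0).2 h0).
    exists [:: xi], xi; rewrite mem_head ZE; split=> // [y|B B1].
      by rewrite inE => /eqP ->.
    have [zs' [c' [szs' c'0 E' _]]] := @form_factor R B _ _ slp lp0; exists zs', c'; split=> //.
    by move: szs'; rewrite h0 => /size0nil ->.
  have ZE : Z = zero_set (H_L L P).
    by apply: Z_nonconstant => /(H_L_constant L_ge0 L_inj P_neq0)/eqP; rewrite (negPf h0).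
  case: zs szs mem_zs => [|z zs] szs mem_zs; first by rewrite -szs eqxx in h0.
  exists (z :: zs), z; rewrite mem_head; split=> // [xi|B B1].
    by rewrite mem_zs ZE; case: xi => [e|] xiz; apply/zero_set_H_L.
  have [zs' [c' [szs' c'0 E' mem_zs']]] := @form_factor R B _ _ slp lp0; exists zs', c'; split=> //.
  by move=> y; rewrite mem_zs' mem_zs.
pose Q (xi : proj_line R[i]) (D : R) := match xi with Some c => is_true (cabs c <= D) | None => True end.
have [||B0 B00 hB] := @uniform_bound R _ Q pts.
- by move=> [c|] D D' //=; exact: le_trans.
- move=> [c|] _; last by exists 1.
  by exists (cabs c + 1); rewrite ?ltr_wpDl ?cabs_ge0//= lerDl.
have B1 : 1 <= B0 + 1 by rewrite lerDr ltW.
have [zs [c [szs c0 zsp fE]]] := factor _ B1.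
pose QD xi D := 0 < D /\ gevrey_coef (fps_comp P (blowup xi)) s (fps_comp fhat (blowup xi)) D.
have [||D D0 hD] := @uniform_bound R _ QD pts.
- move=> xi D D' [D0 h] DD'; split; first exact: lt_le_trans DD'.
  exact: gevrey_coef_le h.
- by move=> xi /Zp/fhat_gevrey/gevrey_coef_exists[D D0 h]; exists D.
have [|D' D'0 h] := gevrey_of_charts L_ge0 L_inj P_neq0 rP0 PM xi0p B1 _ szs c0 fE zsp D0
  (fun xi xip => (hD xi xip).2).
  by move=> e /hB h; rewrite lerD2r.
exact: gevrey_of_coef h.
Qed.
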